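(* Let $n\ge 2$ and let $F_n$ be the free group of rank $n$. Let $FC_n$ be the partially ordered set of proper free factors of $F_n$, ordered by inclusion. Then the geometric realization $|FC_n|$ has the homotopy type of a bouquet (wedge) of spheres of dimension $n-2$.
   Context: A free factor of $F_n$ is a subgroup $A\le F_n$ such that $F_n=A*B$ for some subgroup $B\le F_n$. ''Proper free factor'' here means a free factor different from both the trivial subgroup and $F_n$. The geometric realization $|X|$ of a poset $X$ is the simplicial complex whose $k$-simplices are the chains $x_0<x_1<\cdots<x_k$ in $X$; thus a $k$-simplex of $|FC_n|$ is a flag $H_0<H_1<\cdots<H_k$ of proper free factors, each properly included in the next. *)

(* Defs.v *)
From HB Require Import structures.
From mathcomp Require Import all_boot all_order all_algebra.
From mathcomp Require Import generic_quotient.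
From mathcomp Require Import all_classical all_reals all_analysis.
From mathcomp Require Import wedge_sigT.
Import Order.TTheory GRing.Theory Num.Theory.
Import numFieldNormedType.Exports.

Set Implicit Arguments.
Unset Strict Implicit.
Unset Printing Implicit Defensive.

Local Open Scope classical_set_scope.
Local Open Scope ring_scope.

(* [(i, false)] stands for the i-th generator and [(i, true)] for its inverse. *)
Definition letter (n : nat) : Type := ('I_n * bool)%type.
HB.instance Definition _ n := Finite.on (letter n).

Definition inv_letter n (a : letter n) : letter n := (a.1, ~~ a.2).

Definition reduced n : pred (seq (letter n)) :=
  sorted (fun a b : letter n => b != inv_letter a).

Record free_group (n : nat) : Type := FreeGroup {
  word : seq (letter n);
  word_reduced : reduced word }.

HB.instance Definition _ n := [isSub for @word n].
HB.instance Definition _ n := [Choice of free_group n by <:].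

Section FreeGroup.
Context {n : nat}.
Implicit Types (a b : letter n) (u v w : seq (letter n)).

Definition lmul_letter a w : seq (letter n) :=
  if w is b :: w' then if b == inv_letter a then w' else a :: w else [:: a].

Definition mul_word u v : seq (letter n) := foldr lmul_letter v u.

Definition inv_word w : seq (letter n) := rev [seq inv_letter a | a <- w].

Lemma inv_letterK : involutive (@inv_letter n).
Proof. by case=> i e; rewrite /inv_letter /= negbK. Qed.

Lemma reduced_lmul a w : reduced w -> reduced (lmul_letter a w).
Proof.
case: w => [//|b w] rw /=; case: ifPn => [_|nb]; last by rewrite /= nb.
exact: path_sorted rw.
Qed.

Lemma reduced_mul u v : reduced v -> reduced (mul_word u v).
Proof. by move=> rv; elim: u => //= a u; exact: reduced_lmul. Qed.

Lemma reduced_inv w : reduced w -> reduced (inv_word w).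
Proof.
rewrite /reduced /inv_word rev_sorted sorted_map.
apply: sub_sorted => a b /=; apply: contraNN => /eqP.
by rewrite inv_letterK => ->.
Qed.

Lemma lmul_letterE a w : reduced (a :: w) -> lmul_letter a w = a :: w.
Proof. by case: w => //= b w /andP[/negPf->]. Qed.

Lemma lmul_letterK a w :
  reduced w -> lmul_letter a (lmul_letter (inv_letter a) w) = w.
Proof.
case: w => [|b w] rw /=; first by rewrite eqxx.
rewrite inv_letterK; case: ifPn => [/eqP bE|_]; last by rewrite /= eqxx.
by rewrite -bE; exact: lmul_letterE.
Qed.

Lemma mul_word_lmul a u v :
  reduced v -> mul_word (lmul_letter a u) v = lmul_letter a (mul_word u v).
Proof.
case: u => [//|b u] rv /=; case: ifPn => [/eqP->|//].
by rewrite lmul_letterK //; exact: reduced_mul.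
Qed.

Lemma mul_wordA u v w :
  reduced w -> mul_word u (mul_word v w) = mul_word (mul_word u v) w.
Proof. by move=> rw; elim: u => //= a u ->; rewrite mul_word_lmul. Qed.

Lemma mul_word0 u : reduced u -> mul_word u [::] = u.
Proof.
elim: u => //= a u IHu ru; rewrite IHu; last exact: path_sorted ru.
exact: lmul_letterE.
Qed.

Lemma mul_inv_word u v : reduced v -> mul_word (inv_word u) (mul_word u v) = v.
Proof.
elim: u v => //= a u IHu v rv; rewrite /inv_word /= rev_cons /mul_word foldr_rcons.
rewrite -/(mul_word u v) -[X in lmul_letter _ (lmul_letter X _)]inv_letterK.
by rewrite lmul_letterK; [exact: IHu|exact: reduced_mul].
Qed.

Lemma inv_wordK : involutive inv_word.
Proof.
by move=> w; rewrite /inv_word map_rev revK -map_comp map_id_in // => a _ /=;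
  rewrite inv_letterK.
Qed.

Definition fg_one : free_group n := FreeGroup (isT : reduced [::]).
Definition fg_mul (x y : free_group n) : free_group n :=
  FreeGroup (reduced_mul (word x) (word_reduced y)).
Definition fg_inv (x : free_group n) : free_group n :=
  FreeGroup (reduced_inv (word_reduced x)).

Lemma fg_mulA : associative fg_mul.
Proof. by move=> x y z; apply/val_inj/mul_wordA/word_reduced. Qed.

Lemma fg_mul1 : left_id fg_one fg_mul.
Proof. by move=> x; apply/val_inj. Qed.

Lemma fg_mulr1 : right_id fg_one fg_mul.
Proof. by move=> x; apply/val_inj/mul_word0/word_reduced. Qed.

Lemma fg_mulV : left_inverse fg_one fg_inv fg_mul.
Proof.
move=> x; apply/val_inj; rewrite /= -[X in mul_word _ X]mul_word0.
  exact: mul_inv_word.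
exact: word_reduced.
Qed.

Lemma fg_mulrV : right_inverse fg_one fg_inv fg_mul.
Proof.
move=> x; have invK : fg_inv (fg_inv x) = x by exact/val_inj/inv_wordK.
by rewrite -[X in fg_mul X _]invK fg_mulV.
Qed.

HB.instance Definition _ := isGroup.Build (free_group n)
  fg_mulA fg_mul1 fg_mulr1 fg_mulV fg_mulrV.

End FreeGroup.

Definition subgroup (G : groupType) (A : set G) : Prop :=
  [/\ A 1%g, forall x y, A x -> A y -> A (x * y)%g & forall x, A x -> A (x^-1)%g].

(* [G = A * B] as an internal free product: [G], with the two inclusions, is
   the coproduct of the groups [A] and [B].  A homomorphism defined on [A] is
   represented by a function on [G] of which only the values on [A] matter. *)
Definition internal_free_product (G : groupType) (A B : set G) : Prop :=
  [/\ subgroup A, subgroup B &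
   forall (H : groupType) (f g : G -> H),
     {in A &, {morph f : x y / (x * y)%g}} ->
     {in B &, {morph g : x y / (x * y)%g}} ->
     exists! h : G -> H,
       [/\ {morph h : x y / (x * y)%g}, {in A, h =1 f} & {in B, h =1 g}]].

Definition free_factor (G : groupType) (A : set G) : Prop :=
  exists B : set G, internal_free_product A B.

Definition proper_free_factor (G : groupType) (A : set G) : Prop :=
  [/\ free_factor A, A <> [set 1%g] & A <> [set: G]].

Definition FC (n : nat) : Type :=
  set_type [set A : set (free_group n) | proper_free_factor A].

HB.instance Definition _ n := SubChoice.on (FC n).
HB.instance Definition _ n :=
  [SubChoice_isSubPOrder of FC n by <: with set_display].

Lemma le_FC n (A B : FC n) : (A <= B)%O <-> val A `<=` val B.
Proof. by rewrite leEsub subsetEset. Qed.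

(* Points are given by their barycentric coordinates; for a chain [s], listed
   in increasing order, [closed_simplex R s] is the simplex with vertex set
   [s] (empty when [s] is). *)
Section GeometricRealization.
Context (R : realType) (d : Order.disp_t) (T : porderType d).

Definition chain (s : seq T) : bool := sorted <%O s.

Definition closed_simplex (s : seq T) : set (T -> R) :=
  [set p | [/\ forall x, 0 <= p x, forall x, x \notin s -> p x = 0
             & \sum_(x <- s) p x = 1]].

Definition realization : Type :=
  set_type (\bigcup_(s in [set s | chain s]) closed_simplex s).

HB.instance Definition _ := Choice.on realization.

(* The weak (CW) topology: a set is open when its trace on every closed simplex
   is open for the Euclidean topology of that simplex. *)
Definition realization_open (U : set realization) : Prop :=
  forall s : seq T, chain s ->
  forall p : realization, U p -> closed_simplex s (val p) ->
  exists2 e : R, 0 < e &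
    forall q : realization, closed_simplex s (val q) ->
      (forall x, x \in s -> `|val p x - val q x| < e) -> U q.

Lemma realization_openT : realization_open setT.
Proof. by move=> s _ p _ _; exists 1. Qed.

Lemma realization_openI : setI_closed realization_open.
Proof.
move=> U V oU oV s cs p [Up Vp] sp.
have [e e0 eU] := oU s cs p Up sp; have [k k0 kV] := oV s cs p Vp sp.
exists (Num.min e k); first by rewrite lt_min e0.
move=> q sq pq; split; [apply: eU|apply: kV] => // x xs;
  by have := pq x xs; rewrite lt_min => /andP[].
Qed.

Lemma realization_open_bigU (I : Type) (f : I -> set realization) :
  (forall i, realization_open (f i)) -> realization_open (\bigcup_i f i).
Proof.
move=> of_ s cs p [i _ fip] sp; have [e e0 ef] := of_ i s cs p fip sp.
by exists e => // q sq pq; exists i => //; exact: ef.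
Qed.

HB.instance Definition _ := isOpenTopological.Build realization
  realization_openT realization_openI realization_open_bigU.

End GeometricRealization.

Definition sphere (R : realType) (d : nat) : set 'rV[R]_d.+1 :=
  [set v | \sum_(i < d.+1) v 0 i ^+ 2 = 1].
Arguments sphere : clear implicits.

Definition sphere_base (R : realType) (d : nat) : 'rV[R]_d.+1 :=
  delta_mx 0 ord0.

Lemma sphere_base_in (R : realType) (d : nat) :
  sphere R d (sphere_base R d).
Proof.
rewrite /sphere /= /sphere_base big_ord_recl big1 => [|i _].
  by rewrite mxE !eqxx expr1n addr0.
by rewrite mxE andTb /= expr0n.
Qed.

(* The extra one-point summand [None] only supplies the base point, so that
   the bouquet over an empty index set is a point. *)
Definition bouquet_summand (R : realType) (d : nat) (I : choiceType)
    (o : option I) : set 'rV[R]_d.+1 :=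
  if o is Some _ then sphere R d else [set sphere_base R d].
Arguments bouquet_summand R d {I} o.

Lemma bouquet_base_in (R : realType) (d : nat) (I : choiceType) (o : option I) :
  bouquet_summand R d o (sphere_base R d).
Proof. by case: o => //= _; exact: sphere_base_in. Qed.

Definition bouquet_base (R : realType) (d : nat) (I : choiceType)
    (o : option I) : bouquet_summand R d o :=
  SigSub (mem_set (bouquet_base_in R d o)).

Definition bouquet (R : realType) (d : nat) (I : choiceType) :
    topologicalType :=
  wedge (bouquet_base R d (I := I)).

Definition homotopic (R : realType) (X Y : topologicalType) (f g : X -> Y) :
    Prop :=
  exists H : X * R -> Y,
    [/\ {within [set: X] `*` `[0, 1], continuous H},
        forall x, H (x, 0) = f x & forall x, H (x, 1) = g x].

Definition homotopy_equivalent (R : realType) (X Y : topologicalType) : Prop :=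
  exists (f : X -> Y) (g : Y -> X),
    [/\ continuous f, continuous g,
        homotopic R (g \o f) id & homotopic R (f \o g) id].

(* Main.v *)
(** The proof is a discrete Morse argument driven by Whitehead's peak reduction.
Order the bases of [F_n] by their cost vectors: total length first, then the
lengths of all the elements of [F_n] in a fixed enumeration, lexicographically.
Up to signed permutations distinct bases have distinct costs, and only finitely
many bases lie below a given one.  For a chain of free factors, the bases adapted
to it (those of which every factor of the chain is spanned by a part) are
connected by Whitehead moves that respect the chain, and peak reduction shows
that a basis which no such move improves is the cheapest adapted one.

Consequently the chains with a given cheapest basis [b] correspond to the chains
of proper subsets [X] of the index set such that, for each index [i], no move
multiplying by [b_i] and fixing the elements of [b] in the largest member of [X]
avoiding [i] improves [b]; that condition on a pair (subset, index) is monotone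
in the subset.  Adding greedily the first index allowed by the current subset
produces a distinguished maximal flag; a chain not containing the whole flag is
matched with another one by toggling a single subset.  The unmatched chains are
maximal, with [n - 1] members, hence of dimension [n - 2].

Following the matching, the complex minus its critical simplices contracts to a
point; as critical simplices are maximal this contraction extends over them, so
the realization is equivalent to the bouquet of the spheres obtained from them by
collapsing their boundaries. *)

Require Import Defs.
From HB Require Import structures.
From mathcomp Require Import all_boot all_order all_algebra.
From mathcomp Require Import finmap zify.

Set Implicit Arguments.
Unset Strict Implicit.
Unset Printing Implicit Defensive.

(** * The matching on chains of subsets *)

(** The matching must not change the cheapest basis of a chain, yet being cheapest is a comparison
    with infinitely many bases. Peak reduction replaces it by a test on finitely many moves, and
    this test sees a chain only through the largest member avoiding each index. Whether a subset may
    be added or removed is thus decided inside the finite set of indices. Ties between essentially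
    different bases would spoil the choice of a cheapest one; for this reason a cost records the
    length of every element and not only a total length. The poset is infinite and the ranks of
    matched pairs are unbounded, although bounded on each simplex, so the collapse has no first pair
    to start from. Each rank gets its own time interval, these intervals accumulate at time 0, and
    continuity is checked on one simplex at a time. The collapse is over at time 1/2: the other half
    of the time is needed to move the interiors of the critical simplices. The equivalence is then
    given by two explicit maps, each composite being the end of an explicit homotopy that starts at
    the identity. *)

Section SetMatching.
Context (I : finType) (good : {set I} -> pred I).
Hypothesis good_mono : forall (S S' : {set I}) i, S \subset S' -> good S i -> good S' i.
Implicit Types (S T : {set I}) (X Y : {set {set I}}).

Definition schain X := (forall S, S \in X -> S != set0 /\ S != setT) /\
  (forall S S', S \in X -> S' \in X -> (S \subset S') || (S' \subset S)).

(** In a chain this union is the largest member avoiding [i], or empty when every member contains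
    [i]. *)
Definition low X i : {set I} := \bigcup_(S in X | i \notin S) S.
Definition goodf X := forall i, good (low X i) i.

Definition next S := [pick i | (i \notin S) && good S i].
Definition greedy k := iter k (fun S => if next S is Some i then i |: S else S) set0.
(** The number of consecutive greedy sets, starting from [greedy 1], that belong to [X]; [find]
    returns [#|I|] when none of the tested ones is missing. *)
Definition depth X := find (fun j => greedy j.+1 \notin X) (iota 0 #|I|).
Definition cap X i : {set I} := \bigcap_(S in X | i \in S) S.
(** In a chain [cap X i] is the smallest member containing [i], or the full set. Removing from it
    the next greedy index gives the largest subset that can be inserted just below it without
    containing [i]. *)
Definition toggle X := if next (greedy (depth X)) is Some i then cap X i :\ i else set0.
Lemma greedyS k : greedy k.+1 = if next (greedy k) is Some i then i |: greedy k else greedy k.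
Proof. by []. Qed.

Lemma depth_lt X j : j < depth X -> greedy j.+1 \in X.
Proof.
move=> lt; have jI : j < #|I|.
  by apply: leq_trans lt _; rewrite -[X in _ <= X](size_iota 0) find_size.
by have := before_find 0 lt; rewrite nth_iota // add0n => /negbFE.
Qed.

Lemma depth_notin X : depth X < #|I| -> greedy (depth X).+1 \notin X.
Proof.
move=> lt; have : has (fun j => greedy j.+1 \notin X) (iota 0 #|I|).
  by rewrite has_find size_iota.
by move/(nth_find 0); rewrite -/(depth X) nth_iota.
Qed.

Lemma depth_greedy X : depth X = 0 \/ greedy (depth X) \in X.
Proof. by case E: (depth X) => [|k]; [left|right; apply: depth_lt; rewrite E]. Qed.

Lemma depth_le X : depth X <= #|I|.
Proof. by rewrite -[X in _ <= X](size_iota 0) find_size. Qed.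

Lemma low_sub X i S : S \in X -> i \notin S -> S \subset low X i.
Proof. by move=> SX iS; apply: bigcup_sup; rewrite SX. Qed.

Lemma lowP X i S : (forall S', S' \in X -> i \notin S' -> S' \subset S) -> low X i \subset S.
Proof. by move=> h; apply/bigcupsP => S' /andP[]; exact: h. Qed.

Lemma cap_sub X i S : S \in X -> i \in S -> cap X i \subset S.
Proof. by move=> SX iS; apply: bigcap_inf; rewrite SX. Qed.

Lemma mem_cap X i : i \in cap X i.
Proof. by apply/bigcapP => S /andP[]. Qed.

Lemma low_mono X Y i : X \subset Y -> low X i \subset low Y i.
Proof. by move=> /subsetP s; apply: lowP => S /s; exact: low_sub. Qed.

Lemma cap_anti X Y i : X \subset Y -> cap Y i \subset cap X i.
Proof. by move=> /subsetP s; apply/bigcapsP => S /andP[/s]; exact: cap_sub. Qed.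

Lemma cap_eq X Y i : (forall S, i \in S -> (S \in X) = (S \in Y)) -> cap X i = cap Y i.
Proof.
by move=> h; apply: eq_bigl => S; case: (boolP (i \in S)) => iS; rewrite ?andbF ?andbT ?h.
Qed.

(* An [i] outside [S] with smallest [low X i] satisfies [low X i \subset S]. *)
Lemma next_exists X S : schain X -> goodf X -> S != setT ->
  exists2 i, next S = Some i & i \notin S /\ good S i.
Proof.
move=> [h1 h2] gX ST.
suff [i /andP[iS gi]] : exists i, (i \notin S) && good S i.
  rewrite /next; case: pickP => [j /andP[]|/(_ i)]; first by exists j.
  by rewrite iS gi.
have [i0 i0S] : exists i, i \notin S.
  by apply/existsP; rewrite -negb_forall; apply: contraNN ST => /forallP h; apply/eqP/setP => x; rewrite h inE.
case: (@arg_minnP _ i0 (fun i => i \notin S) (fun i => #|low X i|) i0S) => i iS imin.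
exists i; rewrite iS; apply: good_mono (gX i); apply: lowP => S' S'X iS'.
apply/subsetP => j jS'; apply: contraT => jS; have := imin j jS.
rewrite leqNgt => /negP[]; apply: proper_card; apply/properP.
have S'i := low_sub S'X iS'; split; last first.
  exists j; first exact: (subsetP S'i).
  by apply/bigcupP => -[S1 /andP[_ /negP]].
apply: subset_trans S'i; apply: lowP => S1 S1X jS1.
by case/orP: (h2 _ _ S1X S'X) => // /subsetP/(_ j jS'); rewrite (negPf jS1).
Qed.

Lemma card_greedy X k : schain X -> goodf X -> k <= #|I| -> #|greedy k| = k.
Proof.
move=> sX gX; elim: k => [|k IH] lt; first by rewrite cards0.
have ek := IH (ltnW lt); have [|i ei [iC _]] := @next_exists X (greedy k) sX gX.
  by apply: contraTneq lt => e; rewrite -ek e cardsT ltnn.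
by rewrite greedyS ei cardsU1 iC ek.
Qed.

Lemma depth_ltI X : schain X -> goodf X -> 0 < #|I| -> depth X < #|I|.
Proof.
move=> sX gX I0; rewrite ltn_neqAle depth_le andbT; apply/eqP => e.
have := card_greedy sX gX (leqnn _); have [e0|h] := depth_greedy X.
  by rewrite -e e0 in I0.
rewrite -{1}e => e1; case: (sX.1 _ h) => _ /eqP[]; apply/eqP.
by rewrite eqEcard subsetT cardsT /= e1.
Qed.

Lemma greedy_sub j k : j <= k -> greedy j \subset greedy k.
Proof.
move=> /subnK <-; elim: (k - j) => [|m IH] //; rewrite addSn greedyS.
apply: subset_trans IH _; case: next => // i; exact: subsetUr.
Qed.

Lemma depth_eq X k : k < #|I| -> (forall j, j < k -> greedy j.+1 \in X) ->
  greedy k.+1 \notin X -> depth X = k.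
Proof.
move=> kI h1 h2; apply/eqP; rewrite eqn_leq; apply/andP; split; rewrite leqNgt; apply/negP.
  by move/depth_lt; rewrite (negPf h2).
by move=> lt; have := depth_notin (ltn_trans lt kI); rewrite h1.
Qed.

Lemma cap_in X i : schain X -> cap X i = setT \/ cap X i \in X.
Proof.
move=> [h1 h2]; have [/existsP [S0 h0]|] := boolP [exists S, (S \in X) && (i \in S)]; last first.
  rewrite negb_exists => /forallP h; left; rewrite /cap big_pred0 // => S.
  by apply/negbTE/h.
right; case: (@arg_minnP _ S0 (fun S => (S \in X) && (i \in S)) (fun S => #|S|) h0).
move=> S /andP[SX iS] Smin; suff -> : cap X i = S by [].
apply/eqP; rewrite eqEsubset cap_sub //=; apply/bigcapsP => S' /andP[S'X iS'].
case/orP: (h2 _ _ SX S'X) => // S'S.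
have := Smin S'; rewrite S'X iS' => /(_ isT) le.
by have /eqP -> : S' == S by rewrite eqEcard S'S.
Qed.

Section Toggle.
Variable X : {set {set I}}.
Hypotheses (sX : schain X) (gX : goodf X) (nX : depth X < #|I|.-1).
Let k := depth X.
Let C := greedy k.
Let T := toggle X.

Let kI : k.+1 < #|I|. Proof. by move: nX; rewrite -/k; lia. Qed.
Let cC : #|C| = k. Proof. by apply: (card_greedy sX gX); lia. Qed.
Let CX : C = set0 \/ C \in X.
Proof. by rewrite /C /k; case: (depth_greedy X) => [->|]; [left|right]. Qed.

Let nextC : exists2 i, next C = Some i & i \notin C /\ good C i.
Proof.
apply: next_exists gX _ => //; apply: contraTneq kI => e.
by rewrite -cC e cardsT; lia.
Qed.

(** If [T] were equal to [C], then [cap X i] would be the next greedy set, which the depth declares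
    missing from [X], or the full set, which the bound on the depth excludes. Comparability of [T]
    with the members follows by asking whether they contain [i]. *)
Lemma toggle_spec : exists i, [/\ [/\ next C = Some i, i \notin C, good C i & C \subset T],
  [/\ i \notin T, cap X i = i |: T, T != C, T != set0 & T != setT] &
  forall S, S \in X -> if i \in S then i |: T \subset S else S \subset T].
Proof.
have [i ei [iC gi]] := nextC; have [h1 h2] := sX.
have eT : T = cap X i :\ i by rewrite /T /toggle -/k -/C ei.
have iT : i \notin T by rewrite eT !inE eqxx.
have eU : cap X i = i |: T by rewrite eT setD1K // mem_cap.
have CT : C \subset T.
  rewrite eT subsetD1 iC andbT; apply/bigcapsP => S /andP[SX iS].
  case: CX => [->|CX']; first exact: sub0set.
  by case/orP: (h2 _ _ CX' SX) => // /subsetP/(_ i iS); rewrite (negPf iC).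
have TC : T != C.
  apply/eqP => e; have eC : cap X i = greedy k.+1 by rewrite eU e greedyS -/C ei.
  case: (cap_in i sX) => h; last first.
    by have := depth_notin (ltnW kI); rewrite -/k -eC h.
  have := card_greedy sX gX (ltnW kI); rewrite -eC h cardsT; move: kI; lia.
exists i; split => //.
  split => //; last by apply: contraNneq iT => ->; rewrite inE.
  by apply: contraNneq TC => e; rewrite e eqEsubset sub0set /= -e.
move=> S SX; case: ifPn => iS; first by rewrite -eU; exact: cap_sub.
rewrite eT subsetD1 iS andbT; apply/bigcapsP => S' /andP[S'X iS'].
by case/orP: (h2 _ _ SX S'X) => // /subsetP/(_ i iS'); rewrite (negPf iS).
Qed.

(** [T] is none of the greedy sets up to the first missing one: that one contains [i], and the
    earlier ones are contained in [C], which is properly contained in [T]. *)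
Lemma depth_toggle Y : X :\ T \subset Y -> Y \subset T |: X -> depth Y = k.
Proof.
move=> /subsetP XY /subsetP YX; have [i [[ei iC gi CT] [iT eU TC T0 TT] hS]] := toggle_spec.
have nT j : j <= k.+1 -> greedy j != T.
  rewrite leq_eqVlt => /orP[/eqP->|jk].
    by apply: contraNneq iT => <-; rewrite greedyS -/C ei !inE eqxx.
  apply: contraNneq TC => e; rewrite eqEsubset CT andbT -e; exact: greedy_sub.
apply: depth_eq; first exact: ltnW.
  move=> j jk; apply: XY; rewrite !inE nT ?depth_lt //; exact: leqW.
apply/negP => /YX; rewrite !inE (negPf (nT _ _)) //=; apply/negP; apply: depth_notin.
exact: ltnW.
Qed.

Lemma toggle_toggle Y : X :\ T \subset Y -> Y \subset T |: X -> toggle Y = T.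
Proof.
move=> XY YX; have [i [[ei iC gi CT] [iT eU TC T0 TT] hS]] := toggle_spec.
rewrite /toggle (depth_toggle XY YX) -/C ei.
have -> : cap Y i = cap X i.
  apply: cap_eq => S iS; have ST : S != T by apply: contraNneq iT => <-.
  apply/idP/idP => h; first by have := subsetP YX _ h; rewrite !inE (negPf ST).
  by apply: (subsetP XY); rewrite !inE ST.
by rewrite eU setU1K.
Qed.

Lemma schain_toggle : schain (T |: X).
Proof.
have [i [[ei iC gi CT] [iT eU TC T0 TT] hS]] := toggle_spec; have [h1 h2] := sX.
have comp S : S \in X -> (S \subset T) || (T \subset S).
  move/hS; case: ifP => _ h; last by rewrite h.
  by rewrite orbC (subset_trans _ h) // subsetUr.
split=> [S|S S']; first by rewrite !inE => /orP[/eqP->|/h1].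
rewrite !inE => /orP[/eqP->|SX] /orP[/eqP->|S'X]; [by rewrite subxx| |exact: comp|exact: h2].
by rewrite orbC comp.
Qed.

(** Removing [T] shrinks [low X j] only if [T] was the largest member avoiding [j]. For [j = i] the
    set [C] remains and is good by the choice of [i]; any other such [j] lies outside [cap X i],
    which then belongs to [X] and contains [T]. *)
Lemma goodf_toggleD : goodf (X :\ T).
Proof.
have [i [[ei iC gi CT] [iT eU TC T0 TT] hS]] := toggle_spec; have [h1 h2] := sX.
move=> j; have [->|ji] := eqVneq j i.
  apply: good_mono gi; case: CX => [->|CX']; first exact: sub0set.
  by apply: low_sub => //; rewrite !inE eq_sym TC.
apply: good_mono (gX j); apply: lowP => S SX jS.
have [eST|ST] := eqVneq S T; last by apply: low_sub => //; rewrite !inE ST.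
have jU : j \notin cap X i by rewrite eU !inE negb_or ji -eST.
have UX : cap X i \in X by case: (cap_in i sX) => // e; rewrite e inE in jU.
apply: (subset_trans _ (low_sub _ jU)); first by rewrite eST eU subsetUr.
by rewrite !inE UX andbT eU; apply: contraNneq iT => <-; rewrite !inE eqxx.
Qed.

End Toggle.

Lemma depth_mono X Y : X \subset Y -> depth X <= depth Y.
Proof.
move=> /subsetP s; rewrite leqNgt; apply/negP => lt.
by have /negP[] := depth_notin (leq_trans lt (depth_le X)); apply/s/depth_lt.
Qed.

(** A lexicographic triple in base [#|I|.+2]: depth, codimension of [cap], size of the larger chain
    of the pair. Each entry can only grow with the chain once the previous ones agree, which is what
    makes the matching acyclic. *)
Definition srank X := (depth X * #|I|.+2 + (#|I| - if next (greedy (depth X)) is Some i then #|cap X i| else 0))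
  * #|I|.+2 + #|toggle X |: X|.

(** Members of a chain have distinct sizes, between 1 and [#|I|.-1]. *)
Lemma card_schain X : schain X -> #|X| <= #|I|.-1.
Proof.
move=> [h0 h].
have cI S : S \in X -> 0 < #|S| < #|I|.
  move=> /h0 [S0 ST]; rewrite card_gt0 S0 ltn_neqAle max_card andbT.
  by apply: contraNneq ST => e; rewrite eqEcard subsetT cardsT e leqnn.
have [->|/set0Pn [S0 S0X]] := eqVneq X set0; first by rewrite cards0.
have e : #|I|.-1 = #|I|.-2.+1 by have := cI _ S0X; lia.
rewrite e -[leqRHS]card_ord -(card_in_imset (f := fun S : {set I} => inord #|S|.-1 : 'I_#|I|.-2.+1)).
  exact: max_card.
move=> S S' SX S'X /(congr1 (@nat_of_ord _)); have := cI _ SX; have := cI _ S'X => c1 c2.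
rewrite !inordK; try lia; move=> eSS; apply/eqP; case/orP: (h _ _ SX S'X) => s.
  by rewrite eqEcard s; lia.
by rewrite eq_sym eqEcard s; lia.
Qed.

Lemma lexi_le N a b a' b' : b < N -> b' < N -> a <= a' -> (a = a' -> b <= b') ->
  a * N + b <= a' * N + b' /\ (a * N + b = a' * N + b' -> a = a' /\ b = b').
Proof.
move=> bN bN'; rewrite leq_eqVlt => /orP[/eqP-> /(_ erefl)|lt _]; first by split; lia.
have : a * N + N <= a' * N by rewrite -mulSnr leq_mul2r lt orbT.
by split; lia.
Qed.

Lemma srank_lt X : schain X -> goodf X -> depth X < #|I|.-1 -> srank X < #|I|.+2 ^ 3.
Proof.
move=> sX gX nX; have cX : #|toggle X |: X| < #|I|.+2 by apply: leq_ltn_trans (card_schain (schain_toggle sX gX nX)) _; rewrite ltnS (leq_trans (leq_pred _)) ?leqW.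
rewrite /srank.
set h := #|I| - _; have hI : h <= #|I| by rewrite leq_subr.
have dI := depth_le X.
have : (depth X * #|I|.+2 + h).+1 <= #|I|.+2 ^ 2.
  have : depth X * #|I|.+2 <= #|I| * #|I|.+2 by rewrite leq_mul2r dI orbT.
  by rewrite expnS expn1; nia.
rewrite -(leq_pmul2r (ltn0Sn #|I|.+1)) -expnSr mulSn; apply: leq_trans.
by rewrite addnC ltn_add2r.
Qed.

Lemma srank_mono X Y : schain X -> goodf X -> depth X < #|I|.-1 ->
  schain Y -> goodf Y -> depth Y < #|I|.-1 -> X \subset Y ->
  srank X <= srank Y /\ (srank X = srank Y -> toggle X = toggle Y /\ toggle X |: X = toggle Y |: Y).
Proof.
move=> sX gX nX sY gY nY XY.
have cX : #|toggle X |: X| < #|I|.+2 by apply: leq_ltn_trans (card_schain (schain_toggle sX gX nX)) _; rewrite ltnS (leq_trans (leq_pred _)) ?leqW.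
have cY : #|toggle Y |: Y| < #|I|.+2 by apply: leq_ltn_trans (card_schain (schain_toggle sY gY nY)) _; rewrite ltnS (leq_trans (leq_pred _)) ?leqW.
have [i [[ei _ _ _] _ _]] := toggle_spec sX gX nX.
have [j [[ej _ _ _] _ _]] := toggle_spec sY gY nY.
have ij : depth X = depth Y -> j = i by move: ei ej => + + e; rewrite e => -> [].
have c1 : #|cap X i| <= #|I| by exact: max_card.
have c2 : #|cap Y j| <= #|I| by exact: max_card.
have [||| A1 A2] := @lexi_le #|I|.+2 _ (#|I| - #|cap X i|) _ (#|I| - #|cap Y j|) _ _ (depth_mono XY).
- by lia.
- by lia.
- by move=> /ij ->; apply: leq_sub2l; apply: subset_leq_card; exact: cap_anti.
have tE : depth X = depth Y /\ #|I| - #|cap X i| = #|I| - #|cap Y j| -> toggle X = toggle Y.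
  move=> [/[dup] e /ij eji]; rewrite eji in c2 * => e2; rewrite /toggle ei ej eji.
  suff -> : cap X i = cap Y i by [].
  by apply/eqP; rewrite eq_sym eqEcard cap_anti //=; lia.
have [|B1 B2] := @lexi_le #|I|.+2 _ _ _ _ cX cY A1.
  by move=> /A2/tE ->; apply: subset_leq_card; exact: setUS.
rewrite /srank ei ej; split=> // /B2 [/A2/tE e e']; split=> //.
by apply/eqP; rewrite eqEcard {1}e setUS //= e'.
Qed.

Lemma srank_toggle X Y : schain X -> goodf X -> depth X < #|I|.-1 ->
  X :\ toggle X \subset Y -> Y \subset toggle X |: X -> srank Y = srank X.
Proof.
move=> sX gX nX XY YX; have [i [[ei _ _ _] [iT eU _ _ _] _]] := toggle_spec sX gX nX.
rewrite /srank (depth_toggle sX gX nX XY YX) (toggle_toggle sX gX nX XY YX) ei.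
rewrite (@cap_eq Y X i).
  congr (_ + #|pred_of_set _|); apply/setP => S; rewrite !inE.
  case: (eqVneq S (toggle X)) => //= ST; apply/idP/idP => h.
    by have := subsetP YX _ h; rewrite !inE (negPf ST).
  by apply: (subsetP XY); rewrite !inE ST.
move=> S iS; have ST : S != toggle X by apply: contraTneq iS => ->.
apply/idP/idP => h; first by have := subsetP YX _ h; rewrite !inE (negPf ST).
by apply: (subsetP XY); rewrite !inE ST.
Qed.

(** All greedy sets of size 1 to [#|I|.-1] are present, and they are distinct because their sizes
    are. *)
Lemma card_scrit X : depth X = #|I|.-1 -> schain X -> goodf X -> #|I|.-1 <= #|X|.
Proof.
move=> dX sX gX; rewrite -[leqLHS]card_ord.
have inj : injective (fun j : 'I_#|I|.-1 => greedy j.+1).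
  move=> j j' /(congr1 (fun S : {set I} => #|S|)).
  have lt (k : 'I_#|I|.-1) : k.+1 <= #|I| by have := ltn_ord k; lia.
  by rewrite !(card_greedy sX gX) // => -[/ord_inj].
rewrite -(card_imset (mem 'I_#|I|.-1) inj); apply: subset_leq_card; apply/subsetP => S /imsetP [j _ ->].
by apply: depth_lt; rewrite dX.
Qed.

End SetMatching.

From mathcomp Require Import all_classical.

(** * Words and Nielsen reduction *)

Section Words.
Local Open Scope group_scope.
Context {J : eqType}.
Implicit Types (l : J * bool) (z : seq (J * bool)).

Definition invl l : J * bool := (l.1, ~~ l.2).
Definition invw z := rev [seq invl l | l <- z].
Definition redw z := sorted (fun k l => l != invl k) z.

Definition lmul l z :=
  if z is k :: z' then if k == invl l then z' else l :: z else [:: l].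
Definition redu z := foldr lmul [::] z.

Lemma invlK : involutive invl.
Proof. by case=> i e; rewrite /invl /= negbK. Qed.

Lemma invl_neq l : invl l != l.
Proof. by case: l => i []; rewrite /invl xpair_eqE eqxx. Qed.

Lemma eq_invl l k : l.1 = k.1 -> l != k -> l = invl k.
Proof.
case: l k => [i e] [j f] /= -> ; rewrite xpair_eqE eqxx /= /invl /= => h.
by congr pair; case: e f h => [] [].
Qed.

Lemma invwK : involutive invw.
Proof. by move=> z; rewrite /invw map_rev revK -map_comp map_id_in // => l _ /=; rewrite invlK. Qed.

Lemma invw_cat z1 z2 : invw (z1 ++ z2) = invw z2 ++ invw z1.
Proof. by rewrite /invw map_cat rev_cat. Qed.

Lemma invw_cons l z : invw (l :: z) = rcons (invw z) (invl l).
Proof. by rewrite /invw /= rev_cons. Qed.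

Lemma size_invw z : size (invw z) = size z.
Proof. by rewrite /invw size_rev size_map. Qed.

Lemma mem_invw z l : (l \in invw z) = (invl l \in z).
Proof. by rewrite mem_rev -{1}[l]invlK mem_map //; exact: inv_inj invlK. Qed.

Lemma redw_inv z : redw (invw z) = redw z.
Proof.
rewrite /redw /invw rev_sorted sorted_map; apply: eq_sorted => a b /=.
by rewrite invlK; apply/idP/idP; apply: contraNN => /eqP-> //; rewrite invlK.
Qed.

Lemma redw_lmul l z : redw z -> redw (lmul l z).
Proof.
case: z => [//|k z] rz /=; case: ifPn => [_|nk]; last by rewrite /= nk.
exact: path_sorted rz.
Qed.

Lemma redw_redu z : redw (redu z).
Proof. by elim: z => //= l z; exact: redw_lmul. Qed.

Lemma mem_lmul l z : {subset lmul l z <= l :: z}.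
Proof.
case: z => [|k z] //= x; case: ifP => // _; rewrite !inE => ->.
by rewrite !orbT.
Qed.

Lemma mem_redu z : {subset redu z <= z}.
Proof.
elim: z => //= l z IH x /mem_lmul; rewrite !inE => /orP[->//|/IH ->].
by rewrite orbT.
Qed.

Lemma redu_id z : redw z -> redu z = z.
Proof.
elim: z => //= l z IH rz; rewrite IH; last exact: path_sorted rz.
by case: z rz {IH} => //= k z /andP[/negPf->].
Qed.

Lemma redw_catl z1 z2 : redw (z1 ++ z2) -> redw z1.
Proof. exact: (prefix_sorted (prefix_prefix _ _)). Qed.

Lemma redw_catr z1 z2 : redw (z1 ++ z2) -> redw z2.
Proof. exact: (suffix_sorted (suffix_suffix _ _)). Qed.

(** Being reduced concerns adjacent letters only, and a nonempty overlap sees every adjacency. *)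
Lemma redw_cat3 z1 z2 z3 : z2 != [::] ->
  redw (z1 ++ z2) -> redw (z2 ++ z3) -> redw (z1 ++ z2 ++ z3).
Proof.
case: z2 => // k z2 _; case: z1 => [//|l z1].
rewrite /redw /= !cat_path /= => /and3P[-> -> h1].
by rewrite cat_path.
Qed.

Context {G : groupType}.
Implicit Types (V W : J -> G).

Definition lval V l : G := if l.2 then (V l.1)^-1 else V l.1.
Arguments lval : simpl never.
Definition ev V z : G := foldr (fun l x => lval V l * x) 1 z.

Lemma lval_inv V l : lval V (invl l) = (lval V l)^-1.
Proof. by case: l => i [] //=; rewrite /lval /= invgK. Qed.

Lemma ev_cat V z1 z2 : ev V (z1 ++ z2) = ev V z1 * ev V z2.
Proof. by elim: z1 => [|l z1 IH] /=; rewrite ?mul1g // IH mulgA. Qed.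

Lemma ev_rcons V z l : ev V (rcons z l) = ev V z * lval V l.
Proof. by rewrite -cats1 ev_cat /= mulg1. Qed.

Lemma ev_invw V z : ev V (invw z) = (ev V z)^-1.
Proof.
elim: z => [|l z IH]; first by rewrite /= invg1.
by rewrite invw_cons ev_rcons IH lval_inv /= invgM.
Qed.

Lemma ev_lmul V l z : ev V (lmul l z) = lval V l * ev V z.
Proof.
case: z => [|k z] //=; case: ifP => //= /eqP->.
by rewrite lval_inv mulVKg.
Qed.

Lemma ev_redu V z : ev V (redu z) = ev V z.
Proof. by elim: z => //= l z IH; rewrite ev_lmul IH. Qed.

Lemma eq_ev V W z : (forall l, l \in z -> V l.1 = W l.1) -> ev V z = ev W z.
Proof.
elim: z => //= l z IH h; rewrite IH; last by move=> k kz; rewrite h ?inE ?kz ?orbT.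
by rewrite /lval h ?inE ?eqxx.
Qed.

End Words.

Definition freew (J : eqType) (G : groupType) (V : J -> G) :=
  forall z, redw z -> ev V z = 1%g -> z = [::].

Section FreeW.
Local Open Scope group_scope.
Context {J : eqType} {G H : groupType}.

(** The reduced form of [z1 ++ invw z2] is empty. This is the universal property of a free family: a
    map defined through words does not depend on the word chosen. *)
Lemma freew_ev (V : J -> G) (W : J -> H) z1 z2 : freew V ->
  ev V z1 = ev V z2 -> ev W z1 = ev W z2.
Proof.
move=> fV e12; have r : redu (z1 ++ invw z2) = [::].
  by apply: fV; [exact: redw_redu|rewrite ev_redu ev_cat ev_invw e12 mulgV].
have := ev_redu W (z1 ++ invw z2).
by rewrite r ev_cat ev_invw /= => /esym/divg1_eq.
Qed.

Lemma freew_inj (V : J -> G) z1 z2 : freew V -> redw z1 -> redw z2 ->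
  ev V z1 = ev V z2 -> z1 = z2.
Proof.
move=> fV; elim: z1 z2 => [|a z1 IH] [|b z2] r1 r2 //.
- by move=> /= e; rewrite -(fV (b :: z2)) //.
- by move=> /= e; rewrite -(fV (a :: z1)) //= e.
case: (eqVneq a b) => [<-|nab] e.
  congr cons; apply: IH; [exact: path_sorted r1|exact: path_sorted r2|].
  by move: e; rewrite /= => /mulgI.
have: redw (invw (a :: z1) ++ (b :: z2)).
  rewrite /invw /= rev_cons -cats1 -catA; apply: (@redw_cat3 _ _ [:: invl a]) => //.
    by rewrite cats1 -rev_cons -[rev _]/(invw (a :: z1)) redw_inv.
  by rewrite /redw /= invlK eq_sym nab; exact: r2.
move/fV; rewrite ev_cat ev_invw e mulVg => /(_ erefl)/(congr1 size).
by rewrite size_cat /= addnS.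
Qed.

End FreeW.

Section FreeGroupWords.
Local Open Scope group_scope.
Context {n : nat}.
Implicit Types (x y : free_group n) (z : seq (letter n)).

Definition gen (i : 'I_n) : free_group n := FreeGroup (isT : reduced [:: (i, false)]).

Lemma ev_mul_word (G : groupType) (V : 'I_n -> G) z1 z2 :
  ev V (mul_word z1 z2) = ev V z1 * ev V z2.
Proof.
elim: z1 => [|l z1 IH] /=; first by rewrite mul1g.
by rewrite -[lmul_letter _ _]/(lmul l _) ev_lmul IH mulgA.
Qed.

Definition fhom (G : groupType) (V : 'I_n -> G) x : G := ev V (word x).

Lemma fhomM (G : groupType) (V : 'I_n -> G) : {morph fhom V : x y / x * y}.
Proof. by move=> x y; rewrite /fhom ev_mul_word. Qed.

Lemma word_ev_gen z : word (ev gen z) = redu z.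
Proof.
elim: z => [//|l z IH].
rewrite -[redu _]/(lmul l (redu z)) -IH.
by case: l => i [].
Qed.

Lemma word_ev_gen_id z : redw z -> word (ev gen z) = z.
Proof. by move=> rz; rewrite word_ev_gen redu_id. Qed.

Lemma ev_gen_word x : ev gen (word x) = x.
Proof. by apply/val_inj; rewrite /= word_ev_gen redu_id //; exact: word_reduced. Qed.

Lemma redw_word x : redw (word x).
Proof. exact: word_reduced. Qed.

Lemma freew_gen : freew gen.
Proof. by move=> z rz e; rewrite -(word_ev_gen_id rz) e. Qed.

Lemma fhom_gen (G : groupType) (V : 'I_n -> G) i : fhom V (gen i) = V i.
Proof. by rewrite /fhom /= mulg1. Qed.

Lemma fhom_ev (G : groupType) (V : 'I_n -> G) (J : eqType) (W : J -> free_group n)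
    (z : seq (J * bool)) : fhom V (ev W z) = ev (fun j => fhom V (W j)) z.
Proof.
elim: z => //= l z IH; rewrite fhomM IH; congr (_ * _).
rewrite /lval; case: l.2 => //.
apply: (mulgI (fhom V (W l.1))); rewrite -fhomM !mulgV.
by [].
Qed.

Lemma fhom1 (G : groupType) (V : 'I_n -> G) : fhom V 1 = 1.
Proof. by []. Qed.

Lemma fhomV (G : groupType) (V : 'I_n -> G) x : fhom V x^-1 = (fhom V x)^-1.
Proof. by apply: (mulgI (fhom V x)); rewrite -fhomM !mulgV fhom1. Qed.

Lemma word_inv x : word x^-1 = invw (word x).
Proof. by []. Qed.

End FreeGroupWords.

(** * Cancellation in products, and the weight used in Nielsen reduction *)

Section NielsenOrder.
Local Open Scope group_scope.
Context {n : nat}.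
Implicit Types (x y : free_group n) (p q u v z : seq (letter n)).

Definition len x := size (word x).

Lemma lenV x : len x^-1 = len x.
Proof. by rewrite /len word_inv size_invw. Qed.

Lemma len0 x : len x = 0%N -> x = 1.
Proof. by move=> /size0nil e; apply/val_inj; rewrite /= e. Qed.

Lemma cancel_cat u v : redw u -> redw v ->
  exists p u' v', [/\ u = u' ++ invw p, v = p ++ v' & redw (u' ++ v')].
Proof.
elim: v u => [|a v IH] u ru rv; first by exists [::], u, [::]; rewrite /= cats0.
case/lastP: u ru => [|u b] ru; first by exists [::], [::], (a :: v).
case: (eqVneq a (invl b)) => [e|ne].
  have ru' : redw u by move: ru; rewrite -cats1; exact: redw_catl.
  have [p [u' [v' [-> -> r]]]] := IH u ru' (path_sorted rv).
  exists (a :: p), u', v'; split => //.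
  by rewrite invw_cons rcons_cat e invlK.
exists [::], (rcons u b), (a :: v); split => //; first by rewrite cats0.
rewrite -cats1 -catA; apply: redw_cat3 => //; first by rewrite cats1.
by rewrite /redw /= ne.
Qed.

Lemma word_mul_cancel p u v x y : word x = u ++ invw p -> word y = p ++ v ->
  redw (u ++ v) -> word (x * y) = u ++ v.
Proof.
move=> ex ey r; rewrite -[x]ev_gen_word -[y]ev_gen_word ex ey -ev_cat.
rewrite -(word_ev_gen_id r) !ev_cat ev_invw; congr word.
by rewrite -mulgA mulKg.
Qed.

Lemma mul_cancel x y : exists p u v,
  [/\ word x = u ++ invw p, word y = p ++ v & word (x * y) = u ++ v].
Proof.
have [p [u [v [ex ey r]]]] := cancel_cat (redw_word x) (redw_word y).
by exists p, u, v; split => //; exact: word_mul_cancel ex ey r.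
Qed.

Lemma redw_invw_cat p : redw (p ++ invw p) -> p = [::].
Proof.
case/lastP: p => // p a; rewrite -cats1 invw_cat -catA /=.
by move=> /redw_catr; rewrite /redw /= eqxx.
Qed.

(** If more than half cancelled in a square, the two decompositions of the word would force a
    nonempty [q] with [invw q = q]: for odd length its middle letter would be its own inverse, for
    even length its two middle letters would cancel. *)
Lemma cancel_self p u v : redw (u ++ invw p) -> u ++ invw p = p ++ v ->
  2 * size p <= size (p ++ v).
Proof.
move=> r e; rewrite leqNgt; apply/negP => h.
have s : size u = size v.
  by move/(congr1 size): e; rewrite !size_cat size_invw addnC; apply: addnI.
have hu : size u < size p by move: h; rewrite size_cat; lia.
have [q eq1] : exists q, p = u ++ q.
  exists (drop (size u) p); rewrite -{1}(cat_take_drop (size u) p); congr cat.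
  by move/(congr1 (take (size u))): e; rewrite take_size_cat // takel_cat // ltnW.
move: e; rewrite {1}eq1 eq1 invw_cat -catA => /eqP.
rewrite eqseq_cat // eqxx /= eqseq_cat ?size_invw // => /andP[/eqP e _].
have qn : q != [::] by apply/eqP => q0; move: hu; rewrite eq1 q0 cats0 ltnn.
have r' : redw q.
  by move: r; rewrite eq1 invw_cat e => /redw_catr/redw_catl.
have [m [hm [hq|hq]]] : exists m, m = (size q)./2 /\
    (size q = m.*2.+1 \/ size q = m.*2)%N.
  exists (size q)./2; split => //; rewrite -{1 3}(odd_double_half (size q)).
  by case: (odd _); [left|right].
- have [i0 _] : exists i0 : letter n, true by case: (q) qn => // a; exists a.
  have := congr1 (fun s => nth i0 s m) e.
  rewrite /invw nth_rev ?size_map ?hq; last by lia.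
  rewrite (nth_map i0) ?hq; last by lia.
  have -> : (m.*2.+1 - m.+1 = m)%N by lia.
  by move/eqP; rewrite (negPf (invl_neq _)).
- have [i0 _] : exists i0 : letter n, true by case: (q) qn => // a; exists a.
  have m0 : 0 < m by rewrite lt0n; apply/eqP => m0; move/eqP: qn; apply; apply: size0nil; rewrite hq m0.
  have := congr1 (fun s => nth i0 s m) e.
  rewrite /invw nth_rev ?size_map ?hq; last by lia.
  rewrite (nth_map i0) ?hq; last by lia.
  have -> : (m.*2 - m.+1 = m.-1)%N by lia.
  move=> ee; have := r'; rewrite /redw => /(sortedP i0)/(_ m.-1).
  rewrite prednK // hq => /(_ _)/negP; apply; last by apply/eqP; rewrite ee.
  by lia.
Qed.

Let B := #|{: letter n}|.+2.

Definition code z := foldl (fun c l => c * B + enum_rank l)%N 0%N z.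

Lemma code_cat p q : code (p ++ q) = (code p * B ^ size q + code q)%N.
Proof.
rewrite /code foldl_cat -/(code p).
elim/last_ind: q (code p) => [|q l IH] c; first by rewrite /= expn0 muln1 addn0.
rewrite -cats1 !foldl_cat /= IH -/(code q) size_cat addn1 expnSr.
by rewrite mulnDl mulnA addnA.
Qed.

Lemma code_lt z : code z < B ^ size z.
Proof.
elim/last_ind: z => [//|z l IH]; rewrite -cats1 code_cat size_cat /= expn1 addn1 expnSr.
have h := ltn_ord (enum_rank l); rewrite {2}/code /= mul0n add0n.
apply: (@leq_trans ((code z).+1 * B)); last by rewrite leq_mul2r IH orbT.
by rewrite mulSnr -addnS leq_add2l /B ltnW // ltnS ltnW.
Qed.

Lemma code_inj p q : size p = size q -> code p = code q -> p = q.
Proof.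
elim/last_ind: p q => [|p l IH] q; first by move/esym/size0nil.
case/lastP: q => [|q k]; first by rewrite size_rcons.
rewrite !size_rcons => -[/IH{}IH]; rewrite -!cats1 !code_cat /= /code /= !mul0n !add0n expn1.
have h1 := ltn_ord (enum_rank l); have h2 := ltn_ord (enum_rank k).
move=> e; have ek : enum_rank l = enum_rank k :> nat.
  have := congr1 (modn^~ B) e; rewrite !modnMDl !modn_small //.
    by rewrite /B ltnW // ltnS ltnW.
  by rewrite /B ltnW // ltnS ltnW.
rewrite (enum_rank_inj (val_inj ek)) IH //; move: e; rewrite ek => /addIn/eqP.
by rewrite eqn_pmul2r // => /eqP.
Qed.

Lemma code_cat_lt p q v : size p = size q -> code q < code p ->
  code (q ++ v) < code (p ++ v).
Proof. by move=> s h; rewrite !code_cat ltn_add2r ltn_pmul2r // expn_gt0. Qed.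

Definition half z := take (uphalf (size z)) z.

(** Nielsen's order as a number: length first, then the codes of the initial halves of the word and
    of its inverse. Each code is below [B ^ len x] and [B] is at least 2, so the factor 3 lets a
    gain in length outweigh both codes. *)
Definition mu x : nat :=
  (3 * B ^ len x + (code (half (word x)) + code (half (word x^-1))))%N.

Lemma muV x : mu x^-1 = mu x.
Proof. by rewrite /mu invgK lenV [(code _ + _)%N]addnC. Qed.

Lemma code_half z : code (half z) < B ^ size z.
Proof.
apply: leq_trans (code_lt _) _; rewrite leq_exp2l // /half size_take.
by case: ltnP => // _; rewrite leq_uphalf_double -addnn leq_addl.
Qed.

Lemma mu_len x y : len x < len y -> mu x < mu y.
Proof.
move=> h; have := code_half (word x); have := code_half (word x^-1).
rewrite -[size (word x^-1)]/(len x^-1) lenV -/(len x) /mu => h1 h2.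
have : B * B ^ len x <= B ^ len y by rewrite -expnS leq_exp2l.
have : 1 < B by []. nia.
Qed.

(** Both words have the same initial half, contained in [u], while the initial halves of their
    inverses begin with [p] and [q] and then agree. *)
Lemma mu_half x y u p q : word x = u ++ invw p -> word y = u ++ invw q ->
  size p = size q -> size p <= size u -> code q < code p -> mu y < mu x.
Proof.
move=> ex ey s h c; have e1 : len y = len x by rewrite /len ex ey !size_cat !size_invw s.
rewrite /mu e1 ltn_add2l.
have hs : uphalf (size u + size p) <= size u by lia.
have hs' : size p <= uphalf (size u + size p) by lia.
have -> : half (word y) = half (word x).
  by rewrite /half ex ey !size_cat !size_invw -s !takel_cat.
rewrite ltn_add2l !word_inv ex ey !invw_cat !invwK /half !size_cat -s !size_invw.
have -> : (size p + size u = size u + size p)%N by rewrite addnC.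
rewrite !take_cat -s !(ltnNge _ (size p)) hs' /=.
exact: code_cat_lt.
Qed.

End NielsenOrder.

(* [L] is the set of indices that must not be modified; their values are letters.
   [nielsen_irr] says that no elementary Nielsen transformation modifying an
   index outside [L] decreases the weight [mu]. *)
Section NielsenReduced.
Local Open Scope group_scope.
Context {n : nat} {J : eqType} (L : pred J) (V : J -> free_group n).
Local Notation lv l := (lval V l : free_group n).
Implicit Types (k l : J * bool) (z : seq (J * bool)) (x y : free_group n).

Hypothesis V1 : forall i, V i != 1.
Hypothesis VL : forall i, L i -> len (V i) = 1%N.
Hypothesis VLL : forall k l, L k.1 -> L l.1 -> l != invl k ->
  lv k * lv l != 1.
Hypothesis irr : forall k l, k.1 != l.1 -> ~~ L k.1 ->
  mu (lv k) <= mu (lv k * lv l).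

Lemma lval_neq1 l : lv l != 1.
Proof. by rewrite /lval; case: l.2; rewrite ?invg_eq1 V1. Qed.

Lemma lval_len_gt0 l : 0 < len (lv l).
Proof.
by rewrite lt0n; apply/eqP => /len0 e; have := lval_neq1 l; rewrite e eqxx.
Qed.

Lemma lval_lenL l : L l.1 -> len (lv l) = 1%N.
Proof. by move=> /VL; rewrite /lval; case: l.2; rewrite ?lenV. Qed.

Lemma len_cat x (u v : seq (letter n)) : word x = u ++ v -> len x = (size u + size v)%N.
Proof. by rewrite /len => ->; rewrite size_cat. Qed.

Lemma len_catV x (u p : seq (letter n)) :
  word x = u ++ invw p -> len x = (size u + size p)%N.
Proof. by rewrite /len => ->; rewrite size_cat size_invw. Qed.

Lemma size_gt0 (u : seq (letter n)) : (u != [::]) = (0 < size u).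
Proof. by case: u. Qed.

(** For [l = k] this is [cancel_self]; otherwise a shorter product would have a smaller weight. If
    [k] is not to be modified it is a letter, a shorter product would be trivial, and irreducibility
    is applied to the inverse of [l] instead. *)
Lemma nielsen1 k l : l != invl k ->
  len (lv k) <= len (lv k * lv l).
Proof.
move=> nk; rewrite leqNgt; apply/negP => h.
have [e1|n1] := eqVneq k.1 l.1.
  have e : l = k.
    by apply/eqP; apply: contraNT nk => nk; rewrite (@eq_invl _ l k).
  have [p [u [v [ex ey exy]]]] := mul_cancel (lv k) (lv l).
  rewrite e in ey h exy.
  have := cancel_self (p := p) (u := u) (v := v); rewrite -ex -ey.
  move=> /(_ (redw_word _) erefl).
  by have := len_catV ex; have := len_cat ey; have := len_cat exy; rewrite -/(len _); lia.
have [Lk|nL] := boolP (L k.1); last by have := irr n1 nL; rewrite leqNgt mu_len.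
move: h; rewrite lval_lenL // ltnS leqn0 => /eqP/len0 e.
have [Ll|nLl] := boolP (L l.1); first by have := VLL Lk Ll nk; rewrite e eqxx.
have := @irr (invl l) (invl k); rewrite /= eq_sym n1 nLl => /(_ isT isT).
rewrite !lval_inv -invgM e invg1 leqNgt mu_len //.
by rewrite lenV; apply: leq_trans (lval_len_gt0 l).
Qed.

Lemma nielsen1r k l : l != invl k ->
  len (lv l) <= len (lv k * lv l).
Proof.
move=> nk; have := @nielsen1 (invl l) (invl k).
rewrite !lval_inv -invgM !lenV; apply.
by rewrite (inj_eq (inv_inj invlK)) eq_sym -(inj_eq (inv_inj (@invlK J))) invlK.
Qed.

(** Multiplication by [l] exchanges the tail [invw p] of [k] for [invw q] at equal length, so
    irreducibility forbids a smaller code. This is where the half-word part of [mu] is used. *)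
Lemma nielsen_half k l (p q u : seq (letter n)) : l != invl k ->
  word (lv k) = u ++ invw p -> word (lv l) = p ++ invw q ->
  size p = size q -> p != [::] -> redw (u ++ invw q) -> size p <= size u ->
  code p <= code q.
Proof.
move=> nk ek el s p0 r su; rewrite leqNgt; apply/negP => h.
have nkl : k.1 != l.1.
  apply/eqP => e1; have e : l = k.
    by apply/eqP; apply: contraNT nk => nk; rewrite (@eq_invl _ l k).
  move: (el); rewrite e ek => /eqP; rewrite eqseq_cat; last first.
    have e3 : size u = size p by move: (len_catV ek) (len_catV el); rewrite e -s; lia.
    exact: e3.
  by case/andP => _ /eqP/(can_inj (@invwK _)) e2; rewrite e2 ltnn in h.
have nL : ~~ L k.1.
  apply/negP => /lval_lenL e1; move: p0 (len_catV ek).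
  by rewrite size_gt0; lia.
have := irr nkl nL; rewrite leqNgt => /negP; apply.
apply: (mu_half ek) s su h.
exact: word_mul_cancel ek el r.
Qed.

Definition canc x y := ((len x + len y) - len (x * y))./2.

Lemma cancE x y (p u v : seq (letter n)) : word x = u ++ invw p -> word y = p ++ v ->
  word (x * y) = u ++ v -> canc x y = size p.
Proof.
by move=> /len_catV ex /len_cat ey /len_cat e; rewrite /canc ex ey e; lia.
Qed.

(** Each neighbour cancels at most half of [l]. If both cancelled exactly half, then [l = p q^-1]
    with [p] and [q] of equal size, the two comparisons of codes would give [p = q], and [l] would
    be trivial. *)
Lemma nielsen2 k l m : l != invl k -> m != invl l ->
  canc (lv k) (lv l) + canc (lv l) (lv m) < len (lv l).
Proof.
move=> nk nl.
have [p [u [v [ek el ekl]]]] := mul_cancel (lv k) (lv l).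
have [q [u' [w [el' em elm]]]] := mul_cancel (lv l) (lv m).
rewrite (cancE ek el ekl) (cancE el' em elm) ltnNge; apply/negP => h.
have := nielsen1 nk; have := nielsen1r nk; have := nielsen1 nl; have := nielsen1r nl.
have := lval_len_gt0 l.
have := len_catV ek; have := len_cat el; have := len_cat ekl.
have := len_catV el'; have := len_cat em; have := len_cat elm.
move=> s1 s2 s3 s4 s5 s6 s7 h1 h2 h3 h4.
have sp : size p = size u' by lia.
have spq : size p = size q by lia.
move: (el'); rewrite el => /eqP; rewrite eqseq_cat // => /andP[/eqP eu /eqP ev].
subst u' v.
have p0 : p != [::] by rewrite size_gt0; lia.
have c1 : code p <= code q.
  apply: (nielsen_half nk ek el) => //; first by rewrite -ekl; exact: redw_word.
  by lia.
have c2 : code q <= code p.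
  apply: (@nielsen_half (invl m) (invl l) q p (invw w)) => //.
  - by rewrite (inj_eq (inv_inj invlK)) eq_sym -(inj_eq (inv_inj (@invlK J))) invlK.
  - by rewrite lval_inv word_inv em invw_cat.
  - by rewrite lval_inv word_inv el invw_cat invwK.
  - by rewrite size_gt0 -spq -size_gt0.
  - by rewrite -redw_inv invw_cat !invwK -elm; exact: redw_word.
  - have sw : size q <= size w by lia.
    by rewrite size_invw; exact: sw.
have e : p = q by apply: (code_inj spq); apply/eqP; rewrite eqn_leq c1.
move: (redw_word (lv l)); rewrite el -e => /redw_invw_cat.
by move/eqP: p0.
Qed.

Lemma redw_rcons2 z k l : redw (rcons (rcons z k) l) -> l != invl k.
Proof.
by rewrite -!cats1 -catA => /redw_catr; rewrite /redw /= andbT.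
Qed.

(* The product of a reduced word ends with a nonempty part of its last factor
   that survives multiplication by the next one. *)
Lemma nielsen_prod z l : redw (rcons z l) ->
  exists Y s t : seq (letter n),
  [/\ word (ev V (rcons z l)) = Y ++ s, word (lv l) = t ++ s,
    size z <= size Y & size t <= size s] /\
  [/\ s != [::],
    forall k, k \in rcons z l -> len (lv k) <= len (ev V (rcons z l)) &
    forall m, m != invl l -> size t + canc (lv l) (lv m) < len (lv l)].
Proof.
elim/last_ind: z l => [|z k IH] l r.
  exists [::], (word (lv l)), [::].
  rewrite [ev V _]mulg1; split; first by split.
  split.
  - by rewrite size_gt0; exact: lval_len_gt0.
  - by move=> k; rewrite inE => /eqP->.
  move=> m nm; have [p [u [v [el em e]]]] := mul_cancel (lv l) (lv m).
  have := nielsen1r nm; have := nielsen1 nm; have := lval_len_gt0 l.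
  have := len_catV el; have := len_cat em; have := len_cat e.
  by rewrite add0n (cancE el em e); lia.
have nl := redw_rcons2 r.
have r' : redw (rcons z k) by move: r; rewrite -[rcons _ l]cats1 => /redw_catl.
have [Y [s [t [[eY ek sY ts] [s0 hl ht]]]]] := IH k r'.
have [p [u [v [ek' el e]]]] := mul_cancel (lv k) (lv l).
have := ht l nl; rewrite (cancE ek' el e) => lt1.
have s1 := len_cat ek; have s2 := len_catV ek'; have s3 := len_cat el.
have s4 := len_cat e; have n1 := nielsen1 nl; have n2 := nielsen1r nl.
have s5 := lval_len_gt0 l; have s6 := len_cat eY.
have [s' es] : exists s' : seq (letter n), s = s' ++ invw p.
  move: ek'; rewrite ek => /(congr1 (drop (size t))).
  rewrite drop_size_cat // => ->.
  by rewrite drop_cat; case: ltnP => h; [exists (drop (size t) u)|lia].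
have s7 : size s = (size s' + size p)%N by rewrite es size_cat size_invw.
have s'0 : s' != [::] by rewrite size_gt0; lia.
have eu : u = t ++ s'.
  move: ek'; rewrite ek es catA => /eqP; rewrite eqseq_cat; first by case/andP=> /eqP.
  have e5 : size u = (size t + size s')%N by lia.
  by rewrite size_cat; exact/esym/e5.
have rY : redw (Y ++ s' ++ v).
  apply: redw_cat3 => //.
    by move: (redw_word (ev V (rcons z k))); rewrite eY es catA; exact: redw_catl.
  by move: (redw_word (lv k * lv l)); rewrite e eu -catA => /redw_catr.
have eZ : word (ev V (rcons (rcons z k) l)) = (Y ++ s') ++ v.
  rewrite ev_rcons; apply: (word_mul_cancel (p := p)) => //; last by rewrite -catA.
  by rewrite eY es catA.
have s8 := len_cat eZ; rewrite size_cat in s8.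
have Yl : len (lv k) <= len (ev V (rcons z k)).
  by apply: hl; rewrite mem_rcons inE eqxx.
have s9 : 0 < size s' by rewrite -size_gt0.
exists (Y ++ s'), v, p; split; split => //.
- by rewrite size_rcons size_cat; lia.
- by lia.
- by rewrite size_gt0; lia.
- move=> m; rewrite mem_rcons inE => /orP[/eqP->|/hl]; lia.
by move=> m nm; have := nielsen2 nl nm; rewrite (cancE ek' el e).
Qed.

Lemma nielsen_size z : redw z -> size z <= len (ev V z).
Proof.
case/lastP: z => // z k r.
have [Y [s [t [[e _ h _] [s0 _ _]]]]] := nielsen_prod r.
by rewrite size_rcons (len_cat e); move: s0; rewrite size_gt0; lia.
Qed.

Lemma nielsen_free : freew V.
Proof.
by move=> z r e; apply: size0nil; apply/eqP; rewrite -leqn0 (leq_trans (nielsen_size r)) // e.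
Qed.

(** By [nielsen_size] a reduced expression for such an element has a single factor. Standard
    generators are thus found among the members of a reduced family, up to inversion. *)
Lemma nielsen_letter z : len (ev V z) = 1%N -> exists l, ev V z = lv l.
Proof.
rewrite -ev_redu; have := redw_redu z; case: (redu z) => [//|l [|k y]] r e.
  by exists l; rewrite /= mulg1.
by have := nielsen_size r; rewrite e.
Qed.

End NielsenReduced.

(** * Generation, subgroups and internal free products *)

Section Generation.
Local Open Scope group_scope.
Context {G : groupType}.

Definition genby (J : eqType) (V : J -> G) (x : G) := exists z, ev V z = x.

Lemma genby_id (J : eqType) (V : J -> G) j : genby V (V j).
Proof. by exists [:: (j, false)]; rewrite /= mulg1. Qed.

Lemma genby1 (J : eqType) (V : J -> G) : genby V 1.
Proof. by exists [::]. Qed.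

Lemma genbyM (J : eqType) (V : J -> G) x y : genby V x -> genby V y -> genby V (x * y).
Proof. by move=> [z <-] [z' <-]; exists (z ++ z'); rewrite ev_cat. Qed.

Lemma genbyV (J : eqType) (V : J -> G) x : genby V x -> genby V x^-1.
Proof. by move=> [z <-]; exists (invw z); rewrite ev_invw. Qed.

Lemma subgroup_ev (J : eqType) (V : J -> G) (A : set G) z : subgroup A ->
  (forall l, l \in z -> A (V l.1)) -> A (ev V z).
Proof.
move=> [A1 AM AV]; elim: z => //= l z IH h; apply: AM; last first.
  by apply: IH => k kz; apply: h; rewrite inE kz orbT.
by have := h l; rewrite inE eqxx /lval => /(_ isT); case: l.2 => // /AV.
Qed.

Lemma subgroup_genby (J : eqType) (V : J -> G) : subgroup (genby V).
Proof. by split; [exact: genby1|exact: genbyM|exact: genbyV]. Qed.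

Lemma genby_trans (J K : eqType) (V : J -> G) (W : K -> G) x :
  (forall j, genby W (V j)) -> genby V x -> genby W x.
Proof. by move=> h [z <-]; apply: subgroup_ev => //; exact: subgroup_genby. Qed.

Definition rename (J K : eqType) (e : J -> K) (z : seq (J * bool)) :=
  [seq (e l.1, l.2) | l <- z].

Lemma ev_rename (J K : eqType) (e : J -> K) (V : K -> G) z :
  ev (V \o e) z = ev V (rename e z).
Proof. by elim: z => //= l z ->. Qed.

Lemma redw_rename (J K : eqType) (e : J -> K) z : injective e ->
  redw (rename e z) = redw z.
Proof.
move=> ie; rewrite /redw sorted_map; apply: eq_sorted => a b /=.
by rewrite /invl !xpair_eqE (inj_eq ie).
Qed.

Lemma freew_rename (J K : eqType) (e : J -> K) (V : K -> G) : injective e ->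
  freew V -> freew (V \o e).
Proof.
move=> ie fV z rz; rewrite ev_rename => /fV; rewrite redw_rename // => /(_ rz).
by case: z rz.
Qed.

Definition upd (J : eqType) (V : J -> G) (k l : J * bool) (j : J) : G :=
  if j == k.1 then
    if k.2 then (lval V k * lval V l)^-1 else lval V k * lval V l
  else V j.

Lemma upd_lval (J : eqType) (V : J -> G) (k l : J * bool) :
  lval (upd V k l) k = lval V k * lval V l.
Proof. by case: k => i []; rewrite {1}/lval /upd eqxx ?invgK. Qed.

Lemma upd_other (J : eqType) (V : J -> G) (k l : J * bool) m : m.1 != k.1 ->
  lval (upd V k l) m = lval V m.
Proof. by rewrite /lval /upd => /negPf->. Qed.

Lemma genby_lval (J : eqType) (V : J -> G) l : genby V (lval V l).
Proof. by exists [:: l]; rewrite /= mulg1. Qed.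

Lemma genby_lvalP (J K : eqType) (V : J -> G) (W : K -> G) l : genby W (lval V l) ->
  genby W (V l.1).
Proof. by rewrite /lval; case: l.2 => // /genbyV; rewrite invgK. Qed.

Lemma upd_genby (J : eqType) (V : J -> G) k l j : genby V (upd V k l j).
Proof.
case: (eqVneq j k.1) => [->|nj]; last by rewrite /upd (negPf nj); exact: genby_id.
apply: genby_lvalP; rewrite upd_lval; apply: genbyM; exact: genby_lval.
Qed.

Lemma upd_genby' (J : eqType) (V : J -> G) k l j : k.1 != l.1 ->
  genby (upd V k l) (V j).
Proof.
move=> kl; case: (eqVneq j k.1) => [->|nj].
  apply: genby_lvalP; rewrite -[lval V k](mulgK (lval V l)) -upd_lval.
  apply: genbyM; first exact: genby_lval.
  by apply: genbyV; rewrite -(@upd_other _ V k l l); [exact: genby_lval|rewrite eq_sym].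
have -> : V j = lval (upd V k l) (j, false) by rewrite upd_other.
exact: genby_lval.
Qed.

Lemma morph_ev (H : groupType) (h : G -> H) (J : eqType) (V : J -> G) z :
  {morph h : x y / x * y} -> h (ev V z) = ev (h \o V) z.
Proof.
move=> hM; have h1 : h 1 = 1 by apply: (mulgI (h 1)); rewrite -hM !mulg1.
elim: z => //= l z <-; rewrite hM; congr (_ * _); rewrite /lval /=.
by case: l.2 => //; apply: (mulgI (h (V l.1))); rewrite -hM !mulgV.
Qed.

Lemma morph_ev_in (H : groupType) (h : G -> H) (A : set G) (J : eqType) (V : J -> G) z :
  subgroup A -> {in A &, {morph h : x y / x * y}} ->
  (forall l, l \in z -> A (V l.1)) -> h (ev V z) = ev (h \o V) z.
Proof.
move=> sA hM; have [A1 AM AV] := sA.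
have h1 : h 1 = 1 by apply: (mulgI (h 1)); rewrite -hM ?mulg1 // inE.
elim: z => //= l z IH hz.
have Al : A (V l.1) by apply: hz; rewrite inE eqxx.
have hz' k : k \in z -> A (V k.1) by move=> kz; apply: hz; rewrite inE kz orbT.
rewrite -IH // hM; [|rewrite inE|rewrite inE; exact: subgroup_ev].
  congr (_ * _); rewrite /lval /=; case: l.2 => //.
  by apply: (mulgI (h (V l.1))); rewrite -hM ?mulgV // inE //; exact: AV.
by rewrite /lval; case: l.2 => //; exact: AV.
Qed.

End Generation.

(** Bundled so that a subgroup becomes a group type and can be the target in the universal property
    of a free product. *)
Record subgrp (G : groupType) := Subgrp { subgrp_set : set G; subgrpP : subgroup subgrp_set }.

Section SubgroupType.
Local Open Scope group_scope.
Context {G : groupType} (C : subgrp G).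

Definition sub_of : Type := set_type (subgrp_set C).
HB.instance Definition _ := SubChoice.on sub_of.

Let mk (x : G) (h : subgrp_set C x) : sub_of := SigSub (mem_set h).

Lemma sub_of_in (x : sub_of) : subgrp_set C (val x).
Proof. exact: set_mem (valP x). Qed.

Let one : sub_of := mk (let: And3 h _ _ := subgrpP C in h).
Let mul (x y : sub_of) : sub_of :=
  mk (let: And3 _ h _ := subgrpP C in h _ _ (sub_of_in x) (sub_of_in y)).
Let inv (x : sub_of) : sub_of := mk (let: And3 _ _ h := subgrpP C in h _ (sub_of_in x)).

Let mulA : associative mul. Proof. by move=> x y z; apply/val_inj/mulgA. Qed.
Let mul1 : left_id one mul. Proof. by move=> x; apply/val_inj/mul1g. Qed.
Let mulr1 : right_id one mul. Proof. by move=> x; apply/val_inj/mulg1. Qed.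
Let mulV : left_inverse one inv mul. Proof. by move=> x; apply/val_inj/mulVg. Qed.
Let mulrV : right_inverse one inv mul. Proof. by move=> x; apply/val_inj/mulgV. Qed.

HB.instance Definition _ := isGroup.Build sub_of mulA mul1 mulr1 mulV mulrV.

Lemma val_subM (x y : sub_of) : val (x * y) = val x * val y. Proof. by []. Qed.

Definition to_sub (x : G) : sub_of :=
  if pselect (subgrp_set C x) is left h then mk h else one.

Lemma to_subE (x : G) : subgrp_set C x -> val (to_sub x) = x.
Proof. by rewrite /to_sub; case: pselect. Qed.

End SubgroupType.

Section FreeProduct.
Local Open Scope group_scope.
Context {G : groupType} (A B : set G).
Hypothesis AB : internal_free_product A B.

(** The universal property is applied with target the subgroup generated by [A] and [B]; followed by
    the inclusion, the resulting map is the identity by uniqueness. *)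
Lemma free_product_gen x : genby (fun u : {u : G | `[< A u \/ B u >]} => val u) x.
Proof.
case: AB => sA sB univ; set V := fun u : {u : G | _} => val u.
pose C := Subgrp (subgroup_genby V).
have AC u : A u \/ B u -> genby V u.
  by move=> h; have := genby_id V (exist _ u (asboolT h)).
pose i u := to_sub C u.
have iE u : A u \/ B u -> val (i u) = u by move=> /AC; exact: (@to_subE _ C).
have iA : {in A &, {morph i : u v / u * v}}.
  move=> u v; rewrite !inE => Au Av; apply/val_inj.
  have Auv : A (u * v) by case: sA => _ + _; apply.
  by rewrite val_subM (iE _ (or_introl Auv)) (iE _ (or_introl Au)) (iE _ (or_introl Av)).
have iB : {in B &, {morph i : u v / u * v}}.
  move=> u v; rewrite !inE => Bu Bv; apply/val_inj.
  have Buv : B (u * v) by case: sB => _ + _; apply.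
  by rewrite val_subM (iE _ (or_intror Buv)) (iE _ (or_intror Bu)) (iE _ (or_intror Bv)).
have [h [[hM hA hB] _]] := univ _ i i iA iB.
have [h0 [_ uq]] := univ G id id (fun _ _ _ _ => erefl) (fun _ _ _ _ => erefl).
have e1 : h0 = id by apply: uq; split.
have e2 : h0 = val \o h.
  apply: uq; split => [u v|u uA|u uB]; first by rewrite /= hM.
  - by rewrite /= hA // iE //; left; exact: set_mem.
  - by rewrite /= hB // iE //; right; exact: set_mem.
have -> : x = val (h x) by rewrite -[val _]/((val \o h) x) -e2 e1.
exact: (sub_of_in (h x)).
Qed.

(** The retraction extends the identity of [A] and the trivial map on [B]. *)
Lemma free_product_proj : exists r : G -> G,
  [/\ {morph r : x y / x * y}, forall x, A (r x) & forall x, A x -> r x = x].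
Proof.
case: (AB) => sA sB univ; have [A1 AM AV] := sA.
have [r [[rM rA rB] _]] := univ G id (fun=> 1) (fun _ _ _ _ => erefl)
  (fun _ _ _ _ => esym (mul1g _)).
exists r; split => // [x|x Ax]; last by rewrite rA // inE.
have [z <-] := free_product_gen x; rewrite morph_ev //.
apply: subgroup_ev => // l _ /=; have /asboolP [h|h] := valP l.1.
  by rewrite rA ?inE.
by rewrite rB ?inE.
Qed.

End FreeProduct.

Lemma internal_free_productC (G : groupType) (A B : set G) :
  internal_free_product A B -> internal_free_product B A.
Proof.
move=> [sA sB univ]; split => // H f g fM gM.
have [h [[hM hA hB] uq]] := univ H g f gM fM.
exists h; split => // h' [h1 h2 h3]; apply: uq; by split.
Qed.

(** * Existence of Nielsen reduced families *)

Section NielsenMin.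
Local Open Scope group_scope.
Context {n : nat} (L : pred 'I_n).
Local Notation F := (free_group n).

Lemma mu_upd (J : eqType) (V : J -> F) k l :
  mu (lval V k * lval V l) < mu (lval V k) -> mu (upd V k l k.1) < mu (V k.1).
Proof.
by case: k => j []; rewrite /upd eqxx {2 3}/lval //= => h; rewrite muV -[X in _ < X]muV.
Qed.

Definition withL s (w : 'I_s -> F) (j : {i | L i} + 'I_s) : F :=
  match j with inl i => gen (val i) | inr i => w i end.

Definition inlb s (j : {i | L i} + 'I_s) : bool := if j is inl _ then true else false.

Definition nielsen_red s (w : 'I_s -> F) :=
  let V := withL w in
  [/\ forall i, V i != 1, forall i, inlb i -> len (V i) = 1%N,
   forall k l, inlb k.1 -> inlb l.1 -> l != invl k -> lval V k * lval V l != 1 &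
   forall k l, k.1 != l.1 -> ~~ inlb k.1 -> mu (lval V k) <= mu (lval V k * lval V l)].

(** Take the fewest members, then the least total weight: a trivial member could be dropped, and an
    elementary transformation decreasing one weight would decrease the total. *)
Lemma nielsen_min s (w : 'I_s -> F) : exists s' (w' : 'I_s' -> F),
  [/\ s' <= s, forall j, genby (withL w) (withL w' j),
      forall j, genby (withL w') (withL w j) & nielsen_red w'].
Proof.
pose same s1 (w1 : 'I_s1 -> F) := (forall j, genby (withL w) (withL w1 j)) /\
  (forall j, genby (withL w1) (withL w j)).
pose P s1 := `[< exists w1 : 'I_s1 -> F, same s1 w1 >].
have exP : exists s1, P s1.
  by exists s; apply/asboolP; exists w; split => j; exact: genby_id.
case: (ex_minnP exP) => s1 /asboolP [w0 same0] mins.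
pose Q k := `[< exists w1 : 'I_s1 -> F, same s1 w1 /\ \sum_i mu (w1 i) = k >].
have exQ : exists k, Q k by exists (\sum_i mu (w0 i)); apply/asboolP; exists w0.
case: (ex_minnP exQ) => k0 /asboolP [w1 [same1 wk]] mink.
exists s1, w1; split; [|exact: same1.1|exact: same1.2|].
  by apply: mins; apply/asboolP; exists w; split => j; exact: genby_id.
split.
- case=> [i|j]; first by [].
  apply/eqP => /= w1j; case: s1 w0 same0 mins Q exQ w1 same1 wk mink j w1j.
    by move=> ? ? ? ? ? ? ? ? ? [].
  move=> s1 _ _ mins _ _ w1 [sa sb] _ _ j w1j.
  suff /mins : P s1 by rewrite ltnn.
  apply/asboolP; exists (w1 \o lift j); split.
    by case=> [i|i]; [exact: sa (inl i)|exact: sa (inr (lift j i))].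
  move=> i; apply: (genby_trans _ (sb i)) => -[i'|i'] /=; first exact: genby_id (inl i').
  case: (unliftP j i') => [j'|] ->; last by rewrite w1j; exact: genby1.
  exact: genby_id (inr j').
- by case.
- move=> [[i|//] e] [[j|//] f] _ _ nkl; apply/eqP.
  rewrite -[lval _ _]/(lval gen (val i, e)) -[X in _ * X]/(lval gen (val j, f)) => h.
  have r : redw [:: (val i, e); (val j, f)].
    rewrite /redw /= andbT; apply: contraNN nkl; rewrite /invl /= !xpair_eqE.
    move=> /andP[/eqP ji ->]; rewrite andbT; apply/eqP.
    by congr inl; apply: val_inj.
  by have := @freew_gen n _ r; rewrite /= mulg1 h => /(_ erefl).
move=> [[//|j] e] l njl _; rewrite leqNgt; apply/negP => h.
pose k : ({i | L i} + 'I_s1) * bool := (inr j, e).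
pose w2 i := upd (withL w1) k l (inr i).
have ew2 : withL w2 =1 upd (withL w1) k l by case.
suff /mink : Q (\sum_i mu (w2 i)).
  rewrite leqNgt -wk => /negP; apply.
  rewrite (bigD1 j) //= [X in _ < X](bigD1 j) //=.
  have -> : \sum_(i < s1 | i != j) mu (w2 i) = \sum_(i < s1 | i != j) mu (w1 i).
    by apply: eq_bigr => i ij; rewrite /w2 /upd /= (inj_eq (@inr_inj _ _)) (negPf ij).
  by rewrite ltn_add2r; exact: (mu_upd h).
apply/asboolP; exists w2; split => //; split => i.
  rewrite ew2; apply: (genby_trans same1.1); exact: upd_genby.
apply: (genby_trans _ (same1.2 i)) => i'.
have [z ez] := upd_genby' (withL w1) i' njl.
by exists z; rewrite -ez; apply: eq_ev => l' _; exact: ew2.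
Qed.

End NielsenMin.

(** * Bases and the rank of the free group *)

Section Bases.
Local Open Scope group_scope.
Context {n : nat}.
Local Notation F := (free_group n).
Implicit Types (b : 'I_n -> F) (A : set F).

Definition isbasis (J : eqType) (V : J -> F) := freew V /\ forall x, genby V x.

Lemma isbasis_gen : isbasis gen.
Proof. by split; [exact: freew_gen|move=> x; exists (word x); exact: ev_gen_word]. Qed.

Definition co b x : seq (letter n) :=
  if pselect (exists z, redw z /\ ev b z = x) is left h then projT1 (cid h) else [::].

Lemma coP b x : isbasis b -> redw (co b x) /\ ev b (co b x) = x.
Proof.
move=> [_ /(_ x) [z ez]]; rewrite /co; case: pselect => [h|[]]; first exact: projT2 (cid h).
by exists (redu z); rewrite redw_redu ev_redu.
Qed.

Lemma ev_co b x : isbasis b -> ev b (co b x) = x.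
Proof. by case/(coP x). Qed.

Lemma redw_co b x : isbasis b -> redw (co b x).
Proof. by case/(coP x). Qed.

Lemma co_uniq b x z : isbasis b -> redw z -> ev b z = x -> co b x = z.
Proof.
move=> bb rz ez; apply: (freew_inj bb.1) => //; first exact: redw_co.
by rewrite ev_co.
Qed.

End Bases.

Section Rank.
Local Open Scope group_scope.

(** In a Nielsen reduced generating family each standard generator, having length one, is a member
    or the inverse of one, and distinct generators use distinct members. *)
Lemma rank_gen n m (g : 'I_m -> free_group n) : (forall x, genby g x) -> n <= m.
Proof.
move=> hg.
have [s [w [sm _ ww [V1 VL VLL irr]]]] := nielsen_min pred0 g.
have gw x : genby (@withL n pred0 _ w) x.
  apply: (genby_trans ww); apply: (genby_trans _ (hg x)) => j.
  exact: (genby_id (@withL n pred0 _ g) (inr j)).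
have ex i : exists l, lval (@withL n pred0 _ w) l = gen i.
  have [z ez] := gw (gen i).
  have [l el] : exists l, ev (@withL n pred0 _ w) z = lval (@withL n pred0 _ w) l.
    by apply: (nielsen_letter V1 VL VLL irr); rewrite ez.
  by exists l; rewrite -el.
pose f i := (projT1 (cid (ex i))).1.
have fi : injective f.
  have gi (i j : 'I_n) : gen i = gen j -> i = j by move=> /(congr1 (@word n)) [].
  have gVi (i j : 'I_n) : gen i = (gen j)^-1 -> i = j by move=> /(congr1 (@word n)).
  move=> i j; rewrite /f; case: cid => -[k e] /= ek; case: cid => -[l e'] /= el kl.
  move: ek el; rewrite -{}kl /lval /=; case: e; case: e' => ek el.
  - by apply: gi; rewrite -ek -el.
  - by apply: gVi; rewrite -ek -el.
  - by apply: gVi; rewrite -ek -el invgK.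
  - by apply: gi; rewrite -ek -el.
have := leq_card f fi; rewrite card_sum card_ord => h.
suff c0 : #|{: {i : 'I_n | pred0 i}}| = 0%N by rewrite c0 card_ord in h; exact: leq_trans sm.
by apply/eqP/pred0P => -[].
Qed.

(** [rank_gen] is applied in both directions: the basis generates, and the homomorphism [h] sending
    it to letters carries the standard generators to generators of a free group on [#|J|]
    letters. *)
Lemma rank_basis n (J : finType) (V : J -> free_group n) : isbasis V -> #|J| = n.
Proof.
move=> [fV gV]; apply/eqP; rewrite eqn_leq; apply/andP; split.
  pose gJ (j : J) := gen (enum_rank j).
  pose h (x : free_group n) := ev gJ (projT1 (cid (gV x))).
  apply: (rank_gen (g := fun i => h (gen i))) => y.
  have hE z : h (ev V z) = ev gJ z.
    by rewrite /h; case: cid => z' /= ez; exact: (freew_ev gJ fV ez).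
  have hM : {morph h : x y / x * y}.
    move=> x y'; rewrite -(projT2 (cid (gV x))) -(projT2 (cid (gV y'))).
    by rewrite -ev_cat !hE ev_cat.
  exists (word (fhom (V \o enum_val) y)).
  rewrite -[ev _ _]/(ev (h \o gen) _) -morph_ev // ev_gen_word /fhom ev_rename hE.
  rewrite -ev_rename -[RHS]ev_gen_word; apply: eq_ev => l _ /=.
  by rewrite /gJ enum_valK.
apply: (rank_gen (g := V \o enum_val)) => x; have [z <-] := gV x.
exists (rename enum_rank z); rewrite -ev_rename; apply: eq_ev => l _ /=.
by rewrite enum_rankK.
Qed.

End Rank.

(** * Bases adapted to free factors *)

Section FactorBases.
Local Open Scope classical_set_scope.
Local Open Scope group_scope.
Context {n : nat}.
Local Notation F := (free_group n).
Implicit Types (b : 'I_n -> F) (A : set F).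

(** Written in the basis [b], the elements [b i] are letters, which Nielsen reduction of generators
    of [A] leaves untouched; the reduced family is free and still generates [A]. *)
Lemma basis_extend b (L : pred 'I_n) A s (g : 'I_s -> F) : isbasis b -> subgroup A ->
  (forall j, A (g j)) -> (forall x, A x -> genby g x) -> (forall i, L i -> A (b i)) ->
  exists (J : finType) (V : J -> F),
    [/\ freew V, forall j, A (V j), forall x, A x -> genby V x &
        forall i, L i -> exists j, V j = b i].
Proof.
move=> bb sA gA Ag bA.
pose c x := ev gen (co b x).
have cK x : fhom b (c x) = x by rewrite /c fhom_ev -[RHS](ev_co x bb); apply: eq_ev => l _; rewrite fhom_gen.
have [s' [w [_ ww ww' [V1 VL VLL irr]]]] := nielsen_min L (c \o g).
pose wL := @withL n L _ w; pose V j := fhom b (wL j).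
have hV z : ev V z = fhom b (ev wL z) by rewrite fhom_ev.
have Ac j : A (fhom b (@withL n L _ (c \o g) j)).
  by case: j => [[i Li]|j] /=; [rewrite fhom_gen; exact: bA|rewrite cK].
exists _, V; split.
- move=> z rz; rewrite hV => e.
  apply: (nielsen_free V1 VL VLL irr rz).
  by have := bb.1 _ (redw_word _) e; case: (ev _ z) => ? ? /= ?; apply/val_inj.
- move=> j; have [z ez] := ww j.
  by rewrite /V /wL -ez fhom_ev; apply: subgroup_ev => // l _; exact: Ac.
- move=> x /Ag [z <-]; apply: (genby_trans (V := g)); last by exists z.
  move=> j; have [z' ez'] := ww' (inr j); exists z'.
  by rewrite hV ez' /= cK.
- by move=> i Li; exists (inl (exist _ i Li)); rewrite /V /= fhom_gen.
Qed.

(** Homomorphisms from [A] and [B] to a free group on [J + K] letters glue to one on the whole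
    group; a relation in the united family would become a relation between letters. *)
Lemma free_product_basis A B (J K : finType) (V : J -> F) (W : K -> F) :
  internal_free_product A B -> freew V -> (forall j, A (V j)) ->
  (forall x, A x -> genby V x) -> freew W -> (forall j, B (W j)) ->
  (forall x, B x -> genby W x) ->
  isbasis (fun j : J + K => match j with inl j => V j | inr k => W k end).
Proof.
move=> AB fV AV VA fW BW WB; set U := fun j : J + K => _.
have [sA sB univ] := AB.
pose H := free_group #|{: J + K}|.
pose gU (j : J + K) : H := gen (enum_rank j).
pose f x : H := if pselect (genby V x) is left h then ev (gU \o inl) (projT1 (cid h)) else 1.
pose g x : H := if pselect (genby W x) is left h then ev (gU \o inr) (projT1 (cid h)) else 1.
have fE z : f (ev V z) = ev (gU \o inl) z.
  rewrite /f; case: pselect => [h|[]]; last by exists z.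
  by case: cid => z' /= ez; exact: (freew_ev _ fV ez).
have gE z : g (ev W z) = ev (gU \o inr) z.
  rewrite /g; case: pselect => [h|[]]; last by exists z.
  by case: cid => z' /= ez; exact: (freew_ev _ fW ez).
have fM : {in A &, {morph f : x y / x * y}}.
  move=> x y; rewrite !inE => /VA [z <-] /VA [z' <-].
  by rewrite -ev_cat !fE ev_cat.
have gM : {in B &, {morph g : x y / x * y}}.
  move=> x y; rewrite !inE => /WB [z <-] /WB [z' <-].
  by rewrite -ev_cat !gE ev_cat.
have [h [[hM hA hB] _]] := univ H f g fM gM.
have hU j : h (U j) = gU j.
  case: j => j /=.
    rewrite hA ?inE //; have := fE [:: (j, false)]; rewrite /= !mulg1.
    by rewrite /lval /=.
  rewrite hB ?inE //; have := gE [:: (j, false)]; rewrite /= !mulg1.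
  by rewrite /lval /=.
have hev z : h (ev U z) = ev gU z.
  by rewrite morph_ev //; apply: eq_ev => l _ /=.
split.
  move=> z rz e; have := hev z; rewrite e.
  have -> : h 1 = 1 by apply: (mulgI (h 1)); rewrite -hM !mulg1.
  by move/esym; apply: (freew_rename (e := enum_rank) _ freew_gen) => //.
move=> x; have [z <-] := free_product_gen AB x.
apply: (subgroup_ev (subgroup_genby U)) => l _.
have /asboolP [/VA|/WB] := valP l.1; apply: genby_trans => j.
  exact: (genby_id U (inl j)).
exact: (genby_id U (inr j)).
Qed.

(** The retraction onto a free factor carries the standard generators to generators of the
    factor. *)
Lemma factor_fg A : free_factor A ->
  [/\ subgroup A & exists s (g : 'I_s -> F), (forall j, A (g j)) /\ forall x, A x -> genby g x].
Proof.
move=> [B AB]; split; first by case: AB.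
have [r [rM rA rid]] := free_product_proj AB.
exists n, (r \o gen); split=> [j|x Ax]; first exact: rA.
by exists (word x); rewrite -morph_ev // ev_gen_word rid.
Qed.

Definition adapted b A := forall x, A x -> exists2 z, ev b z = x & forall l, l \in z -> A (b l.1).

Lemma adapted_genby b A (J : eqType) (V : J -> F) :
  (forall x, A x -> genby V x) -> (forall j, exists2 i, b i = V j & A (V j)) -> adapted b A.
Proof.
move=> VA h x /VA [z <-].
pose e j := s2val (cid2 (h j)).
have eE j : b (e j) = V j by rewrite /e; case: cid2.
exists (rename e z); first by rewrite -ev_rename; apply: eq_ev => l _ /=.
move=> l /mapP [k _ ->] /=; rewrite eE.
by case: (h k.1).
Qed.

(** Induction from the bottom of the chain: the basis elements lying in the smaller factors are
    completed to a basis of the top factor [A], and a basis of a complement of [A] is added.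
    [rank_basis] allows the result to be indexed by ['I_n] again. *)
Lemma adapted_exists (c : seq (set F)) : (forall A, A \in c -> free_factor A) ->
  pairwise (fun A B => `[< A `<=` B >]) c ->
  exists2 b, isbasis b & forall A, A \in c -> adapted b A.
Proof.
elim/last_ind: c => [|c A IH] ff; first by exists gen => //; exact: isbasis_gen.
rewrite pairwise_rcons => /andP[/allP cA pc].
have [b bb bc] : exists2 b, isbasis b & forall A, A \in c -> adapted b A.
  by apply: IH => // B Bc; apply: ff; rewrite mem_rcons inE Bc orbT.
have fA : free_factor A by apply: ff; rewrite mem_rcons inE eqxx.
have [B AB] := fA.
have [sA [s [g [gA Ag]]]] := factor_fg fA.
have [|sB [t [g' [gB Bg]]]] := @factor_fg B.
  by exists A; exact: internal_free_productC.
pose L i := `[< exists2 C, C \in c & C (b i) >].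
have LA i : L i -> A (b i).
  by move=> /asboolP [C /cA /asboolP]; apply.
have [J [V [fV AV VA VL]]] := basis_extend bb sA gA Ag LA.
have [K [W [fW BW WB _]]] := basis_extend (L := pred0) bb sB gB Bg (fun i h => False_ind _ (notF h)).
have bU := free_product_basis AB fV AV VA fW BW WB.
have cn := rank_basis bU; move: bU; set U := (fun j : J + K => _) => bU.
pose e (i : 'I_n) : J + K := enum_val (cast_ord (esym cn) i).
pose e' (j : J + K) : 'I_n := cast_ord cn (enum_rank j).
have eK j : e (e' j) = j by rewrite /e /e' cast_ordK enum_rankK.
have bUe : isbasis (U \o e).
  split; first by apply: freew_rename bU.1 => // i j /enum_val_inj/cast_ord_inj.
  move=> x; have [z <-] := bU.2 x; exists (rename e' z).
  by rewrite -ev_rename; apply: eq_ev => l _; rewrite /= eK.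
exists (U \o e) => // C; rewrite mem_rcons inE => /orP[/eqP->|Cc].
  by apply: (adapted_genby VA) => j; exists (e' (inl j)); rewrite /= ?eK.
apply: (adapted_genby (V := fun i : {i | `[< C (b i) >]} => b (val i)) (A := C)).
  move=> y /(bc C Cc y) [z' <- hz'].
  have : forall l, l \in z' -> genby (fun i : {i | `[< C (b i) >]} => b (val i)) (b l.1).
    move=> l lz'; have Cl := asboolT (hz' l lz').
    exact: (genby_id (fun i : {i | `[< C (b i) >]} => b (val i)) (exist _ l.1 Cl)).
  by apply: subgroup_ev; exact: subgroup_genby.
case=> i /= /asboolP Ci.
have [j ej] : exists j, V j = b i by apply: VL; apply/asboolP; exists C.
by exists (e' (inl j)) => //; rewrite /= eK.
Qed.

End FactorBases.

(** * Whitehead moves *)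

Section WhiteheadMoves.
Local Open Scope group_scope.
Context {n : nat}.
Implicit Types (P Q : {set letter n}) (a c l : letter n) (u : seq (letter n)).

Definition valid P a := (a \in P) && (invl a \notin P).

Definition pw (G : groupType) (x : G) (e : bool) : G := if e then x else 1.

(** Whitehead's automorphism of the second kind with set [P] and multiplier [a]. *)
Definition move (G : groupType) (b : 'I_n -> G) P a (i : 'I_n) : G :=
  if i == a.1 then b i else
  pw (lval b a)^-1 ((i, false) \in P) * b i * pw (lval b a) ((i, true) \in P).

Lemma invg_pw (G : groupType) (x : G) e : (pw x e)^-1 = pw x^-1 e.
Proof. by case: e; rewrite /= ?invg1. Qed.

Lemma lval_move (G : groupType) (b : 'I_n -> G) P a l : l.1 != a.1 ->
  lval (move b P a) l =
  pw (lval b a)^-1 (l \in P) * lval b l * pw (lval b a) (invl l \in P).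
Proof.
case: l => i [] /= ia; rewrite /lval /move (negPf ia) /invl //=.
by rewrite !invgM !invg_pw invgK mulgA.
Qed.

Lemma lval_move_same (G : groupType) (b : 'I_n -> G) P a l : l.1 = a.1 ->
  lval (move b P a) l = lval b l.
Proof. by move=> e; rewrite /lval /move e eqxx. Qed.

Lemma eq_lval (G : groupType) (b b' : 'I_n -> G) :
  (forall i, exists e, lval b (i, e) = lval b' (i, e)) -> b = b'.
Proof.
move=> h; apply: funext => i; have [[] //] := h i.
by rewrite /lval /= => /invg_inj.
Qed.

Lemma eq_lval2 (G : groupType) (b b' : 'I_n -> G) a c :
  lval b a = lval b' a -> lval b c = lval b' c ->
  (forall l, l.1 != a.1 -> l.1 != c.1 -> lval b l = lval b' l) -> b = b'.
Proof.
move=> ha hc h; apply: eq_lval => i.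
case: (eqVneq i a.1) => [->|ia]; first by exists a.2; rewrite -surjective_pairing.
case: (eqVneq i c.1) => [->|ic]; first by exists c.2; rewrite -surjective_pairing.
by exists false; apply: h.
Qed.

Lemma letter_cases l a : l.1 = a.1 -> l = a \/ l = invl a.
Proof. by move=> e; case: (eqVneq l a) => [|/(eq_invl e)]; [left|right]. Qed.

Definition inv_set P a := invl a |: (P :\ a).

Lemma valid_inv P a : valid P a -> valid (inv_set P a) (invl a).
Proof.
move=> _; rewrite /valid invlK !inE !eqxx /= orbF eq_sym.
exact: invl_neq.
Qed.

Lemma mem_inv_set P a l : l.1 != a.1 -> (l \in inv_set P a) = (l \in P).
Proof.
move=> h; rewrite !inE; have [e|_] /= := eqVneq l (invl a); first by rewrite e eqxx in h.
by have [e|//] := eqVneq l a; rewrite e eqxx in h.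
Qed.

Lemma move_inv (G : groupType) (b : 'I_n -> G) P a :
  move (move b P a) (inv_set P a) (invl a) = b.
Proof.
have e : lval (move b P a) (invl a) = (lval b a)^-1 by rewrite lval_move_same // lval_inv.
apply: (@eq_lval2 _ _ _ a a).
- by rewrite !lval_move_same.
- by rewrite !lval_move_same.
move=> l la _; rewrite lval_move // e invgK lval_move // !mem_inv_set //.
by case: (l \in P); case: (invl l \in P); rewrite /= ?mulg1 ?mul1g ?mulgA ?mulgV ?mulgK ?mulVKg ?mul1g ?mulgK.
Qed.

(* [phi P a s u] rewrites a word [u] in a basis [b] as a word in [move b P a].
   Blow up the vertex of the rose into two vertices joined by a new edge, [true]
   being the vertex with the directions in [P]; [s] is the current vertex, the
   letter [a] of the new word is the new edge, and the old edge [a] is collapsed. *)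
Fixpoint phi P a (s : bool) u : seq (letter n) :=
  match u with
  | [::] => if s then [:: invl a] else [::]
  | l :: u' => (if s == (l \in P) then [::] else [:: if s then invl a else a]) ++
               (if l.1 == a.1 then [::] else [:: l]) ++ phi P a (invl l \in P) u'
  end.

(* The turns of a word are counted with a base point, outside [P], at both ends. *)
Fixpoint cutw P (s : bool) u : nat :=
  match u with
  | [::] => s
  | l :: u' => (s != (l \in P)) + cutw P (invl l \in P) u'
  end.

Definition cut P u := cutw P false u.
Definition occ a u := count (fun l => l.1 == a.1) u.

(** Every crossing between the two vertices writes one letter of index [a.1], and every old letter
    of that index is erased. *)
Lemma size_phi P a s u : size (phi P a s u) + occ a u = size u + cutw P s u.
Proof.
elim: u s => [|l u IH] s /=; first by case: s.
have := IH (invl l \in P); rewrite !size_cat /occ /=.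
by case: (s == _); case: (l.1 == a.1) => /=; lia.
Qed.

Lemma ev_phi (G : groupType) (b : 'I_n -> G) P a s u : valid P a ->
  ev (move b P a) (phi P a s u) = pw (lval b a)^-1 s * ev b u.
Proof.
move=> /andP[aP aN]; have eA : lval (move b P a) a = lval b a by rewrite lval_move_same.
have eA' : lval (move b P a) (invl a) = (lval b a)^-1 by rewrite lval_inv eA.
elim: u s => [|l u IH] s; first by case: s; rewrite /= ?eA' ?mulg1.
rewrite [phi _ _ _ _]/= !ev_cat IH [ev b (_ :: _)]/=.
have -> : ev (move b P a) (if s == (l \in P) then [::] else [:: if s then invl a else a]) =
   pw (lval b a)^-1 s * pw (lval b a) (l \in P).
  case: s; case: (l \in P) => /=; rewrite ?mulg1 ?mul1g ?mulVg //.
case: eqP => [la|/eqP la].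
  case: (letter_cases la) => ->; rewrite ?invlK aP (negPf aN) /= ?mulg1 ?mul1g.
    by rewrite mulgA.
  by rewrite lval_inv.
rewrite /= mulg1 lval_move //; case: (l \in P); case: (invl l \in P);
 by rewrite /= ?mulg1 ?mul1g !mulgA ?mulgK ?mulgVK // ?mulgK.
Qed.

Definition cross a (s : bool) := if s then invl a else a.

(* The first letter of [u] is the collapsed letter, starting at [s]. *)
Definition skips P a s u := if u is k :: _ then (k.1 == a.1) && ((k \in P) == s) else false.

(** The induction must control the first letter of the output: it crosses the new edge from the
    current vertex, or is the first letter of the input, unless a collapsed letter was skipped
    before. This is what excludes cancellation where a letter is put in front. *)
Lemma phi_red P a s u : valid P a -> redw u ->
  redw (phi P a s u) /\
  (if phi P a s u is h :: _ then
     if h.1 == a.1 then (h == cross a s) || ((h == cross a (~~ s)) && skips P a s u)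
     else (((h \in P) == s) && (ohead u == Some h)) || (((h \in P) != s) && skips P a s u)
   else true).
Proof.
move=> /andP[aP aN]; elim: u s => [|l u IH] s ru.
  by case: s => //=; rewrite eqxx; split => //; rewrite /cross eqxx.
have rhd k : ohead u = Some k -> k != invl l by move: ru; case: (u) => //= x y /andP[h _] [<-].
have := IH (invl l \in P) (path_sorted ru).
case E: (phi P a (invl l \in P) u) => [|h t] [rphi hphi].
  rewrite [phi _ _ _ _]/= E.
  case: (eqVneq l.1 a.1) => la; case: (eqVneq s (l \in P)) => es //=; rewrite ?la ?eqxx /=.
  - by rewrite /cross; case: (s); rewrite /= ?eqxx.
  - by rewrite (negPf la) es !eqxx.
  have -> : (if s then invl a else a).1 = a.1 by case: (s).
  rewrite /cross !eqxx /redw /= andbT; split => //.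
  by apply: contraNneq la => ->; case: (s).
have crossE : (if s then invl a else a) = cross a s by [].
have cross1 e : (cross a e).1 = a.1 by case: e.
have crossN e : cross a (~~ e) = invl (cross a e) by case: e; rewrite /= ?invlK.
rewrite [phi _ _ _ _]/= E crossE.
case: (eqVneq l.1 a.1) => [la|la].
  have tl : (invl l \in P) = ~~ (l \in P).
    by case: (letter_cases la) => ->; rewrite ?invlK aP (negPf aN).
  have nskip : skips P a (invl l \in P) u = false.
    case: (u) rhd => //= k ? /(_ k erefl) nk; apply/negbTE/negP => /andP[/eqP ka /eqP kP].
    have kl : k = l by apply/eqP; apply: contraNT nk => nk; rewrite (@eq_invl _ k l) // ka.
    by move: kP; rewrite kl tl; case: (l \in P).
  move: hphi; rewrite nskip tl !andbF !orbF => hphi.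
  case: (eqVneq s (l \in P)) => [es|ns] /=.
    split=> //; move: hphi; rewrite la es !eqxx /=.
    case: ifP => [_ ->|_ /andP[/eqP-> _]]; rewrite ?orbT //.
    by case: (l \in P).
  have es : s = ~~ (l \in P) by case: (s) (l \in P) ns => [] [].
  rewrite cross1 !eqxx; split => //.
  move: rphi hphi; rewrite -es /redw /= => -> ; rewrite andbT.
  case: ifP => [_ /eqP->|+ _]; first by rewrite eq_sym invl_neq.
  by move=> /negP ha; apply/eqP => e; apply: ha; rewrite e /= cross1.
have rl : redw (l :: h :: t).
  move: rphi; rewrite /redw /= => ->; rewrite andbT.
  move: hphi; case: ifP => [ha _|ha]; first by apply: contraNneq la => e; rewrite e in ha.
  move=> /orP[/andP[_ /eqP/rhd //]|/andP[+ _]].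
  by apply: contraNneq => ->.
case: (eqVneq s (l \in P)) => [es|ns] /=; first by rewrite (negPf la) es !eqxx.
rewrite cross1 !eqxx; split=> //; move: rl; rewrite /redw /= => ->; rewrite andbT.
by apply: contraNneq la => ->; rewrite /= cross1.
Qed.

(** No reduced word but the empty one becomes empty, so the moved family is free. Starting at the
    vertex of [P], the word [[:: a]] also disappears, as it only runs along the collapsed edge. *)
Lemma phi_nil P a s u : valid P a -> redw u -> phi P a s u = [::] ->
  if s then u = [:: a] else u = [::].
Proof.
move=> /andP[aP aN]; elim: u s => [|l u IH] s ru; first by case: s.
rewrite /=; case: eqP => // es; case: eqP => // la /(IH _ (path_sorted ru)).
case: (letter_cases la) => e; move: es; rewrite e ?invlK aP (negPf aN) => -> // ue.
  by rewrite ue.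
by move: ru; rewrite ue e /redw /= invlK eqxx.
Qed.

Section Bases.
Local Notation F := (free_group n).
Implicit Types b : 'I_n -> F.

Lemma move_basis b P a : valid P a -> isbasis b -> isbasis (move b P a).
Proof.
move=> vP [fb gb].
have hb : b = move (move b P a) (inv_set P a) (invl a) by rewrite move_inv.
have gm (b' : 'I_n -> F) Q c i : genby b' (move b' Q c i).
  rewrite /move; case: eqP => _; first exact: genby_id.
  apply: genbyM; first (apply: genbyM; last exact: genby_id).
    by rewrite /pw; case: ifP => _; [apply: genbyV; exact: genby_lval|exact: genby1].
  by rewrite /pw; case: ifP => _; [exact: genby_lval|exact: genby1].
split; last by move=> x; apply: (genby_trans _ (gb x)) => i; rewrite {2}hb; exact: gm.
move=> z rz e; have := ev_phi (move b P a) false z (valid_inv vP).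
rewrite move_inv e mulg1 => /fb; have [r _] := phi_red false (valid_inv vP) rz.
by move=> /(_ r)/(phi_nil (valid_inv vP) rz).
Qed.

Lemma co_move b P a x : valid P a -> isbasis b ->
  co (move b P a) x = phi P a false (co b x).
Proof.
move=> vP bb; apply: co_uniq.
- exact: move_basis.
- by have [] := phi_red false vP (redw_co x bb).
- by rewrite ev_phi // mul1g ev_co.
Qed.

End Bases.

Lemma occ_phi P a c s u : c.1 != a.1 -> occ c (phi P a s u) = occ c u.
Proof.
move=> ca; elim: u s => [|l u IH] s; first by case: s; rewrite //= eq_sym (negPf ca).
have oc x y : occ c (x ++ y) = (occ c x + occ c y)%N by exact: count_cat.
rewrite [phi _ _ _ _]/= !oc IH [occ c (l :: u)]/= -/(occ c u) addnA; congr addn.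
have -> : occ c (if s == (l \in P) then [::] else [:: if s then invl a else a]) = 0%N.
  by case: (s == _) => //=; case: (s); rewrite /= eq_sym (negPf ca).
by case: eqP => [->|_] /=; rewrite ?addn0 // eq_sym (negPf ca).
Qed.

(** Blowing up along [P] and [Q] together gives a graph whose vertices are the pairs of sides
    allowed by [con]; once the old edge [a] is collapsed, [pi] tells which of them lie on the side
    of [Q']. The last hypothesis compares one turn of the path, so each application is a finite
    check on booleans. *)
Lemma cut_phi P a Q Q' (con : rel bool) (pi : bool -> bool -> bool) u :
  (forall l, con (l \in P) (l \in Q)) -> con false false -> pi false false = false ->
  (forall l, l.1 != a.1 -> (l \in Q') = pi (l \in P) (l \in Q)) ->
  (forall l, l.1 = a.1 -> pi (invl l \in P) (invl l \in Q) = pi (l \in P) (l \in Q)) ->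
  (forall s q t r q', con s q -> con t r ->
     (if s == t then (q' != pi t r : nat)
      else (q' != (cross a s \in Q')) + ((invl (cross a s) \in Q') != pi t r))
       <= (q' != pi s q) + (q != r)) ->
  cut Q' (phi P a false u) <= cut Q u.
Proof.
move=> hcon con0 pi0 hQ' ha hstep.
have cutcat s t q' w : cutw Q' q' ((if s == t then [::] else [:: cross a s]) ++ w) =
    if s == t then cutw Q' q' w
    else (q' != (cross a s \in Q')) + cutw Q' (invl (cross a s) \in Q') w.
  by case: (s == t).
suff H s q q' : con s q -> cutw Q' q' (phi P a s u) <= (q' != pi s q) + cutw Q q u.
  by apply: leq_trans (H false false false con0) _; rewrite pi0.
elim: u s q q' => [|l u IH] s q q' sq.
  have := hstep s q false false q' sq con0.
  rewrite pi0 /=; case: (s) => /=; rewrite /cross.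
    by case: (invl (invl a) \in Q'); case: (q).
  by case: (q); case: (q').
rewrite [phi _ _ _ _]/= -/(cross a s) cutcat [cutw Q q _]/=.
have H := IH _ _ _ (hcon (invl l)).
have := hstep s q _ _ q' sq (hcon l).
set Y := cutw Q _ u; set W := phi P a _ u in H *; set c1 := cross a s \in Q'.
set c2 := invl _ \in Q'; set pt := pi (l \in P) (l \in Q).
case: (eqVneq l.1 a.1) => la.
  have := H c2; have := H q'; rewrite (ha l la) -/pt -/Y.
  set w1 := cutw Q' q' W; set w2 := cutw Q' c2 W; clearbody w1 w2 Y pt c1 c2.
  case: (s == _); clear; lia.
have := H (invl l \in Q'); rewrite (hQ' (invl l)) // eqxx add0n -/Y.
rewrite [cutw Q' q' _]/= [cutw Q' c2 _]/= !hQ' // -/pt.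
set w1 := cutw Q' _ W; clearbody w1 Y pt c1 c2.
case: (s == _); clear; lia.
Qed.

Lemma cut_phi_disjoint P Q a u : valid P a -> [disjoint P & Q] -> invl a \notin Q ->
  cut Q (phi P a false u) <= cut Q u.
Proof.
move=> vP dPQ aQ'; have /andP[aP aN] := vP.
have aQ : a \notin Q by rewrite (disjointFr dPQ).
apply: (@cut_phi _ _ _ _ (fun s q => ~~ (s && q)) (fun s q => q)) => //.
- by move=> l; apply/negP => /andP[lP]; rewrite (disjointFr dPQ).
- by move=> l /letter_cases [] ->; rewrite ?invlK (negPf aQ) (negPf aQ').
- by case; case; case; case; case; rewrite /cross /= ?invlK ?(negPf aQ) ?(negPf aQ').
Qed.

Lemma cut_phi_nested P Q a u : valid P a -> P \subset Q -> invl a \in Q ->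
  cut Q (phi P a false u) <= cut Q u.
Proof.
move=> vP /fintype.subsetP sPQ aQ'; have /andP[aP aN] := vP.
have aQ : a \in Q by exact: sPQ.
apply: (@cut_phi _ _ _ _ (fun s q => s ==> q) (fun s q => q)) => //.
- by move=> l; apply/implyP; exact: sPQ.
- by move=> l /letter_cases [] ->; rewrite ?invlK aQ aQ'.
- by case; case; case; case; case; rewrite /cross /= ?invlK ?aQ ?aQ'.
Qed.

(** Here the old edge [a] joins the innermost vertex to the outermost one; after its collapse the
    set cut off consists of [Q :\: P] and one end of the new edge. *)
Lemma cut_phi_collapse P Q a u : valid P a -> P \subset Q -> invl a \notin Q ->
  cut (a |: (Q :\: P)) (phi P a false u) <= cut Q u.
Proof.
move=> vP /fintype.subsetP sPQ aQ'; have /andP[aP aN] := vP.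
have aQ : a \in Q by exact: sPQ.
set Q' := a |: _.
have aQ1 : a \in Q' by rewrite !inE eqxx.
have aQ2 : invl a \in Q' = false by rewrite !inE (negPf aQ') andbF orbF (negPf (invl_neq _)).
apply: (@cut_phi _ _ _ _ (fun s q => s ==> q) (fun s q => q && ~~ s)) => //.
- by move=> l; apply/implyP; exact: sPQ.
- move=> l la; rewrite !inE andbC; have [e|//] := eqVneq l a.
  by rewrite e eqxx in la.
- by move=> l /letter_cases [] ->; rewrite ?invlK aP aQ (negPf aN) (negPf aQ').
- by case; case; case; case; case; rewrite /cross /= ?invlK ?aQ1 ?aQ2.
Qed.

(** Submodularity of cuts, verified turn by turn; the base point lies outside both sets. *)
Lemma cut_submodIU P Q u : cut (P :&: Q) u + cut (P :|: Q) u <= cut P u + cut Q u.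
Proof.
suff H s1 s2 s3 s4 : s3 = s1 && s2 -> s4 = s1 || s2 ->
    cutw (P :&: Q) s3 u + cutw (P :|: Q) s4 u <= cutw P s1 u + cutw Q s2 u.
  exact: H.
elim: u s1 s2 s3 s4 => [|l u IH] s1 s2 s3 s4 -> -> /=; first by case: s1; case: s2.
have := IH (invl l \in P) (invl l \in Q) _ _ erefl erefl; rewrite !inE.
by case: s1; case: s2; case: (l \in P); case: (l \in Q) => /=; lia.
Qed.

Lemma cut_submodD P Q u : cut (P :\: Q) u + cut (Q :\: P) u <= cut P u + cut Q u.
Proof.
suff H s1 s2 s3 s4 : s3 = s1 && ~~ s2 -> s4 = s2 && ~~ s1 ->
    cutw (P :\: Q) s3 u + cutw (Q :\: P) s4 u <= cutw P s1 u + cutw Q s2 u.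
  exact: H.
elim: u s1 s2 s3 s4 => [|l u IH] s1 s2 s3 s4 -> -> /=; first by case: s1; case: s2.
have := IH (invl l \in P) (invl l \in Q) _ _ erefl erefl; rewrite !inE.
rewrite [(_ \notin _) && _]andbC [(_ \notin _) && (invl l \in Q)]andbC.
rewrite [(_ \notin _) && _]andbC [(_ \notin _) && (l \in Q)]andbC.
by case: s1; case: s2; case: (l \in P); case: (l \in Q) => /=; lia.
Qed.

(** * Identities between products of moves *)

Section MoveIdentities.
Context {G : groupType} (b : 'I_n -> G).

Let norm := (@mulg1 G, @mul1g G, @invgM G, @invgK G, @invg1 G, @mulgA G,
  @mulgK G, @mulgVK G, @mulgV G, @mulVg G).

Lemma move_same P Q a : valid P a -> valid Q a -> P \subset Q ->
  move b Q a = move (move b P a) (a |: (Q :\: P)) a.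
Proof.
move=> vP vQ /fintype.subsetP sPQ; apply: (@eq_lval2 _ _ _ a a); rewrite ?lval_move_same //.
move=> l la _; rewrite (lval_move b Q la) (lval_move (move b P a) _ la).
rewrite (lval_move b P la) lval_move_same // !inE.
have -> : (l == a) = false by apply: contraNF la => /eqP->.
have -> : (invl l == a) = false by apply: contraNF la => /eqP<-.
have := sPQ l; have := sPQ (invl l).
by case: (l \in P); case: (l \in Q); case: (invl l \in P); case: (invl l \in Q) => /= h1 h2;
  rewrite ?norm //; (try by have := h1 isT); by have := h2 isT.
Qed.

Lemma move_opp P Q a : valid P a -> valid Q (invl a) -> [disjoint P & Q] ->
  move b Q (invl a) = move (move b P a) ((P :|: Q) :\ a) (invl a).
Proof.
move=> vP vQ dPQ; apply: (@eq_lval2 _ _ _ a a); rewrite ?lval_move_same //.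
move=> l la _; rewrite (@lval_move _ b Q (invl a) _ la).
rewrite (@lval_move _ (move b P a) _ (invl a) _ la) (lval_move b P la).
rewrite !lval_inv lval_move_same // !inE.
have -> : (l == a) = false by apply: contraNF la => /eqP->.
have -> : (invl l == a) = false by apply: contraNF la => /eqP<-.
have := disjointFr dPQ (x := l); have := disjointFr dPQ (x := invl l).
by case: (l \in P); case: (l \in Q); case: (invl l \in P); case: (invl l \in Q) => /= h1 h2;
  rewrite ?norm //; (try by have := h1 isT); by have := h2 isT.
Qed.

Lemma move_swap_disjoint P Q a c : valid P a -> valid Q c -> [disjoint P & Q] ->
  c.1 != a.1 -> invl a \notin Q -> invl c \notin P ->
  move (move b P a) Q c = move (move b Q c) P a.
Proof.
move=> /andP[aP aN] /andP[cQ cN] dPQ ca aQ' cP'.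
have aQ : a \notin Q by rewrite (disjointFr dPQ).
have cP : c \notin P by rewrite (disjointFl dPQ).
have ac : a.1 != c.1 by rewrite eq_sym.
have eA : lval (move b Q c) a = lval b a.
  by rewrite (lval_move b Q ac) (negPf aQ) (negPf aQ') /= mul1g mulg1.
have eC : lval (move b P a) c = lval b c.
  by rewrite (lval_move b P ca) (negPf cP) (negPf cP') /= mul1g mulg1.
apply: (@eq_lval2 _ _ _ a c).
- by rewrite (lval_move_same _ P) // (lval_move _ Q ac) eC eA lval_move_same // (negPf aQ) (negPf aQ') /= mul1g mulg1.
- by rewrite (lval_move_same _ Q) // eC (lval_move _ P ca) eA lval_move_same // (negPf cP) (negPf cP') /= mul1g mulg1.
move=> l la lc; rewrite (lval_move _ Q lc) (lval_move b P la) (lval_move _ P la) (lval_move b Q lc) eA eC.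
have := disjointFr dPQ (x := l); have := disjointFr dPQ (x := invl l).
by case: (l \in P); case: (l \in Q); case: (invl l \in P); case: (invl l \in Q) => /= h1 h2;
  rewrite ?norm //; (try by have := h1 isT); by have := h2 isT.
Qed.

(** As [P] contains the inverse of [c], the move by [P] turns [c] into [c a]. Everything multiplied
    by [c] afterwards is then also multiplied by [a], which enlarges [P] by [Q]. *)
Lemma move_swap_disjoint' P Q a c : valid P a -> valid Q c -> [disjoint P & Q] ->
  c.1 != a.1 -> invl a \notin Q -> invl c \in P ->
  move (move b P a) Q c = move (move b Q c) ((P :|: Q) :\ c) a.
Proof.
move=> /andP[aP aN] /andP[cQ cN] dPQ ca aQ' cP'.
have aQ : a \notin Q by rewrite (disjointFr dPQ).
have cP : c \notin P by rewrite (disjointFl dPQ).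
have ac : a.1 != c.1 by rewrite eq_sym.
have eA : lval (move b Q c) a = lval b a.
  by rewrite (lval_move b Q ac) (negPf aQ) (negPf aQ') /= mul1g mulg1.
have eC : lval (move b P a) c = lval b c * lval b a.
  by rewrite (lval_move b P ca) (negPf cP) cP' /= mul1g.
apply: (@eq_lval2 _ _ _ a c).
- by rewrite (lval_move_same _ (_ :\ _)) // (lval_move _ Q ac) eC eA lval_move_same // (negPf aQ) (negPf aQ') /= mul1g mulg1.
- rewrite (lval_move_same _ Q) // eC (lval_move _ _ ca) eA lval_move_same // !inE eqxx cP'.
  by rewrite (negPf (invl_neq _)) /= mul1g.
move=> l la lc; rewrite (lval_move _ Q lc) (lval_move b P la) (lval_move _ _ la) (lval_move b Q lc) eA eC !inE.
have -> : (l == c) = false by apply: contraNF lc => /eqP->.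
have -> : (invl l == c) = false by apply: contraNF lc => /eqP<-.
have := disjointFr dPQ (x := l); have := disjointFr dPQ (x := invl l).
by case: (l \in P); case: (l \in Q); case: (invl l \in P); case: (invl l \in Q) => /= h1 h2;
  rewrite ?norm //; (try by have := h1 isT); by have := h2 isT.
Qed.

Lemma move_swap_nested P Q a c : valid P a -> valid Q c -> P \subset Q ->
  c.1 != a.1 -> invl a \in Q -> c \notin P ->
  move (move b P a) Q c = move (move b Q c) P a.
Proof.
move=> /andP[aP aN] /andP[cQ cN] /fintype.subsetP sPQ ca aQ' cP.
have aQ : a \in Q by exact: sPQ.
have cP' : invl c \notin P by apply: contraNN cN; exact: sPQ.
have ac : a.1 != c.1 by rewrite eq_sym.
have eA : lval (move b Q c) a = (lval b c)^-1 * lval b a * lval b c.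
  by rewrite (lval_move b Q ac) aQ aQ'.
have eC : lval (move b P a) c = lval b c.
  by rewrite (lval_move b P ca) (negPf cP) (negPf cP') /= mul1g mulg1.
apply: (@eq_lval2 _ _ _ a c).
- by rewrite (lval_move_same _ P) // (lval_move _ Q ac) eC eA lval_move_same // aQ aQ'.
- by rewrite (lval_move_same _ Q) // eC (lval_move _ P ca) eA lval_move_same // (negPf cP) (negPf cP') /= mul1g mulg1.
move=> l la lc; rewrite (lval_move _ Q lc) (lval_move b P la) (lval_move _ P la) (lval_move b Q lc) eA eC.
have := sPQ l; have := sPQ (invl l).
by case: (l \in P); case: (l \in Q); case: (invl l \in P); case: (invl l \in Q) => /= h1 h2;
  rewrite ?norm //; (try by have := h1 isT); by have := h2 isT.
Qed.

(** The first move turns [c] into [a^-1 c]. A letter of [P] receives [a^-1] and then [c^-1 a], in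
    total [c^-1]; only the letters of [Q :\: P] keep a trace of [a]. *)
Lemma move_swap_nested_in P Q a c : valid P a -> valid Q c -> P \subset Q ->
  c.1 != a.1 -> invl a \in Q -> c \in P ->
  move (move b P a) Q c = move (move b Q c) (invl c |: (Q :\: P)) (invl a).
Proof.
move=> /andP[aP aN] /andP[cQ cN] /fintype.subsetP sPQ ca aQ' cP.
have aQ : a \in Q by exact: sPQ.
have cP' : invl c \notin P by apply: contraNN cN; exact: sPQ.
have ac : a.1 != c.1 by rewrite eq_sym.
have eA : lval (move b Q c) a = (lval b c)^-1 * lval b a * lval b c.
  by rewrite (lval_move b Q ac) aQ aQ'.
have eC : lval (move b P a) c = (lval b a)^-1 * lval b c.
  by rewrite (lval_move b P ca) cP (negPf cP') /= mulg1.
have eA' : lval (move b Q c) (invl a) = (lval b c)^-1 * (lval b a)^-1 * lval b c.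
  by rewrite lval_inv eA !norm.
apply: (@eq_lval2 _ _ _ a c).
- by rewrite (lval_move_same _ (_ |: _)) // (lval_move _ Q ac) eC eA lval_move_same // aQ aQ' /= !norm.
- rewrite (lval_move_same _ Q) // (@lval_move _ _ _ (invl a) c ca) eC eA' lval_move_same //.
  rewrite !inE cP cP' eqxx /= orbF eq_sym (negPf (invl_neq _)) /= !norm //.
move=> l la lc; rewrite (lval_move _ Q lc) (@lval_move _ (move b Q c) _ (invl a) l la).
rewrite (lval_move b P la) (lval_move b Q lc) eA' eC !inE.
have -> : (l == invl c) = false by apply: contraNF lc => /eqP->.
have -> : (invl l == invl c) = false by apply: contraNF lc => /eqP/(congr1 fst) /= ->.
have := sPQ l; have := sPQ (invl l).
by case: (l \in P); case: (l \in Q); case: (invl l \in P); case: (invl l \in Q) => /= h1 h2;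
  rewrite ?norm //; (try by have := h1 isT); by have := h2 isT.
Qed.

Lemma move_swap_nested_out P Q a c : valid P a -> valid Q c -> P \subset Q ->
  c.1 != a.1 -> invl a \notin Q -> c \notin P ->
  move (move b P a) (a |: (Q :\: P)) c = move (move b Q c) P a.
Proof.
move=> /andP[aP aN] /andP[cQ cN] /fintype.subsetP sPQ ca aQ' cP.
have aQ : a \in Q by exact: sPQ.
have cP' : invl c \notin P by apply: contraNN cN; exact: sPQ.
have ac : a.1 != c.1 by rewrite eq_sym.
have eA : lval (move b Q c) a = (lval b c)^-1 * lval b a.
  by rewrite (lval_move b Q ac) aQ (negPf aQ') /= mulg1.
have eC : lval (move b P a) c = lval b c.
  by rewrite (lval_move b P ca) (negPf cP) (negPf cP') /= mul1g mulg1.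
apply: (@eq_lval2 _ _ _ a c).
- rewrite (lval_move_same _ P) // (lval_move _ _ ac) eC eA lval_move_same // !inE eqxx.
  by rewrite (negPf (invl_neq _)) (negPf aQ') andbF /= mulg1.
- by rewrite (lval_move_same _ (_ |: _)) // eC (lval_move _ P ca) eA lval_move_same // (negPf cP) (negPf cP') /= mul1g mulg1.
move=> l la lc; rewrite (lval_move _ _ lc) (lval_move b P la) (lval_move _ P la) (lval_move b Q lc) eA eC !inE.
have -> : (l == a) = false by apply: contraNF la => /eqP->.
have -> : (invl l == a) = false by apply: contraNF la => /eqP<-.
have := sPQ l; have := sPQ (invl l).
by case: (l \in P); case: (l \in Q); case: (invl l \in P); case: (invl l \in Q) => /= h1 h2;
  rewrite ?norm //; (try by have := h1 isT); by have := h2 isT.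
Qed.

(** The same blow-up along [Q] is collapsed along the old edge [a] or along the old edge [c]; the
    two results differ by one move and a signed permutation. *)
Lemma move_change_letter Q a c l : valid Q a -> valid Q c -> c.1 != a.1 ->
  lval (move (move b Q a) (inv_set Q a) c) l = lval (move b Q c)
   (if l == a then c else if l == invl a then invl c else
    if l == c then invl a else if l == invl c then a else l).
Proof.
move=> /andP[aQ aN] /andP[cQ cN] ca.
have ac : a.1 != c.1 by rewrite eq_sym.
have eC : lval (move b Q a) c = (lval b a)^-1 * lval b c.
  by rewrite (lval_move b Q ca) cQ (negPf cN) /= mulg1.
have na : (a \in inv_set Q a) = false by rewrite !inE eqxx eq_sym (negPf (invl_neq _)).
have na' : (invl a \in inv_set Q a) = true by rewrite !inE eqxx.
have e1 : lval (move (move b Q a) (inv_set Q a) c) a = lval (move b Q c) c.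
  rewrite (lval_move _ _ ac) na na' eC lval_move_same // lval_move_same //=.
  by rewrite mul1g mulVKg.
have e2 : lval (move (move b Q a) (inv_set Q a) c) c = lval (move b Q c) (invl a).
  by rewrite lval_move_same // eC lval_inv (lval_move _ _ ac) aQ (negPf aN) /= !norm.
case: eqP => [->//|/eqP la]; case: eqP => [->|/eqP la']; first by rewrite !lval_inv e1.
case: eqP => [->//|/eqP lc]; case: eqP => [->|/eqP lc']; first by rewrite lval_inv e2 lval_inv invgK.
have la1 : l.1 != a.1 by apply/eqP => /letter_cases [] e; rewrite e eqxx in la la'.
have lc1 : l.1 != c.1 by apply/eqP => /letter_cases [] e; rewrite e eqxx in lc lc'.
rewrite (lval_move _ _ lc1) (lval_move _ _ la1) (lval_move _ Q lc1) eC !mem_inv_set //.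
by case: (l \in Q); case: (invl l \in Q) => /=; rewrite ?norm.
Qed.

End MoveIdentities.

End WhiteheadMoves.

(** * Lexicographic cost *)

Section Lex.
Implicit Types f g h : nat -> nat.

Definition lexlt f g := exists k, (forall j, j < k -> f j = g j) /\ f k < g k.
Definition addc f g k := f k + g k.

Lemma lexlt_irr f : ~ lexlt f f.
Proof. by move=> [k [_]]; rewrite ltnn. Qed.

Lemma lexlt_trans f g h : lexlt f g -> lexlt g h -> lexlt f h.
Proof.
move=> [k [ek lk]] [j [ej lj]]; case: (ltngtP k j) => kj.
- exists k; split=> [i ik|]; first by rewrite ek // ej // (ltn_trans ik).
  by rewrite -ej.
- exists j; split=> [i ij|]; first by rewrite ek ?ej // (ltn_trans ij).
  by rewrite ek.
exists k; split=> [i ik|]; first by rewrite ek // ej // -kj.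
by rewrite (ltn_trans lk) // kj.
Qed.

Lemma lexlt_total f g : [\/ f = g, lexlt f g | lexlt g f].
Proof.
have [e|ne] := pselect (forall k, f k == g k).
  by constructor 1; apply: funext => k; exact/eqP.
have ex : exists k, f k != g k.
  by apply: contrapT => h; apply: ne => k; apply: contrapT => /negP hk; apply: h; exists k.
case: (ex_minnP ex) => k nk mink.
have ej j : j < k -> f j = g j.
  by move=> jk; apply/eqP; apply: contraTT jk => /mink; rewrite leqNgt.
case: (ltngtP (f k) (g k)) nk => // h _; first by constructor 2; exists k.
by constructor 3; exists k; split=> // j /ej.
Qed.

Lemma lexlt_add2r h f g : lexlt (addc f h) (addc g h) <-> lexlt f g.
Proof.
split=> -[k [e l]]; exists k; rewrite /addc in e l *.
  by split=> [j /e/addIn //|]; rewrite ltn_add2r in l.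
by split=> [j /e->//|]; rewrite ltn_add2r.
Qed.

Lemma addcC f g : addc f g = addc g f.
Proof. by apply: funext => k; rewrite /addc addnC. Qed.

Lemma lexlt_add f g f' g' : lexlt f g -> lexlt f' g' -> lexlt (addc f f') (addc g g').
Proof.
move=> h h'; apply: (lexlt_trans (g := addc g f')); first exact/lexlt_add2r.
by rewrite ![addc g _]addcC; apply/lexlt_add2r.
Qed.

Lemma lex_le_lt f g h : (forall k, f k <= g k) -> lexlt g h -> lexlt f h.
Proof.
move=> le gh; case: (lexlt_total f g) => [->//|fg|]; first exact: lexlt_trans gh.
by move=> [k [_]]; rewrite ltnNge le.
Qed.

Lemma lexlt_le f g : ~ lexlt g f -> f = g \/ lexlt f g.
Proof. by case: (lexlt_total f g); [left|right|]. Qed.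

Lemma lexlt_le_lt f g h : lexlt f g -> ~ lexlt h g -> lexlt f h.
Proof. by move=> fg /lexlt_le [<-//|]; exact: lexlt_trans. Qed.

(** The lexicographic order is total and compatible with addition, so a strict inequality of sums
    comes from a summand. Corner arguments depend on it. *)
Lemma lexlt_addP f g f' g' : lexlt (addc f f') (addc g g') -> lexlt f g \/ lexlt f' g'.
Proof.
move=> h; case: (lexlt_total f g) => [e|?|gf]; [|by left|].
  by right; move: h; rewrite e ![addc g _]addcC => /lexlt_add2r.
case: (lexlt_total f' g') => [e|?|gf']; [|by right|].
  by move: h; rewrite e => /lexlt_add2r; left.
by have := lexlt_trans h (lexlt_add gf gf') => /lexlt_irr.
Qed.

End Lex.

Section Cost.
Local Open Scope group_scope.
Context {n : nat}.
Local Notation F := (free_group n).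
Implicit Types (b : 'I_n -> F) (P Q : {set letter n}) (a c : letter n).

Definition nth_word (k : nat) : F := if choice.unpickle k is Some z then ev gen z else 1.

Lemma nth_wordP (x : F) : exists k, nth_word k = x.
Proof. by exists (choice.pickle (word x)); rewrite /nth_word choice.pickleK ev_gen_word. Qed.

(* Cost vectors are compared lexicographically; the first coordinate leaves only
   finitely many bases below a given one, the others separate bases. *)
Definition costf (f : seq (letter n) -> nat) b (k : nat) : nat :=
  if k is k'.+1 then f (co b (nth_word k')) else \sum_i f (co b (gen i)).

Definition cost b := costf size b.
Definition cutc P b := costf (cut P) b.
Definition occc a b := costf (occ a) b.

Lemma costf_le f g b k : (forall u, f u <= g u) -> costf f b k <= costf g b k.
Proof. by move=> h; case: k => [|k] /=; [apply: leq_sum => i _|]. Qed.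

Lemma costfD f g b k : (costf f b k + costf g b k)%N = costf (fun u => f u + g u)%N b k.
Proof. by case: k => [|k] //=; rewrite big_split. Qed.

Lemma costf_move f P a b k : isbasis b -> valid P a ->
  costf f (move b P a) k = costf (fun u => f (phi P a false u)) b k.
Proof.
move=> bb vP; case: k => [|k] /=; last by rewrite co_move.
by apply: eq_bigr => i _; rewrite co_move.
Qed.

Lemma cost_move P a b : isbasis b -> valid P a ->
  addc (cost (move b P a)) (occc a b) = addc (cost b) (cutc P b).
Proof.
move=> bb vP; apply: funext => k; rewrite /addc /cost /cutc /occc costf_move // !costfD.
have -> // : (fun u => size (phi P a false u) + occ a u)%N = (fun u => size u + cut P u)%N.
by apply: funext => u; exact: size_phi.
Qed.

Definition reductive b P a := lexlt (cutc P b) (occc a b).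

Lemma reductiveP P a b : isbasis b -> valid P a ->
  reductive b P a <-> lexlt (cost (move b P a)) (cost b).
Proof.
move=> bb vP; rewrite /reductive -(lexlt_add2r (occc a b) (cost _)) cost_move //.
by rewrite ![addc (cost b) _]addcC lexlt_add2r.
Qed.

Lemma cutc_submodIU P Q b k :
  addc (cutc (P :&: Q) b) (cutc (P :|: Q) b) k <= addc (cutc P b) (cutc Q b) k.
Proof. by rewrite /addc /cutc !costfD; apply: costf_le => u; exact: cut_submodIU. Qed.

Lemma cutc_submodD P Q b k :
  addc (cutc (P :\: Q) b) (cutc (Q :\: P) b) k <= addc (cutc P b) (cutc Q b) k.
Proof. by rewrite /addc /cutc !costfD; apply: costf_le => u; exact: cut_submodD. Qed.

(** The first move keeps the number of letters of index [c.1] and does not increase the relevant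
    cut, so the second move is still reductive after it. *)
Lemma cost_move2 P a Q Q' c b : isbasis b -> valid P a -> valid Q' c -> c.1 != a.1 ->
  (forall u, cut Q' (phi P a false u) <= cut Q u) -> reductive b P a -> reductive b Q c ->
  lexlt (cost (move (move b P a) Q' c)) (cost b).
Proof.
move=> bb vP vQ' ca hcut rP rQ; have bP := move_basis vP bb.
apply: (lexlt_trans (g := cost (move b P a))); last exact/reductiveP.
apply/reductiveP => //; apply: (@lex_le_lt _ (cutc Q b)).
  by move=> k; rewrite /cutc costf_move //; exact: costf_le.
suff -> : occc c (move b P a) = occc c b by [].
apply: funext => k; rewrite /occc costf_move //.
by congr costf; apply: funext => u; exact: occ_phi.
Qed.

Lemma lval_inj b : isbasis b -> injective (lval b).
Proof.
move=> [fb _] k l e; have := @freew_inj _ _ b [:: k] [:: l] fb isT isT.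
by rewrite /= !mulg1 => /(_ e) [].
Qed.

Definition signed_perm b b' := forall i, exists l, b' i = lval b l.

Lemma signed_permP b b' : signed_perm b b' -> exists s : letter n -> letter n,
  (forall l, lval b' l = lval b (s l)) /\ (forall l, s (invl l) = invl (s l)).
Proof.
move=> h; pose t i := projT1 (cid (h i)).
have ht i : b' i = lval b (t i) by rewrite /t; case: cid.
exists (fun l => if l.2 then invl (t l.1) else t l.1); split; last first.
  by case=> i [] //=; rewrite invlK.
by case=> i [] /=; rewrite ?lval_inv -ht.
Qed.

Lemma ev_signed b b' (s : letter n -> letter n) z : (forall l, lval b' l = lval b (s l)) ->
  ev b' z = ev b (map s z).
Proof. by move=> hs; elim: z => //= l z ->; rewrite hs. Qed.

Lemma co_signed b b' s x : isbasis b -> isbasis b' -> (forall l, lval b' l = lval b (s l)) ->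
  (forall l, s (invl l) = invl (s l)) -> co b x = map s (co b' x).
Proof.
move=> bb bb' hs si; apply: co_uniq => //; last by rewrite -(ev_signed _ hs) ev_co.
have := redw_co x bb'; rewrite /redw sorted_map; apply: sub_sorted => k l /=.
rewrite -si; apply: contraNneq => e.
by apply/eqP; apply: (lval_inj bb'); rewrite !hs e.
Qed.

Lemma cost_signed b b' : isbasis b -> isbasis b' -> signed_perm b b' -> cost b' = cost b.
Proof.
move=> bb bb' /signed_permP [s [hs si]]; apply: funext => -[|k]; rewrite /cost /=.
  by apply: eq_bigr => i _; rewrite (co_signed _ bb bb' hs si) size_map.
by rewrite (co_signed _ bb bb' hs si) size_map.
Qed.

(** [b' i] has length one in [b'], hence in [b], since equal costs give every element the same
    length in both bases. *)
Lemma signed_cost b b' : isbasis b -> isbasis b' -> cost b = cost b' -> signed_perm b b'.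
Proof.
move=> bb bb' e i; have [k ek] := nth_wordP (b' i).
have : size (co b (b' i)) = size (co b' (b' i)).
  by have := congr1 (fun f => f k.+1) e; rewrite /cost /= ek.
rewrite (@co_uniq _ b' (b' i) [:: (i, false)]) //; last by rewrite /= mulg1.
have := ev_co (b' i) bb; case: (co b (b' i)) => [|l []] //= <- _.
by exists l; rewrite mulg1.
Qed.

Lemma cost_le_len b b' : isbasis b -> isbasis b' -> ~ lexlt (cost b) (cost b') ->
  cost b' 0 <= cost b 0.
Proof.
move=> bb bb' h; rewrite leqNgt; apply/negP => lt; apply: h.
by exists 0%N; split.
Qed.

Lemma move_signed b b' P a : isbasis b -> isbasis b' -> signed_perm b b' -> valid P a ->
  exists P' a', [/\ valid P' a', signed_perm (move b P a) (move b' P' a'),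
    lval b' a' = lval b a & forall l, l \in P' -> exists2 k, k \in P & lval b' l = lval b k].
Proof.
move=> bb bb' /signed_permP [s [hs si]] /andP[aP aN].
have sinj : injective s by move=> k l e; apply: (lval_inj bb'); rewrite !hs e.
have [t st ts] := injF_bij sinj.
pose P' := [set l | s l \in P].
have e1 : lval b' (t a) = lval b a by rewrite hs ts.
exists P', (t a); split => //.
- by rewrite /valid !inE ts aP si ts.
- move=> i; exists (s (i, false)).
  have -> : move b' P' (t a) i = lval (move b' P' (t a)) (i, false) by [].
  have s1 : ((s (i, false)).1 == a.1) = (i == (t a).1).
    apply/eqP/eqP => [/letter_cases [] e|e].
    - by rewrite -e st.
    - have -> : t a = invl (i, false); last by [].
      by apply: sinj; rewrite ts si e invlK.
    have [->|->] : (i, false) = t a \/ (i, false) = invl (t a) by exact: letter_cases.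
      by rewrite ts.
    by rewrite si ts.
  have [ia|ia] := eqVneq i (t a).1.
    by rewrite !lval_move_same ?hs //; apply/eqP; rewrite s1 ia.
  rewrite lval_move // lval_move ?s1 // e1 hs !inE si //.
move=> l; rewrite inE => lP; exists (s l) => //.
Qed.

End Cost.

(** * Peak reduction *)

Section PeakReduction.
Local Open Scope group_scope.
Context {n : nat}.
Local Notation F := (free_group n).
Variable cc : set (set F).
Hypothesis cc_subgroup : forall A, cc A -> subgroup A.
Implicit Types (b : 'I_n -> F) (P Q R : {set letter n}) (a c : letter n).

Definition cadapted b := isbasis b /\ forall A, cc A -> adapted b A.

Definition lev b i j := forall A, cc A -> A (b j) -> A (b i).

(* These moves keep a basis adapted to the subgroups in [cc]: only multiples by [a] occur. *)
Definition pres b P a := forall l, l \in P -> lev b a.1 l.1.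

Lemma lev_trans b i j k : lev b i j -> lev b j k -> lev b i k.
Proof. by move=> h1 h2 A cA /(h2 A cA)/(h1 A cA). Qed.

Lemma lev_refl b i : lev b i i. Proof. by move=> A. Qed.

Lemma adapted_letters b A x : isbasis b -> adapted b A -> A x ->
  forall l, l \in co b x -> A (b l.1).
Proof.
move=> bb hA /hA [z ez hz] l lz; apply: hz; apply: mem_redu.
by rewrite -(@co_uniq _ b x _ bb (redw_redu z)) // ev_redu.
Qed.

Lemma lval_in (A : set F) b l : subgroup A -> A (lval b l) <-> A (b l.1).
Proof.
move=> [_ _ AV]; rewrite /lval; case: l.2 => //; split; last exact: AV.
by move=> /AV; rewrite invgK.
Qed.

Lemma pw_in (A : set F) (x : F) (e : bool) : subgroup A -> (e -> A x) -> A (pw x e).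
Proof. by move=> [A1 _ _]; case: e => //= h; exact: h. Qed.

(** The new element is a reduced word in [b] containing [b i], with at most one letter of index
    [a.1] on each side. If it lies in [A], adaptedness puts all its letters in [A]; conversely
    [pres] puts the multiplier in [A] whenever it is used. *)
Lemma move_in b P a i A : cadapted b -> valid P a -> pres b P a -> cc A ->
  A (move b P a i) <-> A (b i).
Proof.
move=> [bb hA] vP pP cA; have sA := cc_subgroup cA; have [A1 AM AV] := sA.
rewrite /move; case: eqP => [//|/eqP ia].
have Aa e : (i, e) \in P -> A (b i) -> A (lval b a).
  by move=> /pP /(_ A cA) h /h; rewrite lval_in.
split=> [|Ai]; last first.
  apply: (AM); first apply: (AM) => //.
    by apply: pw_in => // h; apply: (AV); exact: Aa h Ai.
  by apply: pw_in => // h; exact: Aa h Ai.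
move=> /(adapted_letters bb (hA A cA)); move: ((i, false) \in P) ((i, true) \in P) => e1 e2 h.
have ne1 : (i, false) != a by apply: contraNneq ia => <-.
have ne2 : a != invl (i, false) by apply: contraNneq ia => ->.
apply: (h (i, false)).
rewrite (@co_uniq _ b _ ((if e1 then [:: invl a] else [::]) ++ (i, false) :: (if e2 then [:: a] else [::]))) //.
- by rewrite mem_cat inE eqxx orbT.
- by case: e1 {h}; case: e2; rewrite /redw /= ?invlK ?ne1 ?ne2.
- rewrite ev_cat /= -mulgA; congr (_ * _); first by case: e1 {h} => //=; rewrite mulg1 lval_inv.
  by congr (_ * _); case: e2 {h} => //=; rewrite mulg1.
Qed.

Lemma lev_move b P a i j : cadapted b -> valid P a -> pres b P a ->
  lev (move b P a) i j <-> lev b i j.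
Proof.
move=> sb vP pP; split=> h A cA; have := h A cA; rewrite !move_in //.
Qed.

Lemma cadapted_move b P a : cadapted b -> valid P a -> pres b P a -> cadapted (move b P a).
Proof.
move=> sb vP pP; have [bb hA] := sb; split; first exact: move_basis.
move=> A cA; have sA := cc_subgroup cA.
set b' := move b P a.
have sub : subgroup [set x | exists2 z, ev b' z = x & forall l, l \in z -> A (b' l.1)].
  split; first by exists [::].
    move=> x y [z <- hz] [z' <- hz']; exists (z ++ z'); first by rewrite ev_cat.
    by move=> l; rewrite mem_cat => /orP[/hz|/hz'].
  move=> x [z <- hz]; exists (invw z); first by rewrite ev_invw.
  by move=> l; rewrite mem_invw => /hz.
move=> x /(hA A cA) [z <- hz]; apply: (subgroup_ev sub) => l /hz Al /=.
exists (phi P a false [:: (l.1, false)]).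
  by rewrite ev_phi // mul1g /= mulg1.
have aA e : (l.1, e) \in P -> A (b' a.1).
  by move=> /pP /(_ A cA) h; rewrite move_in //; exact: h.
move=> k; rewrite /= !mem_cat => /orP[|/orP[]].
- by case E: ((l.1, false) \in P) => //=; rewrite inE => /eqP->; exact: aA E.
- by case: eqP => // _; rewrite inE => /eqP->; rewrite move_in.
by case E: (invl (l.1, false) \in P) => //=; rewrite inE => /eqP->; exact: aA E.
Qed.

Lemma pres_move b P a Q c : cadapted b -> valid P a -> pres b P a ->
  pres (move b P a) Q c <-> pres b Q c.
Proof. by move=> sb vP pP; split=> h l /h; rewrite lev_move. Qed.

(** The target is compared by cost only, which makes adjacency insensitive to signed
    permutations. *)
Definition adj b b' := exists P a, [/\ valid P a, pres b P a & cost (move b P a) = cost b'].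

Definition link v b b' := [/\ cadapted b, cadapted b', lexlt (cost b) v, lexlt (cost b') v &
  cost b = cost b' \/ adj b b'].

Inductive conn v : ('I_n -> F) -> ('I_n -> F) -> Prop :=
| conn_refl b : conn v b b
| conn_step b b' b'' : link v b b' -> conn v b' b'' -> conn v b b''.

Lemma conn_trans v b b' b'' : conn v b b' -> conn v b' b'' -> conn v b b''.
Proof. by elim=> // x y z l _ IH /IH; exact: conn_step. Qed.

Lemma pres_signed b b' P a P' a' : pres b P a -> lval b' a' = lval b a ->
  (forall l, l \in P' -> exists2 k, k \in P & lval b' l = lval b k) -> pres b' P' a'.
Proof.
move=> pP ea hP l /hP [k /pP h el] A cA; have sA := cc_subgroup cA.
rewrite -(lval_in b' l sA) el lval_in // => /(h A cA).
by rewrite -(lval_in b a sA) -ea lval_in.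
Qed.

Lemma adj_signed b b2 P a : cadapted b -> cadapted b2 -> signed_perm b b2 ->
  valid P a -> pres b P a -> adj b2 (move b P a).
Proof.
move=> sb sb2 s vP pP; have [bb _] := sb; have [bb2 _] := sb2.
have [P' [a' [vP' s' ea hP']]] := move_signed bb bb2 s vP.
exists P', a'; split => //; first exact: pres_signed pP ea hP'.
by apply: cost_signed => //; exact: move_basis.
Qed.

Lemma adj_cost b b2 b' : cadapted b -> cadapted b2 -> cost b = cost b2 -> adj b b' -> adj b2 b'.
Proof.
move=> sb sb2 e [P [a [vP pP e']]].
have [|P' [a' [vP' pP' e'']]] := @adj_signed b b2 P a sb sb2 _ vP pP.
  by apply: signed_cost => //; [exact: sb.1|exact: sb2.1].
by exists P', a'; split=> //; rewrite e''.
Qed.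

Lemma pres_inv b P a : cadapted b -> valid P a -> pres b P a ->
  pres (move b P a) (inv_set P a) (invl a).
Proof.
move=> sb vP pP l; rewrite lev_move // !inE => /orP[/eqP->|/andP[_ /pP //]].
exact: lev_refl.
Qed.

Lemma adj_sym b b' : cadapted b -> cadapted b' -> adj b b' -> adj b' b.
Proof.
move=> sb sb' [P [a [vP pP e]]].
have sm := cadapted_move sb vP pP.
apply: (adj_cost sm sb' e); exists (inv_set P a), (invl a).
by split; [exact: valid_inv|exact: pres_inv|rewrite move_inv].
Qed.

Lemma link_sym v b b' : link v b b' -> link v b' b.
Proof.
move=> [sb sb' lb lb' h]; split => //; case: h => [->|h]; [by left|right].
exact: adj_sym.
Qed.

Lemma conn_sym v b b' : conn v b b' -> conn v b' b.
Proof.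
elim=> [x|x y z l _ h]; first exact: conn_refl.
by apply: conn_trans h _; apply: conn_step (conn_refl _ _); exact: link_sym.
Qed.

Lemma conn_move v b P a : cadapted b -> valid P a -> pres b P a ->
  lexlt (cost b) v -> lexlt (cost (move b P a)) v -> conn v b (move b P a).
Proof.
move=> sb vP pP l1 l2; apply: conn_step (conn_refl _ _).
by split => //; [exact: cadapted_move|right; exists P, a].
Qed.

Definition redpres b P a := [/\ valid P a, pres b P a & reductive b P a].

Section Peak.
Variable b : 'I_n -> F.
Hypothesis sb : cadapted b.
Let bb : isbasis b := sb.1.

Local Notation cn P a Q c := (conn (cost b) (move b P a) (move b Q c)).

Lemma redpres_lt P a : redpres b P a -> lexlt (cost (move b P a)) (cost b).
Proof. by move=> [vP _ rP]; apply/reductiveP. Qed.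

Lemma redpres_st P a : redpres b P a -> cadapted (move b P a).
Proof. by move=> [vP pP _]; exact: cadapted_move. Qed.

Lemma peak_eq P a Q c M : redpres b P a -> redpres b Q c ->
  move b Q c = move (move b P a) M c -> valid M c -> pres b M c -> cn P a Q c.
Proof.
move=> HP HQ e vM pM; have [vP pP rP] := HP; rewrite e.
apply: conn_move => //; [exact: redpres_st|by rewrite pres_move|exact: redpres_lt|].
by rewrite -e; exact: redpres_lt.
Qed.

Lemma peak_mid P a Q c M M' d :
  redpres b P a -> redpres b Q c -> valid M c -> pres b M c -> valid M' d -> pres b M' d ->
  lexlt (cost (move (move b P a) M c)) (cost b) ->
  move (move b P a) M c = move (move b Q c) M' d -> cn P a Q c.
Proof.
move=> HP HQ vM pM vM' pM' lt e; have [vP pP rP] := HP; have [vQ pQ rQ] := HQ.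
apply: (@conn_trans _ _ (move (move b P a) M c)).
  apply: conn_move => //; [exact: redpres_st|by rewrite pres_move|exact: redpres_lt].
apply: conn_sym; rewrite e; apply: conn_move => //.
- exact: redpres_st.
- by rewrite pres_move.
- exact: redpres_lt.
by rewrite -e.
Qed.

Lemma peak_letter Q a c : redpres b Q a -> redpres b Q c -> cn Q a Q c.
Proof.
move=> HP HQ; have [vP pP rP] := HP; have [vQ pQ rQ] := HQ.
have [e|ca] := eqVneq c.1 a.1.
  case: (letter_cases e) => ec; first by rewrite ec; exact: conn_refl.
  by move: vP vQ; rewrite /valid ec => /andP[_ /negPf->].
have /andP[aQ aN] := vP; have /andP[cQ cN] := vQ.
apply: conn_step (conn_refl _ _); split.
- exact: redpres_st.
- exact: redpres_st.
- exact: redpres_lt.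
- exact: redpres_lt.
right; have vM : valid (inv_set Q a) c by rewrite /valid !mem_inv_set // cQ.
exists (inv_set Q a), c; split => //.
  rewrite pres_move // => l; rewrite !inE => /orP[/eqP->|/andP[_ /pQ //]].
  exact: (pQ _ aQ).
apply: cost_signed; [exact: move_basis|apply: move_basis => //; exact: move_basis|].
by move=> i; eexists; exact: (move_change_letter b (i, false) vP vQ ca).
Qed.

Lemma peak_subset_same P Q a : redpres b P a -> redpres b Q a -> P \subset Q -> cn P a Q a.
Proof.
move=> HP HQ sPQ; have [vP pP rP] := HP; have [vQ pQ rQ] := HQ.
apply: (peak_eq HP HQ (move_same b vP vQ sPQ)).
  by move: vQ; rewrite /valid !inE eqxx (negPf (invl_neq _)) /= => /andP[_ /negPf->]; rewrite andbF.
by move=> l; rewrite !inE => /orP[/eqP->|/andP[_ /pQ //]]; exact: lev_refl.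
Qed.

Lemma peak_opp P Q a : redpres b P a -> redpres b Q (invl a) -> [disjoint P & Q] ->
  cn P a Q (invl a).
Proof.
move=> HP HQ dPQ; have [vP pP rP] := HP; have [vQ pQ rQ] := HQ.
apply: (peak_eq HP HQ (move_opp b vP vQ dPQ)).
  move: vQ; rewrite /valid invlK !inE eqxx => /andP[-> _].
  by rewrite (invl_neq a) orbT.
by move=> l; rewrite !inE => /andP[_ /orP[/pP|/pQ]].
Qed.

Lemma peak_disjoint_out P Q a c : redpres b P a -> redpres b Q c -> [disjoint P & Q] ->
  c.1 != a.1 -> invl a \notin Q -> cn P a Q c.
Proof.
move=> HP HQ dPQ ca aQ'; have [vP pP rP] := HP; have [vQ pQ rQ] := HQ.
have lt : lexlt (cost (move (move b P a) Q c)) (cost b).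
  by apply: (@cost_move2 _ _ _ Q) => // u; exact: cut_phi_disjoint.
have [cP|cP] := boolP (invl c \in P); last first.
  exact: (peak_mid HP HQ vQ pQ vP pP lt (move_swap_disjoint b vP vQ dPQ ca aQ' cP)).
apply: (peak_mid HP HQ vQ pQ _ _ lt (move_swap_disjoint' b vP vQ dPQ ca aQ' cP)).
  move: vP; rewrite /valid !inE (negPf aQ') orbF => /andP[-> /negPf->]; rewrite andbF andbT.
  by rewrite andbT; apply: contraNneq ca => <-.
move=> l; rewrite !inE => /andP[_ /orP[/pP //|/pQ]].
by apply: lev_trans; exact: (pP _ cP).
Qed.

Lemma peak_disjoint P Q a c : redpres b P a -> redpres b Q c -> [disjoint P & Q] -> cn P a Q c.
Proof.
move=> HP HQ dPQ; have [vP pP rP] := HP; have [vQ pQ rQ] := HQ.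
have /andP[aP aN] := vP; have /andP[cQ cN] := vQ.
have [e|ca] := eqVneq c.1 a.1.
  case: (letter_cases e) => ec; first by rewrite ec (disjointFr dPQ) in cQ.
  by move: HQ; rewrite ec => HQ; exact: peak_opp.
have [aQ'|aQ'] := boolP (invl a \in Q); last exact: peak_disjoint_out.
have [cP'|cP'] := boolP (invl c \in P); last first.
  apply: conn_sym; apply: peak_disjoint_out => //; first by rewrite disjoint_sym.
  by rewrite eq_sym.
have cP : c \notin P by rewrite (disjointFl dPQ).
have aQ : a \notin Q by rewrite (disjointFr dPQ).
(* Now [P] contains the inverse of [c] and [Q] the inverse of [a]. The set whose letter is not the
   more frequent one stays reductive with the inverse of the other letter, and the two sets then
   carry opposite letters. *)
have [lt|nlt] := pselect (lexlt (occc a b) (occc c b)).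
  have H : redpres b P (invl c).
    split; first by rewrite /valid invlK cP'.
      by move=> l /pP; apply: lev_trans; exact: (pQ _ aQ').
    exact: lexlt_trans lt.
  apply: (conn_trans (peak_letter HP H)).
  have := @peak_opp P Q (invl c) H; rewrite invlK; exact.
have H : redpres b Q (invl a).
  split; first by rewrite /valid invlK aQ'.
    by move=> l /pQ; apply: lev_trans; exact: (pP _ cP').
  exact: lexlt_le_lt rQ nlt.
exact: (conn_trans (peak_opp HP H dPQ) (peak_letter H HQ)).
Qed.

Lemma peak_nested P Q a c : redpres b P a -> redpres b Q c -> P \subset Q -> cn P a Q c.
Proof.
move=> HP HQ sPQ; have [vP pP rP] := HP; have [vQ pQ rQ] := HQ.
have /andP[aP aN] := vP; have /andP[cQ cN] := vQ.
have subPQ := fintype.subsetP sPQ.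
have aQ : a \in Q by exact: subPQ.
have [e|ca] := eqVneq c.1 a.1.
  case: (letter_cases e) => ec; first by move: HQ; rewrite ec => HQ; exact: peak_subset_same.
  by move: cN; rewrite ec invlK aQ.
have [aQ'|aQ'] := boolP (invl a \in Q).
  have lt : lexlt (cost (move (move b P a) Q c)) (cost b).
    by apply: (@cost_move2 _ _ _ Q) => // u; exact: cut_phi_nested.
  have [cP|cP] := boolP (c \in P); last first.
    exact: (peak_mid HP HQ vQ pQ vP pP lt (move_swap_nested b vP vQ sPQ ca aQ' cP)).
  apply: (peak_mid HP HQ vQ pQ _ _ lt (move_swap_nested_in b vP vQ sPQ ca aQ' cP)).
    rewrite /valid invlK !inE aQ' aN aP /= orbT orbF.
    by apply: contraNneq ca => ->.
  move=> l; rewrite !inE => /orP[/eqP->|/andP[_ /pQ]]; first exact: (pP _ cP).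
  by apply: lev_trans; exact: (pP _ cP).
have [cP|cP] := boolP (c \in P); last first.
  have vQ' : valid (a |: (Q :\: P)) c.
    rewrite /valid !inE cP cQ (negPf cN) andbF orbF orbT /=.
    by apply: contraNneq ca => <-.
  apply: (peak_mid HP HQ vQ' _ vP pP _ (move_swap_nested_out b vP vQ sPQ ca aQ' cP)).
    by move=> l; rewrite !inE => /orP[/eqP->|/andP[_ /pQ //]]; exact: (pQ _ aQ).
  by apply: (@cost_move2 _ _ _ Q) => // u; exact: cut_phi_collapse.
(* Both letters are admissible for both sets; using the more frequent one for both keeps them
   reductive. *)
have [lt|nlt] := pselect (lexlt (occc a b) (occc c b)).
  have H : redpres b P c.
    split; first by rewrite /valid cP; apply: contraNN cN; exact: subPQ.
      by move=> l /pP; apply: lev_trans; exact: (pQ _ aQ).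
    exact: lexlt_trans lt.
  exact: (conn_trans (peak_letter HP H) (peak_subset_same H HQ sPQ)).
have H : redpres b Q a.
  split; first by rewrite /valid aQ.
    by move=> l /pQ; apply: lev_trans; exact: (pP _ cP).
  exact: lexlt_le_lt rQ nlt.
exact: (conn_trans (peak_subset_same HP H sPQ) (peak_letter H HQ)).
Qed.

(* The Higgins--Lyndon argument; [R] and [S] are opposite corners of [P] and [Q]. *)
Lemma corner_red P Q a c R (S : {set letter n}) r s : redpres b P a -> redpres b Q c ->
  (forall k, addc (cutc R b) (cutc S b) k <= addc (cutc P b) (cutc Q b) k) ->
  addc (occc a b) (occc c b) = addc (occc r b) (occc s b) ->
  valid R r -> valid S s -> pres b R r -> pres b S s ->
  redpres b R r \/ redpres b S s.
Proof.
move=> [_ _ rP] [_ _ rQ] sm e vR vS pR pS.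
have := lex_le_lt sm (lexlt_add rP rQ); rewrite e => /lexlt_addP [h|h]; [left|right]; by split.
Qed.

(** A single index serves both corners; this costs nothing when its letters are at least as frequent
    as [a] and [c]. *)
Lemma corner_red2 P Q a c R (S : {set letter n}) r s d : redpres b P a -> redpres b Q c ->
  (forall k, addc (cutc R b) (cutc S b) k <= addc (cutc P b) (cutc Q b) k) ->
  ~ lexlt (occc d b) (occc a b) -> ~ lexlt (occc d b) (occc c b) ->
  r.1 = d.1 -> s.1 = d.1 ->
  valid R r -> valid S s -> pres b R r -> pres b S s ->
  redpres b R r \/ redpres b S s.
Proof.
move=> [_ _ rP] [_ _ rQ] sm la lc er es vR vS pR pS.
have := lex_le_lt sm (lexlt_add (lexlt_le_lt rP la) (lexlt_le_lt rQ lc)).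
have oc (k : letter n) : k.1 = d.1 -> occc d b = occc k b by rewrite /occc /occ => ->.
by rewrite {1}(oc r er) (oc s es) => /lexlt_addP [h|h]; [left|right]; split.
Qed.

(** Crossing sets are handled through a corner: each corner is nested in [P] or [Q] and is nested
    with or disjoint from the other, so a reductive move supported on it links both ends below the
    peak. *)
Lemma peak P Q a c : redpres b P a -> redpres b Q c -> cn P a Q c.
Proof.
move=> HP HQ; have [vP pP rP] := HP; have [vQ pQ rQ] := HQ.
have /andP[aP aN] := vP; have /andP[cQ cN] := vQ.
have sI1 := finset.subsetIl P Q; have sI2 := finset.subsetIr P Q.
have sU1 := finset.subsetUl P Q; have sU2 := finset.subsetUr P Q.
have thruI r : redpres b (P :&: Q) r -> cn P a Q c.
  move=> H; apply: (conn_trans (conn_sym (peak_nested H HP sI1))).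
  exact: peak_nested H HQ sI2.
have thruU r : redpres b (P :|: Q) r -> cn P a Q c.
  move=> H; apply: (conn_trans (peak_nested HP H sU1)).
  exact: conn_sym (peak_nested HQ H sU2).
have thruD r : redpres b (P :\: Q) r -> cn P a Q c.
  move=> H; apply: (conn_trans (conn_sym (peak_nested H HP (finset.subsetDl P Q)))).
  apply: (peak_disjoint H HQ); rewrite disjoint_sym; apply/fintype.pred0P => l /=.
  by rewrite !inE; case: (l \in Q).
have thruD' r : redpres b (Q :\: P) r -> cn P a Q c.
  move=> H; apply: conn_sym; apply: (conn_trans (conn_sym (peak_nested H HQ (finset.subsetDl Q P)))).
  apply: (peak_disjoint H HP); rewrite disjoint_sym; apply/fintype.pred0P => l /=.
  by rewrite !inE; case: (l \in P).
have smI := cutc_submodIU P Q b; have smD := cutc_submodD P Q b.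
have pU_a : lev b a.1 c.1 -> pres b (P :|: Q) a.
  by move=> h l; rewrite inE => /orP[/pP //|/pQ]; exact: lev_trans.
have pU_c : lev b c.1 a.1 -> pres b (P :|: Q) c.
  by move=> h l; rewrite inE => /orP[/pP|/pQ //]; exact: lev_trans.
have pD_a : pres b (P :\: Q) a by move=> l; rewrite inE => /andP[_ /pP].
have pD_c : lev b c.1 a.1 -> pres b (P :\: Q) (invl c).
  by move=> h l; rewrite inE => /andP[_ /pP]; exact: lev_trans.
have pD'_c : pres b (Q :\: P) c by move=> l; rewrite inE => /andP[_ /pQ].
have pD'_a : lev b a.1 c.1 -> pres b (Q :\: P) (invl a).
  by move=> h l; rewrite inE => /andP[_ /pQ]; exact: lev_trans.
have ac_P : (c \in P) || (invl c \in P) -> lev b a.1 c.1 by case/orP => /pP.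
have ca_Q : (a \in Q) || (invl a \in Q) -> lev b c.1 a.1 by case/orP => /pQ.
have pIa : pres b (P :&: Q) a by move=> l; rewrite inE => /andP[/pP].
have pIc : pres b (P :&: Q) c by move=> l; rewrite inE => /andP[_ /pQ].
have occC : addc (occc a b) (occc c b) = addc (occc c b) (occc a b) by rewrite addcC.
have tot : ~ lexlt (occc a b) (occc c b) \/ ~ lexlt (occc c b) (occc a b).
  case: (lexlt_total (occc a b) (occc c b)) => [->|h|h]; first by left; exact: lexlt_irr.
    by right=> /(lexlt_trans h)/lexlt_irr.
  by left=> /(lexlt_trans h)/lexlt_irr.
have irr k : ~ lexlt (occc k b) (occc k b) by exact: lexlt_irr.
have vv R r : (r \in R) = true -> (invl r \in R) = false -> valid R r.
  by rewrite /valid => -> ->.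
case aQ : (a \in Q); case aQ' : (invl a \in Q); case cP : (c \in P); case cP' : (invl c \in P).
all: try have acP : lev b a.1 c.1 by apply: ac_P; rewrite cP cP'.
all: try have caQ : lev b c.1 a.1 by apply: ca_Q; rewrite aQ aQ'.
(* Four ways of giving two opposite corners a letter that lies inside while its inverse lies
   outside, each of [a] and [c] being used once up to inversion. *)
all: try (solve [suff [H|H] : redpres b (P :&: Q) a \/ redpres b (P :|: Q) c;
  [exact: thruI H|exact: thruU H|apply: (corner_red HP HQ smI erefl); auto; apply: vv;
   rewrite !inE ?invlK ?aP ?cQ ?(negPf aN) ?(negPf cN) ?aQ ?aQ' ?cP ?cP' //]]).
all: try (solve [suff [H|H] : redpres b (P :&: Q) c \/ redpres b (P :|: Q) a;
  [exact: thruI H|exact: thruU H|apply: (corner_red HP HQ smI occC); auto; apply: vv;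
   rewrite !inE ?invlK ?aP ?cQ ?(negPf aN) ?(negPf cN) ?aQ ?aQ' ?cP ?cP' //]]).
all: try (solve [suff [H|H] : redpres b (P :\: Q) a \/ redpres b (Q :\: P) c;
  [exact: thruD H|exact: thruD' H|apply: (corner_red HP HQ smD erefl); auto; apply: vv;
   rewrite !inE ?invlK ?aP ?cQ ?(negPf aN) ?(negPf cN) ?aQ ?aQ' ?cP ?cP' //]]).
all: try (solve [suff [H|H] : redpres b (P :\: Q) (invl c) \/ redpres b (Q :\: P) (invl a);
  [exact: thruD H|exact: thruD' H|apply: (@corner_red P Q a c _ _ (invl c) (invl a) HP HQ smD occC); auto; apply: vv;
   rewrite !inE ?invlK ?aP ?cQ ?(negPf aN) ?(negPf cN) ?aQ ?aQ' ?cP ?cP' //]]).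
(* Two configurations remain. In each, [a] and its inverse occupy one pair of opposite quadrants,
   [c] and its inverse the other pair; the letter that is at least as frequent serves both of its
   corners. *)
- case: tot => h.
    suff [H|H] : redpres b (P :&: Q) a \/ redpres b (P :|: Q) a.
    + exact: thruI H.
    + exact: thruU H.
    apply: (corner_red2 (d := a) HP HQ smI) => //; auto; apply: vv;
    by rewrite !inE ?invlK ?aP ?cQ ?(negPf aN) ?(negPf cN) ?aQ ?aQ' ?cP ?cP'.
  suff [H|H] : redpres b (P :\: Q) (invl c) \/ redpres b (Q :\: P) c.
  + exact: thruD H.
  + exact: thruD' H.
  apply: (corner_red2 (d := c) HP HQ smD) => //; auto; apply: vv;
  by rewrite !inE ?invlK ?aP ?cQ ?(negPf aN) ?(negPf cN) ?aQ ?aQ' ?cP ?cP'.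
case: tot => h.
  suff [H|H] : redpres b (P :\: Q) a \/ redpres b (Q :\: P) (invl a).
  + exact: thruD H.
  + exact: thruD' H.
  apply: (corner_red2 (d := a) HP HQ smD) => //; auto; apply: vv;
  by rewrite !inE ?invlK ?aP ?cQ ?(negPf aN) ?(negPf cN) ?aQ ?aQ' ?cP ?cP'.
suff [H|H] : redpres b (P :&: Q) c \/ redpres b (P :|: Q) c.
+ exact: thruI H.
+ exact: thruU H.
apply: (corner_red2 (d := c) HP HQ smI) => //; auto; apply: vv;
by rewrite !inE ?invlK ?aP ?cQ ?(negPf aN) ?(negPf cN) ?aQ ?aQ' ?cP ?cP'.
Qed.

End Peak.
End PeakReduction.

(** * Ranking bases by natural numbers *)

Section BasisRank.
Local Open Scope group_scope.
Local Open Scope classical_set_scope.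
Context {n : nat}.
Local Notation F := (free_group n).
Implicit Types (b : 'I_n -> F).

Definition cwords b (i : 'I_n) : seq (letter n) := co b (gen i).

(** The words of the standard generators in [b] describe the inverse of the automorphism given by
    [b], hence determine [b]. *)
Lemma cwords_inj b b' : isbasis b -> isbasis b' -> cwords b =1 cwords b' -> b = b'.
Proof.
move=> bb bb' e; pose th := fhom (fun i => ev gen (cwords b i)).
have invE b0 : isbasis b0 -> cwords b0 =1 cwords b -> forall x, fhom b0 (th x) = x.
  move=> bb0 e0 x; rewrite /th /fhom -[X in ev b0 (word X)]/(fhom _ x) -/(fhom b0 _).
  rewrite [X in fhom b0 X]/fhom fhom_ev -[RHS]ev_gen_word; apply: eq_ev => l _.
  rewrite fhom_ev -e0 -[RHS](ev_co (gen l.1) bb0); apply: eq_ev => k _.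
  exact: fhom_gen.
have thE i : th (b i) = gen i.
  have : fhom b (th (b i)) = fhom b (gen i) by rewrite invE // fhom_gen.
  by move=> h; apply/val_inj; apply: (freew_inj bb.1) => //; exact: redw_word.
apply: funext => i; have := invE b' bb' (fun j => esym (e j)) (b i).
by rewrite thE fhom_gen.
Qed.

Lemma finite_bases k : finite_set [set b : 'I_n -> F | isbasis b /\ cost b 0 <= k].
Proof.
pose T := {ffun 'I_n -> k.-bseq (letter n)}.
pose A := (fun (t : T) (i : 'I_n) => (t i : seq (letter n))) @` [set: T].
have fA : finite_set A by apply: finite_image; exact: finite_finset.
apply: (@sub_finite_set _ _ ([set b : 'I_n -> F | isbasis b] `&` cwords @^-1` A)).
  move=> b [bb h]; split=> //=; rewrite /A /=.
  have hs i : size (cwords b i) <= k.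
    by apply: leq_trans h; rewrite /cost /= (bigD1 i) //= leq_addr.
  by exists [ffun i => Bseq (hs i)] => //; apply: funext => i; rewrite ffunE.
have : finite_set ((cwords : ('I_n -> F) -> 'I_n -> seq (letter n)) @^-1` A `&` [set b : 'I_n -> F | isbasis b]).
  have -> : cwords @^-1` A `&` [set b : 'I_n -> F | isbasis b] =
     \bigcup_(w in A) [set b : 'I_n -> F | isbasis b /\ cwords b = w].
    by apply/seteqP; split=> [b [Ab bb]|b [w Aw [bb ew]]]; [exists (cwords b)|split; rewrite // /preimage /= ew].
  apply: bigcup_finite => // w _.
  have [[b [bb ew]]|no] := pselect (exists b, isbasis b /\ cwords b = w).
    apply: (@sub_finite_set _ _ [set b]); last exact: finite_set1.
    by move=> b' [bb' ew']; apply: cwords_inj => // i; rewrite ew ew'.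
  by rewrite (_ : [set _ | _] = set0) //; apply/seteqP; split=> // b hb; apply: no; exists b.
by rewrite setIC.
Qed.

Definition below b := [set b' : 'I_n -> F | isbasis b' /\ lexlt (cost b') (cost b)].

Lemma finite_below b : isbasis b -> finite_set (below b).
Proof.
move=> bb; apply: sub_finite_set (finite_bases (cost b 0)) => b' [bb' h]; split => //.
apply: cost_le_len => // h'; exact: (lexlt_irr (lexlt_trans h h')).
Qed.

(** Counting the cheaper bases turns the comparison of infinite cost vectors into one of natural
    numbers, where minima exist and induction is available. *)
Definition rk b : nat := #|` fset_set (below b)|.

Lemma rk_cost b b' : cost b = cost b' -> rk b = rk b'.
Proof. by move=> e; rewrite /rk /below e. Qed.

Lemma rk_lt b b' : isbasis b -> isbasis b' -> lexlt (cost b) (cost b') -> rk b < rk b'.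
Proof.
move=> bb bb' h; apply: fproper_ltn_card; rewrite /fproper; apply/andP; split.
  apply/fsubsetP => x; rewrite !in_fset_set; try exact: finite_below.
  by rewrite !inE => -[bx hx]; split => //; exact: lexlt_trans h.
apply/fsubsetPn; exists b; rewrite in_fset_set; try exact: finite_below.
  by rewrite inE.
by rewrite notin_setE => -[_ /lexlt_irr].
Qed.

Lemma rkP b b' : isbasis b -> isbasis b' ->
  (rk b < rk b' <-> lexlt (cost b) (cost b')) /\ (rk b = rk b' <-> cost b = cost b').
Proof.
move=> bb bb'; case: (lexlt_total (cost b) (cost b')) => h.
- rewrite (rk_cost h) ltnn h; split; split => //; by move=> /lexlt_irr.
- have lt := rk_lt bb bb' h; split; split => //.
    by move=> e; rewrite e ltnn in lt.
  by move=> e; rewrite e in h; case: (lexlt_irr h).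
have lt := rk_lt bb' bb h; split; split.
- by move=> /(ltn_trans lt); rewrite ltnn.
- by move=> h'; case: (lexlt_irr (lexlt_trans h h')).
- by move=> e; rewrite e ltnn in lt.
by move=> e; rewrite e in h; case: (lexlt_irr h).
Qed.

End BasisRank.

(** * From local to global minimality *)

Section LocalMin.
Local Open Scope group_scope.
Local Open Scope classical_set_scope.
Context {n : nat}.
Local Notation F := (free_group n).
Variable c : seq (set F).
Hypothesis c_subgroup : forall A, A \in c -> subgroup A.
Hypothesis c_chain : pairwise (fun A B => `[< A `<=` B >]) c.
Implicit Types (b : 'I_n -> F) (P Q : {set letter n}) (a : letter n).

Let cc := [set A | A \in c].
Let cc_subgroup A : cc A -> subgroup A := fun h => c_subgroup h.

Definition bstep b b' := [/\ cadapted cc b, cadapted cc b' & cost b = cost b' \/ adj cc b b'].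

Inductive reach (M : nat) b : ('I_n -> F) -> Prop :=
| reach_refl : cadapted cc b -> rk b <= M -> reach M b b
| reach_step b' b'' : reach M b b' -> bstep b' b'' -> rk b'' <= M -> reach M b b''.

Lemma reach_rk M b b' : reach M b b' -> rk b' <= M.
Proof. by case. Qed.

Lemma reach_st M b b' : reach M b b' -> cadapted cc b'.
Proof. by case=> // x y _ []. Qed.

Lemma reach_trans M b b' b'' : reach M b b' -> reach M b' b'' -> reach M b b''.
Proof. by move=> h; elim=> // x y _ h' s r; exact: reach_step h' s r. Qed.

Lemma reach_le M M' b b' : M <= M' -> reach M b b' -> reach M' b b'.
Proof.
move=> le; elim=> [sb r|x y _ h s r]; first by apply: reach_refl => //; exact: leq_trans r le.
exact: reach_step h s (leq_trans r le).
Qed.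

Lemma conn_reach b M x y : isbasis b -> rk b <= M.+1 -> cadapted cc x ->
  lexlt (cost x) (cost b) -> conn cc (cost b) x y -> reach M x y.
Proof.
move=> bb rb sx lx h; elim: h sx lx => {x y} [x|x y z [_ sy _ ly h] _ IH] sx lx.
  apply: reach_refl => //; rewrite -ltnS; apply: leq_trans rb; apply: rk_lt => //; exact: sx.1.
have rr u : cadapted cc u -> lexlt (cost u) (cost b) -> rk u <= M.
  by move=> su lu; rewrite -ltnS; apply: leq_trans rb; apply: rk_lt => //; exact: su.1.
apply: reach_trans (IH sy ly); apply: (reach_step (b' := x)).
- by apply: reach_refl => //; exact: rr.
- by split.
exact: rr.
Qed.

Lemma adj_redpres b b' : cadapted cc b -> adj cc b b' -> lexlt (cost b') (cost b) ->
  exists P a, redpres cc b P a /\ cost (move b P a) = cost b'.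
Proof.
move=> sb [P [a [vP pP e]]] lt; exists P, a; split=> //; split=> //.
by apply/reductiveP => //; [exact: sb.1|rewrite e].
Qed.

(** Induction along the path: at a basis of rank [M.+1] one remembers a lower neighbour [e] already
    reached below. When the path descends again, [peak] joins [e] to the next basis; when it stays
    at the same rank the cost is unchanged and [e] is still a neighbour. *)
Lemma reach_down M x y : reach M.+1 x y -> rk x <= M ->
  (rk y <= M -> reach M x y) /\
  (rk y = M.+1 -> exists e, [/\ reach M x e & adj cc y e]).
Proof.
move=> h rx; elim: h => {y} [sx _|y z hy [IH1 IH2] [sy sz hyz] rz].
  by split=> [|e]; [exact: reach_refl|rewrite e ltnn in rx].
have ry := reach_rk hy; have by_ := sy.1; have bz := sz.1.
move: ry; rewrite leq_eqVlt ltnS => /orP[/eqP ey|ry].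
  have [e [he aye]] := IH2 ey; have re := reach_rk he; have se := reach_st he.
  split=> [rz'|ez].
    have lz : lexlt (cost z) (cost y) by apply/(rkP bz by_).1; rewrite ey ltnS.
    have le : lexlt (cost e) (cost y) by apply/(rkP se.1 by_).1; rewrite ey ltnS.
    have ayz : adj cc y z by case: hyz => // h; rewrite h in lz; case: (lexlt_irr lz).
    have [P [a [HP eP]]] := adj_redpres sy aye le.
    have [Q [d [HQ eQ]]] := adj_redpres sy ayz lz.
    have /(conn_reach (M := M) by_) := peak cc_subgroup sy HP HQ.
    rewrite ey => /(_ (leqnn _) (redpres_st cc_subgroup sy HP) (redpres_lt sy HP)) r.
    have sQ := redpres_st cc_subgroup sy HQ.
    apply: (reach_step (b' := move y Q d)) => //; last by split => //; left.
    apply: (reach_trans _ r); apply: (reach_step he).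
      by split => //; [exact: (redpres_st cc_subgroup sy HP)|left].
    by rewrite (rk_cost eP).
  exists e; split=> //; apply: (adj_cost cc_subgroup sy sz) => //.
  by apply/(rkP by_ bz).2; rewrite ey ez.
split=> [rz'|ez]; first by apply: (reach_step (IH1 ry)).
exists y; split; first exact: IH1.
case: hyz => [h|]; first by move: ry; rewrite (rk_cost h) ez ltnn.
exact: adj_sym.
Qed.

Lemma reach_min M b b' : reach M b b' -> rk b' <= rk b -> reach (rk b) b b'.
Proof.
elim: M b' => [|M IH] b' h rb'.
  have e : rk b = 0%N.
    have : rk b <= 0 by elim: h => // ? ? ? r ? _; exact: r.
    by rewrite leqn0 => /eqP.
  by rewrite e.
have [le|] := leqP (rk b) M.
  by apply: IH => //; apply: (reach_down h le).1; exact: leq_trans le.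
have : rk b <= M.+1 by elim: h.
rewrite leq_eqVlt => /orP[/eqP->//|]; by rewrite ltnS leqNgt => /negPf->.
Qed.

(** By [reach_min] the path may be kept at rank at most [rk b]. It can then never leave the cost of
    [b]: a step down from a basis of that cost would give a reductive move at [b] itself. *)
Lemma reach_local_min M b b' : (forall P a, ~ redpres cc b P a) -> reach M b b' ->
  ~ lexlt (cost b') (cost b).
Proof.
move=> nred h lt.
have sb : cadapted cc b by elim: h.
have lt' := rk_lt (reach_st h).1 sb.1 lt.
have {}h := reach_min h (ltnW lt').
suff : cost b' = cost b by move=> e; rewrite e in lt; case: (lexlt_irr lt).
elim: h {lt lt'} => // x y hx ex [sx sy sxy] ry.
case: sxy => [<-//|axy].
move: ry; rewrite leq_eqVlt => /orP[/eqP ey|ry]; first by apply/(rkP sy.1 sb.1).2.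
have aby : adj cc b y by apply: (adj_cost cc_subgroup sx sb ex axy).
have ly : lexlt (cost y) (cost b) by apply/(rkP sy.1 sb.1).1.
by have [P [a [/nred]]] := adj_redpres sb aby ly.
Qed.

(** Elementary Nielsen transformations are special Whitehead moves; this lets Nielsen's method
    produce paths of moves. *)
Lemma upd_move b (k l : letter n) : k.1 != l.1 -> upd b k l = move b [set l; invl k]%SET l.
Proof.
move=> kl; apply: (@eq_lval2 _ _ _ _ k l).
- rewrite upd_lval lval_move // !inE eqxx orbT.
  have -> : (k == l) = false by apply: contraNF kl => /eqP->.
  have -> : (k == invl k) = false by apply/negbTE; rewrite eq_sym invl_neq.
  by rewrite /= mul1g.
- by rewrite upd_other ?lval_move_same // eq_sym.
move=> x xk xl; rewrite upd_other // lval_move // !inE.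
have -> : (x == l) = false by apply: contraNF xl => /eqP->.
have -> : (x == invl k) = false by apply: contraNF xk => /eqP->.
have -> : (invl x == l) = false by apply: contraNF xl => /eqP<-.
have -> : (invl x == invl k) = false by apply: contraNF xk => /eqP/(congr1 fst) /= ->.
by rewrite /= mul1g mulg1.
Qed.

(* Relative Nielsen reduction: the members of [b'] lying in [A] become letters of
   [b], without touching those lying in the smaller subgroups [c1]. *)
Lemma reach_letters b b' (c1 : seq (set F)) A : cadapted cc b -> cadapted cc b' ->
  {subset c1 <= c} -> (A \in c \/ A = setT) -> (forall B, B \in c -> B \in c1 \/ A `<=` B) ->
  (forall i, (exists2 B, B \in c1 & B (b' i)) -> exists l, b' i = lval b l) ->
  exists M b'', reach M b' b'' /\
  (forall i, A (b'' i) \/ (exists2 B, B \in c1 & B (b'' i)) -> exists l, b'' i = lval b l).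
Proof.
move=> sb sb' c1c Ac cA hb'; have [bb hb] := sb.
pose cd (x : F) : F := ev gen (co b x).
have cdK x : fhom b (cd x) = x.
  by rewrite /cd fhom_ev -[RHS](ev_co x bb); apply: eq_ev => l _; rewrite fhom_gen.
have fhom_inj x y : fhom b x = fhom b y -> x = y.
  by move=> h; apply/val_inj; apply: (freew_inj bb.1) => //; exact: redw_word.
have cdM x y : cd (x * y) = cd x * cd y by apply: fhom_inj; rewrite fhomM !cdK.
have cdV x : cd x^-1 = (cd x)^-1 by apply: fhom_inj; rewrite fhomV !cdK.
have cdL l : cd (lval b l) = ev gen [:: l].
  by apply: fhom_inj; rewrite cdK fhom_ev; rewrite /= mulg1 /lval; case: l.2; rewrite fhom_gen.
have cdl b0 l : cd (lval b0 l) = lval (fun i => cd (b0 i)) l.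
  by rewrite /lval; case: l.2 => //; rewrite cdV.
(* Among the bases reachable from [b'] that keep the letters already obtained in [c1], one of least
   total weight is chosen, weights being computed in coordinates with respect to [b]. *)
pose inv b0 := (exists M, reach M b' b0) /\
  (forall i, (exists2 B, B \in c1 & B (b0 i)) -> exists l, b0 i = lval b l).
pose Q k := `[< exists b0, inv b0 /\ \sum_i mu (cd (b0 i)) = k >].
have exQ : exists k, Q k.
  exists (\sum_i mu (cd (b' i))); apply/asboolP; exists b'; split => //; split => //.
  by exists (rk b'); exact: reach_refl.
case: (ex_minnP exQ) => k0 /asboolP [b0 [[[M r0] l0] e0]] mink.
exists M, b0; split=> // i; case; last exact: l0.
have s0 := reach_st r0; have [bb0 hb0] := s0.
have adA b1 : cadapted cc b1 -> adapted b1 A.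
  case: Ac => [h [_ /(_ A h)] //|-> [[_ g1] _] x _].
  by have [z ez] := g1 x; exists z.
pose J := {i | `[< A (b0 i) >]}.
pose V (j : J) := cd (b0 (val j)).
pose L (j : J) := `[< exists2 B, B \in c1 & B (b0 (val j)) >].
pose lf (l : J * bool) : letter n := (val l.1, l.2).
have Vl l : lval V l = cd (lval b0 (lf l)) by rewrite cdl.
have b01 i' : b0 i' != 1.
  apply/eqP => e; have := bb0.1 [:: (i', false)] isT.
  by rewrite /= mulg1 /lval /= e => /(_ erefl).
have cd1 : cd 1 = 1 by apply: fhom_inj; rewrite cdK fhom1.
have V1 j : V j != 1.
  by apply/eqP => e; have := b01 (val j); rewrite -[b0 _]cdK -/(V j) e fhom1 eqxx.
have VL j : L j -> len (V j) = 1%N.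
  by move=> /asboolP /l0 [l el]; rewrite /V el cdL /len word_ev_gen_id.
have VLL k l : L k.1 -> L l.1 -> l != invl k -> lval V k * lval V l != 1.
  move=> _ _; apply: contraNneq; rewrite !Vl -cdM => e.
  have : lval b0 (lf l) = lval b0 (invl (lf k)).
    rewrite lval_inv; apply: (mulgI (lval b0 (lf k))); rewrite mulgV.
    by rewrite -[LHS]cdK e fhom1.
  move/(lval_inj bb0); clear e; case: k l => [k ek] [l el] e2.
  have -> : l = k by apply: val_inj; exact: (congr1 fst e2).
  by have /= -> := congr1 snd e2.
have irr k l : k.1 != l.1 -> ~~ L k.1 -> mu (lval V k) <= mu (lval V k * lval V l).
  move=> kl nL; rewrite leqNgt; apply/negP => lt.
  have kl' : (lf k).1 != (lf l).1 by apply: contraNneq kl => /val_inj ->.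
  pose b1 := upd b0 (lf k) (lf l).
  have vP : valid [set lf l; invl (lf k)]%SET (lf l).
    rewrite /valid !inE eqxx /= negb_or invl_neq /=.
    by apply: contraNneq kl' => /(congr1 fst) /= ->.
  (* As [k] is not in [L], a member of the chain containing its value is not in [c1]; it therefore
     contains [A], and with it the multiplier. *)
  have pP : pres cc b0 [set lf l; invl (lf k)]%SET (lf l).
    move=> x; rewrite !inE => /orP[/eqP->|/eqP->]; first exact: lev_refl.
    move=> B /= Bc Bk; have [Bc1|AB] := cA B Bc.
      by case/negP: nL; apply/asboolP; exists B.
    by apply: AB; exact: (asboolW (valP l.1)).
  have em : b1 = move b0 [set lf l; invl (lf k)]%SET (lf l) by exact: upd_move.
  have s1 : cadapted cc b1 by rewrite em; exact: cadapted_move.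
  suff /mink : Q (\sum_i mu (cd (b1 i))).
    rewrite leqNgt -e0 => /negP; apply.
    rewrite (bigD1 (val k.1)) //= [X in _ < X](bigD1 (val k.1)) //=.
    have -> : \sum_(i < n | i != val k.1) mu (cd (b1 i)) = \sum_(i < n | i != val k.1) mu (cd (b0 i)).
      by apply: eq_bigr => i' ik; rewrite /b1 /upd /= (negPf ik).
    rewrite ltn_add2r.
    have := mu_upd (V := fun i => cd (b0 i)) (k := lf k) (l := lf l).
    rewrite -!cdl -cdM cdM -!Vl => /(_ lt).
    suff -> : cd (b1 (val k.1)) = upd (fun i => cd (b0 i)) (lf k) (lf l) (lf k).1 by [].
    by rewrite /b1 /upd eqxx -!cdl -!cdM; case: (lf k).2; rewrite // cdV.
  apply/asboolP; exists b1; split=> //; split.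
    exists (maxn M (rk b1)); apply: (reach_step (reach_le (leq_maxl _ _) r0)).
      by split => //; right; exists [set lf l; invl (lf k)]%SET, (lf l); rewrite em.
    exact: leq_maxr.
  move=> i' [B Bc1]; rewrite em (move_in cc_subgroup _ s0 vP pP) => [Bi|]; last exact: c1c.
  have ik : i' != val k.1.
    by apply: contraNneq nL => ei; rewrite ei in Bi; apply/asboolP; exists B.
  rewrite -em /b1 /upd /= (negPf ik); apply: l0; by exists B.
have bA l : A (b l.1) -> exists k : letter n, lval b l = lval b0 k.
  move=> Al; have [z ez hz] := adA b0 s0 (b l.1) Al.
  have [z' ez'] : exists z', ev V z' = cd (b l.1).
    rewrite -{l Al}ez; elim: z hz => [|x z IH] hz; first by exists [::]; rewrite /= cd1.
    have [z' ez'] := IH (fun y yz => hz y (mem_behead (s := x :: z) yz)).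
    have Ax : `[< A (b0 x.1) >] by apply/asboolP; apply: hz; rewrite inE eqxx.
    exists ((exist _ x.1 Ax, x.2) :: z'); rewrite [ev _ _]/= [ev b0 _]/= cdM ez' Vl /lf /=.
    by rewrite -surjective_pairing.
  have [k ek] : exists k, ev V z' = lval V k.
    apply: (nielsen_letter V1 VL VLL irr).
    by rewrite ez' -[b l.1]/(lval b (l.1, false)) cdL /len word_ev_gen_id.
  have e1 : b l.1 = lval b0 (lf k) by rewrite -[LHS]cdK -ez' ek Vl cdK.
  clear - e1; case: l e1 => i' [] /= e1; last by exists (lf k).
  by exists (invl (lf k)); rewrite lval_inv -e1.
(* Every letter of [b] in [A] is now a letter of [b0]. The word of [b0 i] in [b] therefore
   translates into a reduced word in [b0] of the same length, which can only be the single letter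
   [i]. *)
move=> Ai.
have Az l : l \in co b (b0 i) -> A (b l.1).
  exact: (adapted_letters bb (adA b sb) Ai).
pose tau l := if pselect (exists k, lval b l = lval b0 k) is left h then projT1 (cid h) else l.
have tauE l : l \in co b (b0 i) -> lval b l = lval b0 (tau l).
  move=> /Az/bA h; rewrite /tau; case: pselect => // h'; exact: projT2 (cid h').
have evtau z : {subset z <= co b (b0 i)} -> ev b z = ev b0 (map tau z).
  elim: z => //= l z IH h; rewrite tauE ?h ?inE ?eqxx // IH // => k kz.
  by apply: h; rewrite inE kz orbT.
have redtau z : {subset z <= co b (b0 i)} -> redw z -> redw (map tau z).
  elim: z => //= l [|k z] IH // h rz.
  rewrite [redw _]/= in IH *; have := IH (fun y yz => h y (mem_behead (s := l :: k :: z) yz)) (path_sorted rz).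
  rewrite /redw /= => ->; rewrite andbT.
  have hl : l \in co b (b0 i) by apply: h; rewrite inE eqxx.
  have hk : k \in co b (b0 i) by apply: h; rewrite !inE eqxx orbT.
  move: rz; rewrite /redw /= => /andP[+ _]; apply: contraNneq => e.
  by apply/eqP/(lval_inj bb); rewrite lval_inv tauE // (tauE l) // e lval_inv.
have eco : [:: (i, false)] = map tau (co b (b0 i)).
  apply: (freew_inj bb0.1) => //; first by apply: redtau => //; exact: redw_co.
  by rewrite -evtau // ev_co //= mulg1.
have := ev_co (b0 i) bb; case: (co b (b0 i)) eco => [//|l [|//]] _ /=.
by rewrite mulg1 => e; exists l.
Qed.

(** [reach_letters] is applied to the members of the chain in increasing order, and at last to the
    whole group, where every member of the basis has become a letter of [b]. *)
Lemma reach_letters_all b b' : cadapted cc b -> cadapted cc b' ->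
  exists M b'', reach M b' b'' /\ signed_perm b b''.
Proof.
move=> sb sb'.
have prefix (c1 c2 : seq (set F)) : c = c1 ++ c2 -> exists M b'', reach M b' b'' /\
    (forall i, (exists2 B, B \in c1 & B (b'' i)) -> exists l, b'' i = lval b l).
  elim/last_ind: c1 c2 => [|c1 A IH] c2 ec.
    by exists (rk b'), b'; split; [exact: reach_refl|move=> i [B]].
  have := IH (A :: c2); rewrite -cat_rcons => /(_ ec) [M [b1 [r1 h1]]].
  have sub1 B : B \in c1 -> B \in c by rewrite ec mem_cat mem_rcons inE => ->; rewrite orbT.
  have [|||M' [b2 [r2 h2]]] := @reach_letters b b1 c1 A sb (reach_st r1) sub1.
  - by left; rewrite ec mem_cat mem_rcons mem_head.
  - move=> B; rewrite {1}ec mem_cat mem_rcons inE => /orP[/orP[/eqP->|]|Bc2]; [by right|by left|right].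
    have := c_chain; rewrite ec pairwise_cat => /and3P[/allrelP /(_ A B) + _ _].
    by rewrite mem_rcons mem_head => /(_ isT Bc2)/asboolP.
  - exact: h1.
  exists (maxn M M'), b2; split.
    apply: (reach_trans (reach_le (leq_maxl _ _) r1)); exact: reach_le (leq_maxr _ _) r2.
  move=> i [B]; rewrite mem_rcons inE => /orP[/eqP->|Bc] Bi; apply: h2; first by left.
  by right; exists B.
have [|M [b1 [r1 h1]]] := prefix c [::]; first by rewrite cats0.
have [||||M' [b2 [r2 h2]]] := @reach_letters b b1 c setT sb (reach_st r1) => //.
- by right.
- by move=> B Bc; left.
exists (maxn M M'), b2; split; last by move=> i; apply: h2; left.
apply: (reach_trans (reach_le (leq_maxl _ _) r1)); exact: reach_le (leq_maxr _ _) r2.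
Qed.

(** A path of preserving moves leads from [b] to a signed permutation of [b'], which has the same
    cost as [b']; [reach_local_min] applies to it. *)
Lemma local_min_min b b' : cadapted cc b -> cadapted cc b' ->
  (forall P a, ~ redpres cc b P a) -> ~ lexlt (cost b') (cost b).
Proof.
move=> sb sb' nred; have [M [b2 [r s]]] := reach_letters_all sb' sb.
by rewrite -(cost_signed sb'.1 (reach_st r).1 s); apply: reach_local_min nred r.
Qed.

End LocalMin.

(** * The matching on chains of free factors *)

Section Chainf.
Context {disp : Order.disp_t} {T : porderType disp}.

Definition chainf (c : {fset T}) :=
  forall x y, x \in c -> y \in c -> (x <= y)%O || (y <= x)%O.

Lemma chainf_sub (c c' : {fset T}) : (c `<=` c')%fset -> chainf c' -> chainf c.
Proof. by move=> /fsubsetP s h x y /s hx /s hy; exact: h. Qed.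

End Chainf.

Section BasisSpan.
Local Open Scope group_scope.
Local Open Scope classical_set_scope.
Context {n : nat}.
Local Notation F := (free_group n).
Implicit Types (b : 'I_n -> F) (S : {set 'I_n}) (A : set F).

Definition spanb b S : set F := [set x | exists2 z, ev b z = x & forall l, l \in z -> l.1 \in S].

Definition idx b A : {set 'I_n} := [set i | `[< A (b i) >]]%SET.

Lemma subgroup_spanb b S : subgroup (spanb b S).
Proof.
split; first by exists [::].
  move=> x y [z <- hz] [z' <- hz']; exists (z ++ z'); first by rewrite ev_cat.
  by move=> l; rewrite mem_cat => /orP[/hz|/hz'].
move=> x [z <- hz]; exists (invw z); first by rewrite ev_invw.
by move=> l; rewrite mem_invw => /hz.
Qed.

Lemma spanb_basis b S i : isbasis b -> spanb b S (b i) <-> i \in S.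
Proof.
move=> bb; split=> [[z ez hz]|iS]; last first.
  by exists [:: (i, false)]; rewrite /= ?mulg1 // => l; rewrite inE => /eqP->.
apply: (hz (i, false)); apply: mem_redu.
have -> : redu z = [:: (i, false)]; last by rewrite mem_head.
apply: (freew_inj bb.1); rewrite ?redw_redu //.
by rewrite ev_redu ez /= mulg1.
Qed.

Lemma idx_spanb b S : isbasis b -> idx b (spanb b S) = S.
Proof. by move=> bb; apply/setP => i; rewrite inE; apply/asboolP/idP => /(spanb_basis S i bb). Qed.

Lemma spanb_sub b S S' : isbasis b -> spanb b S `<=` spanb b S' <-> S \subset S'.
Proof.
move=> bb; split=> [h|/fintype.subsetP h x [z ez hz]].
  by apply/fintype.subsetP => i /(spanb_basis S i bb)/h/(spanb_basis S' i bb).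
by exists z => // l /hz/h.
Qed.

Lemma spanb_idx b A : isbasis b -> subgroup A -> adapted b A -> spanb b (idx b A) = A.
Proof.
move=> bb sA aA; apply/seteqP; split=> x.
  move=> [z <- hz]; apply: subgroup_ev => // l /hz; by rewrite inE => /asboolP.
by move=> /aA [z <- hz]; exists z => // l /hz h; rewrite inE; apply/asboolP.
Qed.

Lemma adapted_spanb b S : isbasis b -> adapted b (spanb b S).
Proof. by move=> bb x [z <- hz]; exists z => // l /hz/(spanb_basis S _ bb). Qed.

Lemma free_factor_spanb b S : isbasis b -> free_factor (spanb b S).
Proof.
move=> bb; exists (spanb b (~: S)); split; [exact: subgroup_spanb|exact: subgroup_spanb|].
move=> H f g fM gM; pose W i := if i \in S then f (b i) else g (b i).
pose h x := ev W (co b x).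
have hE z : h (ev b z) = ev W z by apply: (freew_ev _ bb.1); rewrite ev_co.
exists h; split.
  split.
  - by move=> x y; rewrite -(ev_co x bb) -(ev_co y bb) -ev_cat !hE ev_cat.
  - move=> x; rewrite inE => -[z <- hz]; rewrite hE.
    rewrite (morph_ev_in (A := spanb b S)) //; first by apply: eq_ev => l /hz lS; rewrite /W lS.
      exact: subgroup_spanb.
    by move=> l /hz/(spanb_basis S _ bb).
  move=> x; rewrite inE => -[z <- hz]; rewrite hE.
  rewrite (morph_ev_in (A := spanb b (~: S))) //.
  - by apply: eq_ev => l /hz; rewrite finset.inE /W => /negPf->.
  - exact: subgroup_spanb.
  by move=> l /hz/(spanb_basis (~: S) _ bb).
move=> h' [hM hf hg]; apply: funext => x; rewrite -(ev_co x bb) hE (morph_ev _ _ hM).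
apply: eq_ev => l _; rewrite /W /=; case: ifPn => lS.
  by rewrite hf // inE; apply/spanb_basis.
by rewrite hg // inE; apply/spanb_basis => //; rewrite finset.inE.
Qed.

Lemma spanb_proper b S : isbasis b -> S != finset.set0 -> S != [set: 'I_n]%SET ->
  proper_free_factor (spanb b S).
Proof.
move=> bb S0 ST; split; first exact: free_factor_spanb.
  have /set0Pn [i iS] := S0; move=> e.
  have : spanb b S (b i) by apply/spanb_basis.
  have : spanb b finset.set0 (b i) <-> _ := spanb_basis finset.set0 i bb.
  rewrite e finset.inE => h /= bi1; suff : spanb b finset.set0 (b i) by move/h.
  by rewrite bi1; case: (subgroup_spanb b finset.set0).
move=> e; case/negP: ST; apply/eqP/setP => i; rewrite finset.inE.
by apply: (spanb_basis S i bb).1; rewrite e.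
Qed.

Lemma idx_proper b A : isbasis b -> proper_free_factor A -> adapted b A ->
  idx b A != finset.set0 /\ idx b A != [set: 'I_n]%SET.
Proof.
move=> bb [fA A1 AT] aA; have [sA _] := factor_fg fA.
have e := spanb_idx bb sA aA; split; apply/eqP => h; [case: A1|case: AT]; rewrite -e h.
  apply/seteqP; split=> [x [[|l z] <- hz] //|x ->]; last by exists [::].
  by have := hz l (mem_head _ _); rewrite finset.inE.
apply/seteqP; split=> // x _; exists (co b x); first by rewrite ev_co.
by move=> l _; rewrite finset.inE.
Qed.

End BasisSpan.

Section ChainMatching.
Local Open Scope classical_set_scope.
Context {n : nat}.
Local Notation F := (free_group n).
Implicit Types (b : 'I_n -> F) (S : {set 'I_n}) (A : set F) (c : {fset FC n}).

Definition cseq c : seq (set F) := [seq val x | x <- sort <=%O (enum_fset c)].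

Lemma mem_cseq c A : A \in cseq c <-> exists2 x, x \in c & val x = A.
Proof.
split=> [/mapP [x]|[x xc <-]].
  by rewrite mem_sort => xc ->; exists x.
by apply: map_f; rewrite mem_sort.
Qed.

Lemma FC_proper (x : FC n) : proper_free_factor (val x).
Proof. by have := valP x; rewrite inE. Qed.

Lemma cseq_subgroup c A : A \in cseq c -> subgroup A.
Proof. by move=> /mem_cseq [x _ <-]; have [/factor_fg [] ] := FC_proper x. Qed.

Lemma cseq_chain c : chainf c -> pairwise (fun A B => `[< A `<=` B >]) (cseq c).
Proof.
move=> hc; rewrite pairwise_map.
suff : pairwise <=%O (sort <=%O (enum_fset c) : seq (FC n)).
  by apply: sub_pairwise => x y /= h; apply/asboolP; apply/le_FC.
rewrite -sorted_pairwise; last exact: Order.POrderTheory.le_trans.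
apply: (@sort_sorted_in _ (mem c)) => [x y xc yc|]; first exact: hc.
by apply/allP.
Qed.

Definition cadapt c b := cadapted [set A | A \in cseq c] b.

Lemma cadapt_exists c : chainf c -> exists b, cadapt c b.
Proof.
move=> hc; have [|b bb hb] := adapted_exists _ (cseq_chain hc).
  by move=> A /mem_cseq [x _ <-]; have [] := FC_proper x.
by exists b; split.
Qed.

Lemma cadapt_sub c c' b : {subset c <= c'} -> cadapt c' b -> cadapt c b.
Proof.
move=> s [bb h]; split=> // A /mem_cseq [x /s xc <-]; apply: h.
by apply/mem_cseq; exists x.
Qed.

Lemma cadapt_cost c b b' : isbasis b' -> cost b = cost b' -> cadapt c b -> cadapt c b'.
Proof.
move=> bb' e [bb h]; split=> // A Ac x /(h A Ac) [z <- hz].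
have sA : subgroup A by exact: cseq_subgroup Ac.
have sp := signed_cost bb' bb (esym e).
have [s [hs _]] := signed_permP sp.
exists (map s z).
  elim: z {hz} => //= l z ->; by rewrite hs.
move=> k /mapP [l lz ->]; have := hz l lz.
by rewrite -(lval_in b l sA) hs lval_in.
Qed.

(** One basis is fixed for each cost, so that chains whose cheapest bases have equal rank get
    literally the same basis. *)
Definition canon (v : nat -> nat) : 'I_n -> F :=
  if pselect (exists b, isbasis b /\ cost b = v) is left h then projT1 (cid h) else gen.

Lemma canonP b : isbasis b -> isbasis (canon (cost b)) /\ cost (canon (cost b)) = cost b.
Proof.
move=> bb; rewrite /canon; case: pselect => [h|[]]; first exact: projT2 (cid h).
by exists b.
Qed.

Definition minimal c b := cadapt c b /\ forall b', cadapt c b' -> rk b <= rk b'.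

Lemma minimal_exists c : chainf c -> exists b, minimal c b.
Proof.
move=> /cadapt_exists [b hb].
have ex : exists k, `[< exists b, cadapt c b /\ rk b = k >] by exists (rk b); apply/asboolP; exists b.
case: (ex_minnP ex) => k /asboolP [b0 [h0 <-]] mk; exists b0; split=> // b' h'.
by apply: mk; apply/asboolP; exists b'.
Qed.

Definition beta c : 'I_n -> F :=
  if pselect (exists b, minimal c b) is left h then canon (cost (projT1 (cid h))) else gen.

Lemma beta_min c : chainf c -> minimal c (beta c) /\ canon (cost (beta c)) = beta c.
Proof.
move=> /minimal_exists h; rewrite /beta; case: pselect => // h'; case: (cid h') => b [hb mb] /=.
have [bc ec] := canonP hb.1; rewrite ec; split=> //; split; first exact: cadapt_cost hb.
by move=> b' /mb; rewrite (rk_cost ec).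
Qed.

Lemma beta_rk c c' : chainf c -> chainf c' -> rk (beta c) = rk (beta c') -> beta c = beta c'.
Proof.
move=> hc hc'; have [[ac _] e] := beta_min hc; have [[ac' _] e'] := beta_min hc'.
by move/(rkP ac.1 ac'.1).2 => ee; rewrite -e -e' ee.
Qed.

Lemma beta_mono c c' : {subset c <= c'} -> chainf c -> chainf c' -> rk (beta c) <= rk (beta c').
Proof.
move=> s hc hc'; have [[_ mc] _] := beta_min hc; have [[ac' _] _] := beta_min hc'.
by apply: mc; exact: cadapt_sub ac'.
Qed.

Lemma beta_eq c c' : chainf c -> chainf c' -> minimal c (beta c') -> beta c = beta c'.
Proof.
move=> hc hc' [a m]; have [[a' m'] _] := beta_min hc; apply: beta_rk => //.
by apply/eqP; rewrite eqn_leq m' // m.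
Qed.

Definition good b S i :=
  `[< forall P a, valid P a -> a.1 = i -> (forall l, l \in P -> l.1 \notin S) -> ~ reductive b P a >].

Lemma good_mono b S S' i : S \subset S' -> good b S i -> good b S' i.
Proof.
move=> /fintype.subsetP s /asboolP h; apply/asboolP => P a v e hP; apply: h => // l /hP.
by apply: contraNN => /s.
Qed.

Definition fam b c : {set {set 'I_n}} := [set S | spanb b S \in cseq c]%SET.

Lemma schain_fam b c : chainf c -> isbasis b -> schain (fam b c).
Proof.
move=> hc bb; split=> [S|S S'].
  rewrite finset.inE => /mem_cseq [x _ e]; have := FC_proper x; rewrite e => p.
  by have := idx_proper bb p (adapted_spanb bb); rewrite idx_spanb.
rewrite !finset.inE => /mem_cseq [x xc e] /mem_cseq [y yc e'].
by case/orP: (hc _ _ xc yc) => /le_FC; rewrite e e' => /(spanb_sub _ _ bb) ->; rewrite ?orbT.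
Qed.

Lemma in_fam b c S : S \in fam b c <-> exists2 x, x \in c & val x = spanb b S.
Proof. by rewrite finset.inE; exact: mem_cseq. Qed.

Lemma fam_idx b c x : cadapt c b -> x \in c ->
  idx b (val x) \in fam b c /\ spanb b (idx b (val x)) = val x.
Proof.
move=> [bb h] xc; have xs : val x \in cseq c by apply/mem_cseq; exists x.
have e : spanb b (idx b (val x)) = val x.
  by apply: spanb_idx => //; [exact: cseq_subgroup xs|exact: h].
by split=> //; apply/in_fam; exists x.
Qed.

(** A move by [P] and [a] respects the chain exactly when no letter of [P] has its index in the
    largest member avoiding [a.1]. Goodness thus says that no such move is reductive, and
    [local_min_min] makes this local condition global. *)
Lemma minimal_good c b : chainf c -> cadapt c b -> minimal c b <-> goodf (good b) (fam b c).
Proof.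
move=> hc ac; have [bb hb] := ac.
have presP P a : pres [set A | A \in cseq c] b P a <->
    (forall l, l \in P -> l.1 \notin low (fam b c) a.1).
  split=> [pP l lP|hP l lP A Ac Al].
    apply/negP => /finset.bigcupP [S /andP[]]; rewrite finset.inE => Sc aS lS; case/negP: aS.
    apply/(spanb_basis S _ bb)/(pP l lP _ Sc); exact/spanb_basis.
  apply: contrapT => Aa; case/negP: (hP l lP); apply/finset.bigcupP.
  have e : spanb b (idx b A) = A by apply: spanb_idx => //; [exact: cseq_subgroup Ac|exact: hb].
  by exists (idx b A); rewrite ?finset.inE ?e; [apply/andP; split => //; apply/asboolP|apply/asboolP].
split=> [[_ mb] i|gd].
  apply/asboolP => P a vP ai hP rP; rewrite -ai in hP.
  have am := cadapted_move (@cseq_subgroup c) ac vP ((presP P a).2 hP).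
  have := mb _ am; rewrite leqNgt => /negP; apply; apply: rk_lt => //; first exact: am.1.
  exact/reductiveP.
split=> // b' ab'; rewrite leqNgt; apply/negP => lt.
apply: (local_min_min (@cseq_subgroup c) (cseq_chain hc) ac ab').
  by move=> P a [vP /presP hP]; have /asboolP := gd a.1; apply.
exact/(rkP ab'.1 bb).1.
Qed.

Variable x0 : FC n.

Definition depthc c := depth (good (beta c)) (fam (beta c) c).
Definition critc c := depthc c == n.-1.
Definition togc c := toggle (good (beta c)) (fam (beta c) c).
Definition vc c : FC n := insubd x0 (spanb (beta c) (togc c)).
(** [n.+2 ^ 3] exceeds the [srank] of any noncritical chain, so cheapest bases are compared first
    and set ranks second. *)
Definition rc c := rk (beta c) * n.+2 ^ 3 + srank (good (beta c)) (fam (beta c) c).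

Section OneChain.
Variable c : {fset FC n}.
Hypothesis hc : chainf c.
Let b := beta c.
Let X := fam b c.
Let T := togc c.

Let mb : minimal c b. Proof. by case: (beta_min hc). Qed.
Let ab : cadapt c b. Proof. by case: mb. Qed.
Let bb : isbasis b. Proof. by case: ab. Qed.

Lemma good_beta : goodf (good b) X. Proof. exact/minimal_good. Qed.
Lemma schain_beta : schain X. Proof. exact: schain_fam. Qed.

Lemma depthc_lt : 0 < n -> depthc c < n.
Proof.
move=> n0; rewrite /depthc -[X in _ < X]card_ord.
by apply: depth_ltI; [exact: good_mono|exact: schain_beta|exact: good_beta|rewrite card_ord].
Qed.

Hypothesis n0 : 0 < n.
Hypothesis nc : ~~ critc c.

Lemma depth_beta : depth (good b) X < #|'I_n|.-1.
Proof.
rewrite card_ord; have := depthc_lt n0; move: nc; rewrite /critc /depthc -/b -/X; lia.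
Qed.

Let spec := toggle_spec (@good_mono b) schain_beta good_beta depth_beta.

Lemma val_vc : val (vc c) = spanb b T.
Proof.
rewrite /vc -/b -/T val_insubd; have [i [_ [_ _ _ T0 TT] _]] := spec.
by have := spanb_proper bb T0 TT; rewrite -in_setE => ->.
Qed.

Lemma spanb_T (x : FC n) S : val x = spanb b S -> (x == vc c) = (S == T).
Proof.
move=> e; apply/eqP/eqP => [ex|eS].
  by rewrite -(idx_spanb S bb) -e ex val_vc idx_spanb.
by apply/val_inj; rewrite val_vc e eS.
Qed.

Lemma chainf_vc : chainf (vc c |` c)%fset.
Proof.
have [_ comp] := schain_toggle (@good_mono b) schain_beta good_beta depth_beta.
have rep x : x \in (vc c |` c)%fset -> exists2 S, val x = spanb b S & S \in (T |: X)%SET.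
  rewrite in_fset1U => /orP[/eqP->|xc].
    by exists T; [exact: val_vc|rewrite !finset.inE eqxx].
  have [h e] := fam_idx ab xc; exists (idx b (val x)) => //.
  by rewrite finset.in_setU1 h orbT.
move=> x y /rep [S ex SX] /rep [S' ey SX'].
case/orP: (comp _ _ SX SX') => h; apply/orP; [left|right]; apply/le_FC; rewrite ex ey;
exact/spanb_sub.
Qed.

Variable c' : {fset FC n}.
Hypotheses (c'l : (c `\ vc c `<=` c')%fset) (c'u : (c' `<=` vc c |` c)%fset).

Lemma chainf_tog : chainf c'.
Proof. by move=> x y /(fsubsetP c'u) hx /(fsubsetP c'u) hy; exact: chainf_vc. Qed.

Lemma cadapt_tog : cadapt c' b.
Proof.
split=> // A /mem_cseq [x xc <-]; have := fsubsetP c'u x xc.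
rewrite in_fset1U => /orP[/eqP->|{}xc]; first by rewrite val_vc; exact: adapted_spanb.
by apply: ab.2; apply/mem_cseq; exists x.
Qed.

Lemma fam_tog_sub : fam b c' \subset (T |: X)%SET.
Proof.
apply/fintype.subsetP => S /in_fam [x xc e]; rewrite finset.in_setU1 -(spanb_T e).
have := fsubsetP c'u x xc; rewrite in_fset1U => /orP[->//|{}xc].
by apply/orP; right; apply/in_fam; exists x.
Qed.

Lemma fam_tog_sup : (X :\ T)%SET \subset fam b c'.
Proof.
apply/fintype.subsetP => S; rewrite finset.in_setD1 => /andP[ST /in_fam [x xc e]].
apply/in_fam; exists x => //; apply: (fsubsetP c'l); rewrite in_fsetD1 xc andbT.
by rewrite (spanb_T e).
Qed.

Lemma goodf_tog : goodf (good b) (fam b c').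
Proof.
have g := goodf_toggleD (@good_mono b) schain_beta good_beta depth_beta.
by move=> i; apply: good_mono (g i); apply: low_mono; exact: fam_tog_sup.
Qed.

(** The toggled factor is spanned by a part of [b], so [b] remains adapted; goodness survives as
    well, and [minimal_good] shows that [b] is still the cheapest. *)
Lemma beta_tog : beta c' = b.
Proof.
apply: beta_eq => //; first exact: chainf_tog.
by apply/minimal_good; [exact: chainf_tog|exact: cadapt_tog|exact: goodf_tog].
Qed.

Lemma togP : [/\ ~~ critc c', vc c' = vc c & rc c' = rc c].
Proof.
have eb := beta_tog; have h1 := fam_tog_sup; have h2 := fam_tog_sub.
have gm := @good_mono b.
have e1 := depth_toggle gm schain_beta good_beta depth_beta h1 h2.
have e2 := toggle_toggle gm schain_beta good_beta depth_beta h1 h2.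
split.
- by rewrite /critc /depthc eb e1.
- by rewrite /vc /togc eb e2.
by rewrite /rc eb (srank_toggle gm schain_beta good_beta depth_beta h1 h2).
Qed.

End OneChain.

Lemma fam_mono b c c' : {subset c <= c'} -> fam b c \subset fam b c'.
Proof. by move=> s; apply/fintype.subsetP => S /in_fam [x /s xc e]; apply/in_fam; exists x. Qed.

Lemma fam_vc c : chainf c -> 0 < n -> ~~ critc c ->
  fam (beta c) (vc c |` c)%fset = (togc c |: fam (beta c) c)%SET.
Proof.
move=> hc n0 nc; apply/eqP; rewrite finset.eqEsubset fam_tog_sub //=.
apply/fintype.subsetP => S; rewrite finset.in_setU1 => /orP[/eqP->|].
  by apply/in_fam; exists (vc c); [rewrite fset1U1|exact: val_vc].
by apply: (fintype.subsetP (fam_mono _ _)) => x xc; rewrite in_fset1U xc orbT.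
Qed.

Lemma fam_inj (b : 'I_n -> F) c c' : cadapt c b -> cadapt c' b -> fam b c = fam b c' -> c = c'.
Proof.
move=> a a' e; apply/fsetP => x; apply/idP/idP => xc.
  by have [+ es] := fam_idx a xc; rewrite e => /in_fam [y yc]; rewrite es => /val_inj <-.
by have [+ es] := fam_idx a' xc; rewrite -e => /in_fam [y yc]; rewrite es => /val_inj <-.
Qed.

Lemma card_fam (b : 'I_n -> F) c : cadapt c b -> #|` c| = #|fam b c|.
Proof.
move=> a; rewrite cardE -(size_map (spanb b) (enum _)); rewrite cardfE.
pose s := [seq val x | x <- enum_fset c].
rewrite -cardfE -[LHS](size_map val (enum_fset c)).
apply/eqP; rewrite eqn_leq; apply/andP; split; apply: uniq_leq_size.
- by rewrite map_inj_uniq ?fset_uniq //; exact: val_inj.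
- move=> A /mapP [x xc ->]; have [h e] := fam_idx a xc.
  by rewrite -e map_f // mem_enum.
- rewrite map_inj_in_uniq ?enum_uniq // => S S' _ _ e.
  by rewrite -(idx_spanb S a.1) e idx_spanb //; exact: a.1.
by move=> A /mapP [S]; rewrite mem_enum => /in_fam [x xc e] ->; rewrite -e map_f.
Qed.

(** A larger chain has fewer adapted bases, so the rank of its cheapest one cannot decrease; when
    both chains have the same basis, [srank_mono] decides. *)
Lemma rc_mono c c' : 0 < n -> chainf c' -> ~~ critc c -> ~~ critc c' -> (c `<=` c')%fset ->
  rc c <= rc c' /\ (rc c = rc c' -> vc c = vc c' /\ (vc c |` c = vc c' |` c')%fset).
Proof.
move=> n0 hc' nc nc' s; have hc := chainf_sub s hc'.
have l1 : srank (good (beta c)) (fam (beta c) c) < n.+2 ^ 3.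
  have := srank_lt (@good_mono _) (schain_beta hc) (good_beta hc) (depth_beta hc n0 nc).
  by rewrite card_ord.
have l2 : srank (good (beta c')) (fam (beta c') c') < n.+2 ^ 3.
  have := srank_lt (@good_mono _) (schain_beta hc') (good_beta hc') (depth_beta hc' n0 nc').
  by rewrite card_ord.
have bm := beta_mono (fsubsetP s) hc hc'.
have sm : beta c = beta c' -> _ := fun e => srank_mono (@good_mono (beta c'))
  (eq_ind _ (fun b => schain (fam b c)) (schain_beta hc) _ e)
  (eq_ind _ (fun b => goodf (good b) (fam b c)) (good_beta hc) _ e)
  (eq_ind _ (fun b => depth (good b) (fam b c) < #|'I_n|.-1) (depth_beta hc n0 nc) _ e)
  (schain_beta hc') (good_beta hc') (depth_beta hc' n0 nc') (fam_mono _ (fsubsetP s)).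
have [|le eqr] := lexi_le l1 l2 bm.
  by move=> /(beta_rk hc hc') e; have [+ _] := sm e; rewrite e.
split=> // /eqr [/(beta_rk hc hc') e e2].
have [_ h] := sm e; rewrite e in e2; have [et eX] := h e2.
have ev : vc c = vc c' by rewrite /vc /togc e et.
split=> //; apply: (@fam_inj (beta c')).
- by rewrite -e; apply: (@cadapt_tog c) => //; exact: fsubDset.
- by apply: (@cadapt_tog c') => //; exact: fsubDset.
by rewrite -{1}e !fam_vc // /togc e.
Qed.

(** A critical chain has at least [n.-1] members, and no chain has more, since all its members are
    spanned by parts of one adapted basis. *)
Lemma critc_max c c' : 0 < n -> chainf c' -> critc c -> (c `<=` c')%fset ->
  c' = c /\ #|` c| = n.-1.
Proof.
move=> n0 hc' /eqP dc s; have hc := chainf_sub s hc'.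
have [[ab _] _] := beta_min hc; have [b' ab'] := cadapt_exists hc'.
have c1 : n.-1 <= #|` c|.
  rewrite (card_fam ab) -{1}(card_ord n).
  by apply: (card_scrit (@good_mono (beta c))); [rewrite card_ord|exact: schain_beta|exact: good_beta].
have c2 : #|` c'| <= n.-1.
  by rewrite (card_fam ab') -[X in _ <= X.-1](card_ord n); apply/card_schain/schain_fam => //; exact: ab'.1.
have -> : c' = c by apply/esym/eqP; rewrite eqEfcard s (leq_trans c2 c1).
split=> //; apply/eqP; rewrite eqn_leq c1 andbT; apply: leq_trans c2; exact: fsubset_leq_card.
Qed.

End ChainMatching.

Lemma chain_matching n : 2 <= n ->
  exists (crit : {fset FC n} -> bool) (v : {fset FC n} -> FC n) (r : {fset FC n} -> nat),
  [/\ forall c, chainf c -> ~~ crit c -> chainf (v c |` c)%fset,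
      forall c c', chainf c -> ~~ crit c -> (c `\ v c `<=` c')%fset -> (c' `<=` v c |` c)%fset ->
        [/\ ~~ crit c', v c' = v c & r c' = r c],
      forall c c', chainf c' -> ~~ crit c -> ~~ crit c' -> (c `<=` c')%fset ->
        r c <= r c' /\ (r c = r c' -> v c = v c' /\ (v c |` c = v c' |` c')%fset) &
      forall c c', chainf c' -> crit c -> (c `<=` c')%fset -> c' = c /\ #|` c| = n.-1].
Proof.
move=> n2; have n0 : 0 < n by exact: ltnW.
(* With two generators available, the span of the first is a proper free factor; it serves as the
   default value of [vc]. *)
have [x0] : exists x0 : FC n, True.
  pose i0 := Ordinal n0; pose i1 := Ordinal n2.
  have p : proper_free_factor (spanb gen [set i0]%SET : set (free_group n)).
    apply: spanb_proper; first exact: isbasis_gen.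
      by apply/set0Pn; exists i0; rewrite finset.inE.
    by apply/eqP => /setP /(_ i1); rewrite !finset.inE.
  by exists (SigSub (mem_set p)).
move=> _; exists (@critc n), (vc x0), (@rc n); split.
- by move=> c hc nc; exact: chainf_vc.
- by move=> c c' hc nc h1 h2; exact: togP.
- by move=> c c'; exact: rc_mono.
by move=> c c'; exact: critc_max.
Qed.

From mathcomp Require Import ring lra all_reals all_analysis wedge_sigT.
Import Order.TTheory GRing.Theory Num.Theory.
Import numFieldNormedType.Exports.

Local Open Scope classical_set_scope.
Local Open Scope ring_scope.

(** * Continuity on simplicial realizations *)

Section ContOn.
Implicit Types X Y Z : topologicalType.

Definition cont_on X Y (A : set X) (f : X -> Y) :=
  forall x, A x -> f @ within A (nbhs x) --> f x.

Lemma cont_on_eq X Y (A : set X) (f g : X -> Y) : (forall x, A x -> f x = g x) ->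
  cont_on A f -> cont_on A g.
Proof.
move=> fg cf x Ax; rewrite -fg //; apply: cvg_trans (cf x Ax).
by apply: near_eq_cvg; rewrite near_withinE; apply: nearW => y /fg.
Qed.

Lemma cont_on_sub X Y (A B : set X) (f : X -> Y) : A `<=` B -> cont_on B f -> cont_on A f.
Proof.
move=> AB cf x Ax; apply: cvg_trans (cf x (AB _ Ax)); apply: cvg_app.
by apply: within_subset => //; exact: nbhs_filter.
Qed.

Lemma cont_on_comp X Y Z (A : set X) (B : set Y) (f : X -> Y) (g : Y -> Z) :
  (forall x, A x -> B (f x)) -> cont_on A f -> cont_on B g -> cont_on A (g \o f).
Proof.
move=> AB cf cg x Ax; apply: (@cvg_comp _ _ _ f g _ (within B (nbhs (f x)))); last exact/cg/AB.
move=> U /(cf x Ax); rewrite /= !near_simpl /= !near_withinE => h.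
by near=> y => Ay; apply: (near h y) => //; exact: AB.
Unshelve. all: by end_near.
Qed.

Lemma continuous_cont_on X Y (A : set X) (f : X -> Y) : continuous f -> cont_on A f.
Proof. by move=> cf x _; apply: cvg_within_filter; exact: cf. Qed.

Lemma cvg_pair_nbhs X Y (Z : Type) (F : set_system Z) (f : Z -> X) (g : Z -> Y) (x : X) (y : Y) :
  Filter F -> f @ F --> x -> g @ F --> y -> (fun z => (f z, g z)) @ F --> (x, y).
Proof. by move=> FF fx gy; apply: cvg_pair. Qed.

Lemma cont_on_pair X Y Z (A : set X) (f : X -> Y) (g : X -> Z) :
  cont_on A f -> cont_on A g -> cont_on A (fun x => (f x, g x)).
Proof. by move=> cf cg x Ax; apply: cvg_pair_nbhs; [exact: cf|exact: cg]. Qed.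

Lemma cont_on_cover X Y (I : choiceType) (D : {fset I}) (A : I -> set X) (B : set X) (f : X -> Y) :
  (forall i, i \in D -> closed (A i)) -> (forall i, i \in D -> cont_on (A i) f) ->
  B `<=` \bigcup_(i in [set` D]) A i -> cont_on B f.
Proof.
move=> cA cf BA x Bx V Vfx.
have h i : i \in D -> \forall y \near x, A i y -> V (f y).
  move=> iD; have [Ax|nAx] := pselect (A i x); first exact: (cf i iD x Ax V Vfx).
  have : \forall y \near x, (~` A i) y.
    by apply: open_nbhs_nbhs; split => //; exact/closed_openC/cA.
  by apply: filterS => y nAy Ay; case: nAy.
have hD := @filter_bigI _ I D (fun i => [set y | A i y -> V (f y)]) (nbhs x) (nbhs_filter x) h.
change (nbhs x (fun y => B y -> V (f y))); apply: filterS hD => y hy By.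
by have [i iD Ay] := BA y By; exact: hy Ay.
Qed.

Lemma cont_on_within X Y (A : set X) (f : X -> Y) : cont_on A f -> {within A, continuous f}.
Proof. by move=> cf; apply/subspace_continuousP. Qed.

End ContOn.

Definition uniti (R : realType) : set R := `[0, 1].
Arguments uniti : clear implicits.

(** * Homotopies on spaces with a final topology *)

Section Tube.
Context (R : realType) (Z Y : topologicalType) (I : Type) (X : I -> topologicalType).
Variables (A : forall i, set (X i)) (q : forall i, X i -> Z).
Hypothesis final : forall W : set Z,
  (forall i x, @A i x -> W (q x) -> within (@A i) (nbhs x) (@q i @^-1` W)) -> open W.
Hypothesis cover : forall z, exists i, exists2 x, @A i x & q x = z.

Lemma final_continuous (f : Z -> Y) : (forall i, cont_on (@A i) (f \o @q i)) -> continuous f.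
Proof.
move=> cf; apply/continuousP => V oV; apply: final => i x Ax Vx.
by apply: (cf i x Ax V); exact: open_nbhs_nbhs.
Qed.

(** The points sent into a given open set during a whole compact segment of times form an open set,
    by compactness and the final topology. Continuity on the product with the interval can therefore
    be tested on the pieces. *)
Lemma tube (H : Z * R -> Y) :
  (forall i, cont_on (@A i `*` uniti R) (fun u => H (q u.1, u.2))) ->
  {within [set: Z] `*` uniti R, continuous H}.
Proof.
move=> cH; apply: cont_on_within => -[z0 t0] [_ t0S] V; rewrite /= nbhsE => -[V' [oV' V'H] V'V].
have [i [x0 Ax0 ez0]] := cover z0.
have nV' u : V' u -> nbhs u V' by move=> V'u; apply: open_nbhs_nbhs.
have [d d0 hd] : exists2 d : R, 0 < d & forall s : R, uniti R s -> `|t0 - s| <= d -> V' (H (z0, s)).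
  have := cH i (x0, t0) (conj Ax0 t0S) V'; rewrite /= ez0 => /(_ (nV' _ V'H)) [[Q1 Q2] /= [n1 n2] hQ].
  have [e e0 he] := (nbhs_ballP _ _).1 n2; exists (e / 2); first by rewrite divr_gt0.
  move=> s Ss ts; rewrite -ez0; apply: (hQ (x0, s)) => //; split; first exact: nbhs_singleton n1.
  by apply: he; rewrite /ball /=; apply: le_lt_trans ts _; rewrite ltr_pdivrMr // ltr_pMr // ltr1n.
pose J : set R := [set` `[t0 - d, t0 + d]].
pose W := [set z | forall s, J s -> uniti R s -> V' (H (z, s))].
have oW : open W.
  apply: final => j x Ax Wx.
  have := (compact_near_coveringP J).1 (@segment_compact _ _ _) _ (within (@A j) (nbhs x))
    (fun x' s => uniti R s -> V' (H (q x', s))).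
  apply => s Js; have [Ss|nS] := pselect (uniti R s); last first.
    have : nbhs s (~` uniti R).
      by apply: open_nbhs_nbhs; split => //; apply: closed_openC; exact: itv_closed.
    move=> nn; exists (~` uniti R, setT) => /=; first by split => //; exact: filterT.
    by move=> [s' x'] /= [h _] /h.
  have := cH j (x, s) (conj Ax Ss) V'; rewrite /= => /(_ (nV' _ (Wx s Js Ss))) [[Q1 Q2] /= [n1 n2] hQ].
  exists (Q2, Q1 `&` @A j) => /=.
    split => //; rewrite /within /=; apply: filterS n1 => x' ? ?; by split.
  by move=> [s' x'] /= [Qs' [Qx' Ax']] Ss'; apply: (hQ (x', s')).
exists (W, [set s | `|t0 - s| < d]) => /=.
  split; last by apply/nbhs_ballP; exists d.
  apply: open_nbhs_nbhs; split => // s; rewrite /J /= in_itv /= => /andP[h1 h2] Ss.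
  by apply: hd => //; rewrite ler_distlC ?h1 ?h2 // -lerBlDr lerBlDl -lerBlDr; rewrite ?h1 ?h2.
move=> [z s] /= [Wz ts] [_ Ss]; apply/V'V/Wz => //.
by move: ts; rewrite /J /= in_itv /= ltr_distlC => /andP[/ltW -> /ltW ->].
Qed.

End Tube.

Section Realization.
Context {R : realType} {disp : Order.disp_t} {T : porderType disp}.
Local Notation K := (realization R T).
Implicit Types (p : K) (c : {fset T}).

Definition simp c : set K := [set p | forall x, x \notin c -> val p x = 0].

Lemma chain_chainf (s : seq T) : chain s -> chainf [fset x in s]%fset.
Proof.
move=> cs x y; rewrite !inE => xs ys.
have ps : pairwise <=%O s by rewrite -sorted_pairwise; [apply: sub_sorted cs; exact: ltW|exact: le_trans].
elim: s ps xs ys {cs} => //= z s IH /andP[/allP hz ps].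
rewrite !inE => /predU1P[->|xs] /predU1P[->|ys]; rewrite ?lexx ?hz ?orbT //; exact: IH.
Qed.

Lemma chainf_chain c : chainf c -> exists2 s : seq T, chain s & s =i c.
Proof.
move=> hc; exists (sort <=%O (enum_fset c)); last by move=> x; rewrite mem_sort.
rewrite /chain lt_sorted_uniq_le sort_uniq fset_uniq /=.
apply: (@sort_sorted_in _ (mem c)) => [x y xc yc|]; first exact: hc.
by apply/allP.
Qed.

Lemma point_ge0 p x : 0 <= val p x.
Proof. by have /set_mem [s _ []] := valP p. Qed.

Lemma sum_support (f : T -> R) (s s' : seq T) : uniq s -> uniq s' ->
  (forall x, x \notin s -> f x = 0) -> (forall x, x \notin s' -> f x = 0) ->
  \sum_(x <- s) f x = \sum_(x <- s') f x.
Proof.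
move=> us us' h h'; rewrite (bigID (fun x => f x == 0)) /= big1 ?add0r; last by move=> x /eqP.
rewrite [RHS](bigID (fun x => f x == 0)) /= [in RHS]big1 ?add0r; last by move=> x /eqP.
rewrite -big_filter -[RHS]big_filter; apply: perm_big; apply: uniq_perm; rewrite ?filter_uniq //.
move=> x; rewrite !mem_filter; case: (eqVneq (f x) 0) => //= fx.
have [xs|/h e] := boolP (x \in s); last by rewrite e eqxx in fx.
by have [xs'|/h' e] := boolP (x \in s'); last by rewrite e eqxx in fx.
Qed.

Lemma point_chain p : exists2 c, chainf c & simp c p.
Proof.
have /set_mem [s cs [_ h0 _]] := valP p; exists [fset x in s]%fset; first exact: chain_chainf.
by move=> x; rewrite !inE; exact: h0.
Qed.

Lemma point_sum p c : simp c p -> \sum_(x <- c) val p x = 1.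
Proof.
move=> sp; have /set_mem [s cs [_ h0 <-]] := valP p; apply: sum_support; rewrite ?fset_uniq => //.
by move: cs; rewrite /= /chain lt_sorted_uniq_le => /andP[].
Qed.

Lemma simp_closed_simplex (s : seq T) c p : chain s -> s =i c -> simp c p <-> closed_simplex s (val p).
Proof.
move=> cs sc; split=> [sp|[_ h _] x]; last by rewrite -sc; exact: h.
split; [exact: point_ge0|by move=> x; rewrite sc; exact: sp|].
rewrite -(point_sum sp); apply: sum_support; rewrite ?fset_uniq => //; last by move=> x; rewrite sc; exact: sp.
by move: cs; rewrite /= /chain lt_sorted_uniq_le => /andP[].
Qed.

Lemma mk_point c (f : T -> R) : chainf c -> (forall x, 0 <= f x) ->
  (forall x, x \notin c -> f x = 0) -> \sum_(x <- c) f x = 1 -> exists p : K, val p = f.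
Proof.
move=> hc f0 fc f1; have [s cs sc] := chainf_chain hc.
have h : (\bigcup_(s in [set s | chain s]) @closed_simplex R _ T s) f.
  exists s => //; split => //; first by move=> x; rewrite sc; exact: fc.
  rewrite -f1; apply: sum_support; rewrite ?fset_uniq => //; last by move=> x; rewrite sc; exact: fc.
  by move: cs; rewrite /= /chain lt_sorted_uniq_le => /andP[].
by exists (SigSub (mem_set h)).
Qed.

Lemma bary_continuous (x : T) : continuous (fun p : K => val p x).
Proof.
apply/continuousP => V oV; rewrite /open /= => s cs p Vp sp.
have [e e0 he] := (nbhs_ballP _ _).1 (open_nbhs_nbhs (conj oV Vp)).
exists e => // q sq h; apply: he; rewrite /ball /=.
have [xs|xs] := boolP (x \in s); first exact: h.
by case: sp sq => _ -> // _ [_ -> // _]; rewrite subrr normr0.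
Qed.

(** Inside one closed simplex the weak topology is the Euclidean one, so finitely many coordinates
    decide convergence. *)
Lemma cvg_point (Z : Type) (F : set_system Z) (G : Z -> K) p c : Filter F -> chainf c ->
  simp c p -> (\forall z \near F, simp c (G z)) ->
  (forall x, x \in c -> val (G z) x @[z --> F] --> val p x) -> G @ F --> p.
Proof.
move=> FF hc sp sG cG U; rewrite nbhsE => -[U1 [oO Op] OU].
have [s cs sc] := chainf_chain hc.
have [e e0 he] := oO s cs p Op ((simp_closed_simplex p cs sc).1 sp).
have : F (\bigcap_(x in [set` c]) [set z | `|val p x - val (G z) x| < e]).
  apply: filter_bigI => x xc; apply: (cG x xc (ball (val p x) e)).
  exact: nbhsx_ballx.
move=> h; change (F (fun z => U (G z))); move: sG h; apply: filterS2 => z sz hz; apply/OU/he; first exact/(simp_closed_simplex _ cs sc).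
by move=> x; rewrite sc => xc; exact: hz.
Qed.

Lemma open_realization (U : set K) :
  (forall c p, chainf c -> simp c p -> U p -> within (simp c) (nbhs p) U) -> open U.
Proof.
move=> h; change (realization_open U) => s cs p Up sp; have hc := chain_chainf cs.
have sc : s =i [fset x in s]%fset by move=> x; rewrite !inE.
have := h _ p hc ((simp_closed_simplex p cs sc).2 sp) Up.
rewrite /within /= nbhsE => -[U1 [oO Op] OU].
have [e e0 he] := oO s cs p Op sp; exists e => // q sq hq.
by apply: OU; [exact: he|exact/(simp_closed_simplex _ cs sc)].
Qed.

Lemma closed_simp c : closed (simp c).
Proof.
have -> : simp c = \bigcap_(x in [set x | x \notin c]) ((fun p : K => val p x) @^-1` [set 0]).
  by apply/seteqP; split.
apply: closed_bigI => x _; apply: preimage_closed; last exact: closed_eq.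
by move=> p _; exact: bary_continuous.
Qed.

Lemma realization_continuous (Y : topologicalType) (f : K -> Y) :
  (forall c, chainf c -> cont_on (simp c) f) -> continuous f.
Proof.
move=> cf; apply: (@final_continuous K Y {c : {fset T} | chainf c} (fun=> K) (fun i => @simp (sval i)) (fun=> id)).
- move=> W h; apply: open_realization => c p hc; exact: (h (exist _ c hc)).
- by move=> [c hc]; exact: cf.
Qed.

Lemma realization_homotopy (Y : topologicalType) (H : K * R -> Y) :
  (forall c, chainf c -> cont_on (simp c `*` uniti R) H) ->
  {within [set: K] `*` uniti R, continuous H}.
Proof.
move=> cH; apply: (@tube R K Y {c : {fset T} | chainf c} (fun=> K) (fun i => @simp (sval i)) (fun=> id)).
- move=> W h; apply: open_realization => c p hc; exact: (h (exist _ c hc)).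
- by move=> p; have [c hc sp] := point_chain p; exists (exist _ c hc), p.
- move=> [c hc]; apply: cont_on_eq (cH c hc) => -[] //.
Qed.

End Realization.

Section RealContinuity.
Context {R : realType}.

Lemma closed_le_fun (X : topologicalType) (f g : X -> R) : continuous f -> continuous g ->
  closed [set x | f x <= g x].
Proof.
move=> cf cg; have -> : [set x | f x <= g x] = (fun x => g x - f x) @^-1` [set y | 0 <= y].
  by apply/seteqP; split=> x /=; rewrite subr_ge0.
apply: preimage_closed; last exact: closed_ge.
by move=> x _; apply: cvgB; [exact: cg|exact: cf].
Qed.

Lemma closed_eq_fun (X : topologicalType) (f g : X -> R) : continuous f -> continuous g ->
  closed [set x | f x = g x].
Proof.
move=> cf cg; have -> : [set x | f x = g x] = [set x | f x <= g x] `&` [set x | g x <= f x].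
  by apply/seteqP; split=> x /= => [->|[h1 h2]]; [rewrite lexx|apply: le_anti; rewrite h1 h2].
by apply: closedI; exact: closed_le_fun.
Qed.

Lemma minr_continuous : continuous (fun u : R * R => Num.min u.1 u.2).
Proof. by move=> u; apply: (@continuous_min R _ fst snd); [exact: cvg_fst|exact: cvg_snd]. Qed.

Lemma maxr_continuous : continuous (fun u : R * R => Num.max u.1 u.2).
Proof. by move=> u; apply: (@continuous_max R _ fst snd); [exact: cvg_fst|exact: cvg_snd]. Qed.

End RealContinuity.

Lemma bigmin_seq_le (R : realType) (I : eqType) (s : seq I) (F : I -> R) x :
  x \in s -> \big[Num.min/1]_(y <- s) F y <= F x.
Proof.
elim: s => //= y s IH; rewrite inE big_cons ge_min => /predU1P[->|/IH ->]; first by rewrite lexx.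
by rewrite orbT.
Qed.

Lemma bigmin_seq_attained (R : realType) (I : eqType) (s : seq I) (F : I -> R) :
  (forall x, F x <= 1) -> s != [::] -> exists2 x, x \in s & \big[Num.min/1]_(y <- s) F y = F x.
Proof.
move=> F1; elim: s => //= y s IH _; rewrite big_cons; have [->|/IH [x xs e]] := eqVneq s [::].
  by exists y; [rewrite mem_head|rewrite big_nil min_l].
have [h|h] := leP (F y) (F x).
  by exists y; [rewrite mem_head|rewrite e min_l].
by exists x; [rewrite inE xs orbT|rewrite e min_r // ltW].
Qed.

(** * Collapse of the noncritical part *)

Section Push.
Context {R : realType} {disp : Order.disp_t} {T : porderType disp}.
Local Notation K := (realization R T).
Implicit Types (p : K) (c : {fset T}).

Definition supp p : {fset T} := [fset x in s2val (cid2 (point_chain p)) | val p x != 0]%fset.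

Lemma in_supp p x : (x \in supp p) = (val p x != 0).
Proof.
rewrite /supp; case: cid2 => c hc sp /=; rewrite !inE /=.
by have [//|/sp ->] := boolP (x \in c); rewrite eqxx.
Qed.

Lemma chainf_supp p : chainf (supp p).
Proof.
rewrite /supp; case: cid2 => c hc sp /=; apply: chainf_sub hc.
by apply/fsubsetP => x; rewrite !inE /= => /andP[].
Qed.

Lemma simpP c p : simp c p <-> (supp p `<=` c)%fset.
Proof.
split=> [sp|/fsubsetP h x].
  by apply/fsubsetP => x; rewrite in_supp; apply: contraR => /sp ->.
by apply: contraNeq => ?; apply: h; rewrite in_supp.
Qed.

Lemma simp_supp p : simp (supp p) p. Proof. exact/simpP/fsubset_refl. Qed.

Lemma simp_sub c c' p : (c `<=` c')%fset -> simp c p -> simp c' p.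
Proof. by move=> cc /simpP h; apply/simpP; exact: fsubset_trans cc. Qed.

Lemma point_le1 p x : val p x <= 1.
Proof.
have [xs|] := boolP (x \in supp p); last by rewrite in_supp negbK => /eqP->.
rewrite -(point_sum (@simp_supp p)) (big_fsetD1 x) //= lerDl.
by apply: sumr_ge0 => y _; exact: point_ge0.
Qed.

(** Coordinates never exceed the neutral value 1, so for nonempty [c] this is the smallest
    coordinate on [c]. *)
Definition minc c p : R := \big[Num.min/1]_(x <- c) val p x.

Lemma minc_le c p x : x \in c -> minc c p <= val p x.
Proof. exact: bigmin_seq_le. Qed.

Lemma minc_ge0 c p : 0 <= minc c p.
Proof. by rewrite /minc; elim/big_ind: _ => [|x y hx hy|x _]; [exact: ler01|rewrite le_min hx|exact: point_ge0]. Qed.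

Lemma minc_attained c p : c != fset0 -> exists2 x, x \in c & minc c p = val p x.
Proof.
move=> c0; apply: bigmin_seq_attained => [x|]; first exact: point_le1.
by apply: contraNneq c0 => e; apply/eqP/fsetP => x; rewrite inE -(in_nil x) -e.
Qed.

Lemma minc_continuous c : continuous (minc c).
Proof.
rewrite /minc; elim: (enum_fset c) => [|x s IH] p.
  rewrite (_ : (fun _ => _) = fun=> 1); first exact: (@cst_continuous K R 1 p).
  by apply: funext => q; rewrite big_nil.
rewrite (_ : (fun _ => _) = (fun q : K => val q x) \min (fun q => \big[Num.min/1]_(x <- s) val q x)).
  by apply: continuous_min; [exact: bary_continuous|exact: IH].
by apply: funext => q; rewrite big_cons.
Qed.

Lemma bary_fst_continuous x : continuous (fun u : K * R => val u.1 x).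
Proof.
move=> u; apply: (@continuous_comp (K * R)%type K R fst (fun p : K => val p x)).
  exact: cvg_fst.
exact: bary_continuous.
Qed.

Lemma minc_fst_continuous c : continuous (fun u : K * R => minc c u.1).
Proof.
move=> u; apply: (@continuous_comp (K * R)%type K R fst (minc c)).
  exact: cvg_fst.
exact: minc_continuous.
Qed.

(* Moves [p] along [#|c| w - sum of c] until a coordinate in [c] vanishes, at [t = 1]. *)
Definition pushf c w p (t : R) (x : T) : R :=
  val p x + t * minc c p * ((#|` c|)%:R * (x == w)%:R - (x \in c)%:R).

Definition push c w p t : K :=
  if pselect (exists q : K, val q = pushf c w p t) is left h then projT1 (cid h) else p.

Lemma pushE c w p t : w \notin c -> chainf (w |` c)%fset -> simp (w |` c)%fset p ->
  uniti R t -> val (push c w p t) = pushf c w p t.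
Proof.
move=> wc hc sp; rewrite /uniti /= in_itv /= => /andP[t0 t1].
rewrite /push; case: pselect => [h|[]]; first exact: projT2 (cid h).
have tm0 : 0 <= t * minc c p by rewrite mulr_ge0 // minc_ge0.
apply: (mk_point hc).
- move=> x; rewrite /pushf; have [xc|xc] := boolP (x \in c).
    have -> : x == w = false by apply: contraNF wc => /eqP <-.
    rewrite mulr0 sub0r mulrN1 subr_ge0; apply: le_trans (minc_le p xc).
    by rewrite ler_piMl // minc_ge0.
  by rewrite subr0 addr_ge0 ?point_ge0 // mulr_ge0 // mulr_ge0.
- move=> x; rewrite !inE negb_or => /andP[/negPf xw /negPf xc].
  by rewrite /pushf xw xc mulr0 subr0 mulr0 addr0 sp // !inE xw xc.
have := point_sum sp; rewrite !big_fsetU1 //= {1}/pushf eqxx (negPf wc) subr0 mulr1 => e.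
rewrite -[RHS]e -addrA; congr (_ + _).
rewrite [X in _ + X]big_seq (eq_bigr (fun x => val p x - t * minc c p)) => [|x xc]; last first.
  rewrite /pushf xc; have -> : x == w = false by apply: contraNF wc => /eqP <-.
  by rewrite mulr0 sub0r mulrN1.
rewrite -big_seq big_split /= big_const_seq count_predT iter_addr_0 addrC -addrA.
by rewrite mulNrn mulr_natr addNr addr0.
Qed.

Lemma push_fix c w p t : (t = 0 \/ minc c p = 0 \/ c = fset0) -> push c w p t = p.
Proof.
move=> h; rewrite /push; case: pselect => // h'; case: cid => q eq; apply: val_inj; rewrite [LHS]eq.
apply: funext => x; rewrite /pushf; case: h => [->|[->|->]]; rewrite ?mul0r ?mulr0 ?mul0r ?addr0 //.
by rewrite inE subrr mulr0 addr0.
Qed.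

Lemma push_cont c w : w \notin c -> chainf (w |` c)%fset ->
  cont_on (simp (w |` c)%fset `*` uniti R) (fun u => push c w u.1 u.2).
Proof.
move=> wc hc [p t] [/= sp tu].
have sq q s : simp (w |` c)%fset q -> uniti R s -> simp (w |` c)%fset (push c w q s).
  move=> sq su x; rewrite pushE // !inE negb_or => /andP[/negPf xw /negPf xc].
  by rewrite /pushf xw xc mulr0 subr0 mulr0 addr0 sq // !inE xw xc.
apply: (@cvg_point _ _ _ _ _ _ _ _ _ hc).
- exact: sq.
- by rewrite near_withinE; apply: nearW => -[q s] [/= ? ?]; exact: sq.
move=> x xc; have -> : val (push c w p t) = pushf c w p t by exact: pushE.
have : (fun u : K * R => pushf c w u.1 u.2 x) @ within (simp (w |` c)%fset `*` uniti R) (nbhs (p, t))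
   --> pushf c w p t x.
  apply: cvg_within_filter; rewrite /pushf; apply: cvgD.
    exact: (@bary_fst_continuous x (p, t)).
  apply: cvgM; last exact: cvg_cst.
  apply: cvgM; first exact: cvg_snd.
  exact: (@minc_fst_continuous c (p, t)).
apply: cvg_trans; apply: near_eq_cvg; rewrite near_withinE; apply: nearW => -[q s] [/= ? ?].
by rewrite pushE.
Qed.

End Push.

Section Collapse.
Context {R : realType} {disp : Order.disp_t} {T : porderType disp}.
Local Notation K := (realization R T).
Implicit Types (p : K) (c : {fset T}) (t : R).
Variables (crit : {fset T} -> bool) (v : {fset T} -> T) (r : {fset T} -> nat) (d : nat).
Hypothesis tog_chain : forall c, chainf c -> ~~ crit c -> chainf (v c |` c)%fset.
Hypothesis togP : forall c c', chainf c -> ~~ crit c -> (c `\ v c `<=` c')%fset ->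
  (c' `<=` v c |` c)%fset -> [/\ ~~ crit c', v c' = v c & r c' = r c].
Hypothesis rank_mono : forall c c', chainf c' -> ~~ crit c -> ~~ crit c' -> (c `<=` c')%fset ->
  (r c <= r c')%N /\ (r c = r c' -> v c = v c' /\ (v c |` c = v c' |` c')%fset).
Hypothesis crit_max : forall c c', chainf c' -> crit c -> (c `<=` c')%fset -> c' = c /\ #|` c| = d.+1.

Lemma noncrit_sub c c' : (c `<=` c')%fset -> chainf c' -> ~~ crit c' -> ~~ crit c.
Proof. by move=> s hc'; apply: contraNN => cc; have [-> _] := crit_max hc' cc s. Qed.

Definition noncrit p := ~~ crit (supp p).

Lemma noncrit_simp c p : chainf c -> ~~ crit c -> simp c p -> noncrit p.
Proof. by move=> hc nc /simpP s; exact: noncrit_sub nc. Qed.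

Lemma closed_prism c : closed (simp c `*` uniti R : set (K * R)).
Proof.
have -> : simp c `*` uniti R = fst @^-1` simp c `&` snd @^-1` uniti R :> set (K * R) by [].
apply: closedI; apply: preimage_closed.
- by move=> u _; exact: cvg_fst.
- exact: closed_simp.
- by move=> u _; exact: cvg_snd.
exact: itv_closed.
Qed.

(* [step j] collapses the free pairs of rank [j]; the simplex [c] is pushed away from its face
   [c `\ v c] towards the vertex [v c]. *)
Definition step j p t : K :=
  if ~~ crit (supp p) && (r (supp p) == j) then push (supp p `\ v (supp p))%fset (v (supp p)) p t
  else p.

Lemma fset1UD1 (x : T) c : (x |` (c `\ x) = x |` c)%fset.
Proof. by apply/fsetP => y; rewrite !inE; case: eqVneq. Qed.

Lemma step_lt j c p t : chainf c -> ~~ crit c -> (r c < j)%N -> simp c p -> step j p t = p.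
Proof.
move=> hc nc rj sp; have sc := (simpP c p).1 sp; have nsp := noncrit_sub sc hc nc.
have [le _] := rank_mono hc nsp nc sc.
by rewrite /step nsp (ltn_eqF (leq_ltn_trans le rj)).
Qed.

(** The formula of [c] is valid on its faces: a face containing [c] without [v c] belongs to the
    same pair, and any other face misses a vertex of [c] different from [v c], so the minimum
    vanishes and the push is constant. *)
Lemma stepE j c p t : chainf c -> ~~ crit c -> r c = j -> simp c p ->
  step j p t = push (c `\ v c)%fset (v c) p t.
Proof.
move=> hc nc rj sp; have sc := (simpP c p).1 sp; have nsp := noncrit_sub sc hc nc.
have [le he] := rank_mono hc nsp nc sc; rewrite rj in le he.
rewrite /step nsp; case: eqP => [/he [ev eU]|rne] /=.
  rewrite ev in eU *; congr push; apply/fsetP => x; rewrite !inE.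
  by have /fsetP/(_ x) := eU; rewrite !inE; case: eqVneq.
rewrite push_fix //; right; left.
have [h|/fsubsetPn [x xc xs]] := boolP (c `\ v c `<=` supp p)%fset.
  by case: rne; have [_ _ ->] := togP hc nc h (fsubset_trans sc (fsubsetU1 _ _)).
apply/le_anti; rewrite minc_ge0 andbT; apply: le_trans (minc_le p xc) _.
by move: xs; rewrite in_supp negbK => /eqP ->.
Qed.

Lemma step0 j p : step j p 0 = p.
Proof. by rewrite /step; case: ifP => // _; apply: push_fix; left. Qed.

Lemma step_fix j c p t : chainf c -> ~~ crit c -> simp c p -> (c `\ v c)%fset = fset0 -> step j p t = p.
Proof.
move=> hc nc sp c0; have sc := (simpP c p).1 sp; have nsp := noncrit_sub sc hc nc.
rewrite /step nsp; case: eqP => // e /=; apply: push_fix; right; right.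
have [_ ev _] : [/\ ~~ crit (supp p), v (supp p) = v c & r (supp p) = r c].
  apply: togP => //; first by rewrite c0 fsub0set.
  exact: fsubset_trans sc (fsubsetU1 _ _).
by apply/eqP; rewrite -fsubset0 ev -c0; exact: fsetSD.
Qed.

Lemma upper_noncrit c : chainf c -> ~~ crit c ->
  [/\ ~~ crit (v c |` c)%fset, v (v c |` c)%fset = v c & r (v c |` c)%fset = r c].
Proof.
move=> hc nc; apply: togP => //; exact: fsubset_trans (fsubD1set _ _) (fsubsetU1 _ _).
Qed.

Lemma step_simp j c p t : chainf c -> ~~ crit c -> simp c p -> (r c <= j)%N -> uniti R t ->
  simp (v c |` c)%fset (step j p t).
Proof.
move=> hc nc sp rj tu; have spu : simp (v c |` c)%fset p by apply: simp_sub sp; exact: fsubsetU1.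
move: rj; rewrite leq_eqVlt => /orP[/eqP rj|rj]; last by rewrite (step_lt _ hc nc rj sp).
rewrite (stepE _ hc nc rj sp) => x; rewrite !inE negb_or => /andP[xv xc].
rewrite pushE ?fset1UD1 //; last 2 first.
- by rewrite !inE eqxx.
- exact: tog_chain.
by rewrite /pushf !inE (negPf xv) (negPf xc) mulr0 subr0 mulr0 addr0 sp.
Qed.

Lemma step_cont j c : chainf c -> ~~ crit c -> (r c <= j)%N ->
  cont_on (simp c `*` uniti R) (fun u => step j u.1 u.2).
Proof.
move=> hc nc; rewrite leq_eqVlt => /orP[/eqP rj|rj]; last first.
  apply: (@cont_on_eq _ _ _ fst) => [[p t] [/= sp _]|]; first by rewrite (step_lt _ hc nc rj sp).
  by apply: continuous_cont_on => u; exact: cvg_fst.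
apply: (@cont_on_eq _ _ _ (fun u => push (c `\ v c)%fset (v c) u.1 u.2)).
  by move=> [p t] [/= sp _]; rewrite (stepE _ hc nc rj sp).
apply: (@cont_on_sub _ _ _ (simp (v c |` (c `\ v c))%fset `*` uniti R)).
  move=> [p t] [/= sp tu]; split=> //=; apply: simp_sub sp; rewrite fset1UD1; exact: fsubsetU1.
apply: push_cont; first by rewrite !inE eqxx.
by rewrite fset1UD1; exact: tog_chain.
Qed.

(** Equal ranks would force equal larger chains, but [x] belongs to that of [c] and not to that of
    [c1]. Pushing thus leads to strictly lower ranks, and inductions on the rank terminate. *)
Lemma rank_drop c x : chainf c -> ~~ crit c -> x \in (c `\ v c)%fset ->
  let c1 := ((v c |` c) `\ x)%fset in [/\ chainf c1, ~~ crit c1 & (r c1 < r c)%N].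
Proof.
move=> hc nc; rewrite !inE => /andP[xv xc] c1.
have [nu vu ru] := upper_noncrit hc nc; have hu := tog_chain hc nc.
have s1 : (c1 `<=` v c |` c)%fset by exact: fsubD1set.
have h1 := chainf_sub s1 hu; have n1 := noncrit_sub s1 hu nu.
split => //; have [le he] := rank_mono hu n1 nu s1; rewrite ru vu in le he.
rewrite ltn_neqAle le andbT; apply/eqP => /he [e].
by move=> /fsetP /(_ x); rewrite !inE e eqxx (negPf xv) xc !orbT.
Qed.

Lemma step_end j c p x : chainf c -> ~~ crit c -> r c = j -> simp c p ->
  x \in (c `\ v c)%fset -> val p x = minc (c `\ v c)%fset p ->
  simp ((v c |` c) `\ x)%fset (step j p 1).
Proof.
move=> hc nc rj sp xc ex y; rewrite !inE negb_and negbK => h.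
have u1 : uniti R 1 by rewrite /uniti /= in_itv /= ler01 lexx.
case/orP: h => [/eqP->|]; last first.
  rewrite negb_or => /andP[h1 h2]; have := step_simp hc nc sp (eq_leq rj) u1.
  by apply; rewrite !inE negb_or h1.
rewrite (stepE _ hc nc rj sp) pushE ?fset1UD1 //.
- rewrite /pushf xc; have -> : x == v c = false by move: xc; rewrite !inE => /andP[/negPf].
  by rewrite mulr0 sub0r mulrN1 mul1r ex subrr.
- by rewrite !inE eqxx.
- exact: tog_chain.
by apply: simp_sub sp; exact: fsubsetU1.
Qed.

(* Rank [i] is collapsed while [2^-(i+2) <= t <= 2^-(i+1)]: higher ranks go first, and on a simplex,
   where ranks are bounded, nothing moves near [t = 0]. *)
Definition tau (i : nat) t : R := Num.max 0 (Num.min 1 (2 ^+ i.+2 * t - 1)).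

Lemma tau_unit i t : uniti R (tau i t).
Proof. by rewrite /uniti /= in_itv /= /tau le_max lexx ge_max ler01 ge_min lexx. Qed.

Lemma tau0 i t : 2 ^+ i.+2 * t <= 1 -> tau i t = 0.
Proof. by move=> h; rewrite /tau max_l // ge_min subr_le0 h orbT. Qed.

Lemma tau1 i t : 1 <= 2 ^+ i.+1 * t -> tau i t = 1.
Proof.
move=> h; rewrite /tau min_l ?max_r //.
by rewrite lerBrDr exprS -mulrA -[X in X <= _]mulr1 ler_pM2l // ltr0n.
Qed.

Lemma tau_continuous i : continuous (tau i).
Proof.
move=> t; rewrite /tau.
apply: (cvg_comp2 (cvg_cst _) _ (@maxr_continuous R (0, _))).
apply: (cvg_comp2 (cvg_cst _) _ (@minr_continuous R (1, _))).
apply: cvgB; last exact: cvg_cst.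
apply: cvgM; [exact: cvg_cst|exact: cvg_id].
Qed.

Fixpoint flow i p t : K := if i is j.+1 then flow j (step j p (tau j t)) t else p.

Lemma flow_early i p t : 2 ^+ i.+1 * t <= 1 -> flow i p t = p.
Proof.
elim: i p => //= i IH p h; rewrite tau0 // step0; apply: IH.
have [t0|t0] := leP t 0; first by apply: le_trans ler01; rewrite mulr_ge0_le0 // exprn_ge0.
apply: le_trans h; rewrite [leRHS]mulrC [leLHS]mulrC ler_pM2l // [leRHS]exprS.
by rewrite ler_peMl ?exprn_ge0 // ler1n.
Qed.

Lemma flow_fix i c p t : chainf c -> ~~ crit c -> simp c p -> (c `\ v c)%fset = fset0 -> flow i p t = p.
Proof. by move=> hc nc sp c0; elim: i => //= i IH; rewrite (step_fix _ _ hc nc sp c0). Qed.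

Lemma flow_stable i p t : noncrit p -> (r (supp p) < i)%N -> flow i p t = flow (r (supp p)).+1 p t.
Proof.
move=> np; elim: i => //= i IH; rewrite ltnS leq_eqVlt => /predU1P[->//|lt].
by rewrite (step_lt _ (@chainf_supp _ _ _ p) np lt (@simp_supp _ _ _ p)) IH.
Qed.

Lemma flow_noncrit i p t : noncrit p -> noncrit (flow i p t).
Proof.
elim: i p => //= i IH p np; apply: IH; rewrite /step; case: ifPn => // /andP[_ /eqP e].
have hs := @chainf_supp _ _ _ p; have ss := @simp_supp _ _ _ p.
have [nu _ _] := upper_noncrit hs np.
apply: (noncrit_simp (tog_chain hs np) nu).
have := step_simp hs np ss (eq_leq e) (tau_unit i t).
by rewrite /step (np : ~~ crit (supp p)) e eqxx.
Qed.

Lemma flow_cont i c : chainf c -> ~~ crit c -> (r c < i)%N ->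
  cont_on (simp c `*` uniti R) (fun u => flow i u.1 u.2).
Proof.
elim: i c => // i IH c hc nc; rewrite ltnS leq_eqVlt => /predU1P[rj|lt]; last first.
  apply: cont_on_eq (IH c hc nc lt) => -[p t] [/= sp _].
  by rewrite (step_lt _ hc nc lt sp).
have [D0|D0] := eqVneq (c `\ v c)%fset fset0.
  apply: (@cont_on_eq _ _ _ fst) => [[p t] [/= sp _]|].
    by rewrite (step_fix _ _ hc nc sp D0) (flow_fix _ _ hc nc sp D0).
  by apply: continuous_cont_on => u; exact: cvg_fst.
pose tm (u : K * R) := 2 ^+ i.+1 * u.2.
have tmc : continuous tm by move=> u; apply: cvgM; [exact: cvg_cst|exact: cvg_snd].
have onec : continuous (fun u : K * R => 1 : R) by move=> u; exact: cvg_cst.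
have c1 : closed (simp c `*` uniti R : set (K * R)) by exact: closed_prism.
(* The index [v c] stands for the early times, when only rank [i] moves. At later times the push of
   rank [i] is complete, and the index [x] records a face on which it has landed, to which the
   induction hypothesis applies. *)
pose A x : set (K * R) := (simp c `*` uniti R) `&`
  (if x == v c then [set u | tm u <= 1]
   else [set u | 1 <= tm u] `&` [set u | val u.1 x = minc (c `\ v c)%fset u.1]).
apply: (@cont_on_cover _ _ _ (v c |` c)%fset A).
- move=> x _; apply: closedI => //; case: ifP => _; first exact: closed_le_fun.
  apply: closedI; first exact: closed_le_fun.
  by apply: closed_eq_fun; [exact: bary_fst_continuous|exact: minc_fst_continuous].
- move=> x xc; rewrite /A; case: (eqVneq x (v c)) => [_|xv].
    apply: (@cont_on_eq _ _ _ ((fun u => step i u.1 u.2) \o (fun u => (u.1, tau i u.2)))).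
      by move=> [p t] [_ /= h]; rewrite flow_early.
    apply: (@cont_on_comp _ _ _ _ (simp c `*` uniti R)).
    + by move=> [p t] [[/= sp tu] _]; split => //; exact: tau_unit.
    + apply: cont_on_pair; first by apply: continuous_cont_on => u; exact: cvg_fst.
      apply: continuous_cont_on => u.
      apply: (@continuous_comp (K * R)%type R R snd (tau i)); first exact: cvg_snd.
      exact: tau_continuous.
    by apply: step_cont => //; rewrite rj.
  have xD : x \in (c `\ v c)%fset by move: xc; rewrite !inE (negPf xv).
  have [h1 n1 r1] := rank_drop hc nc xD; rewrite rj in r1.
  apply: (@cont_on_eq _ _ _ ((fun u => flow i u.1 u.2) \o (fun u => (step i u.1 1, u.2)))).
    by move=> [p t] [_ [/= h _]]; rewrite tau1.
  have u1 : uniti R 1 by rewrite /uniti /= in_itv /= ler01 lexx.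
  apply: (cont_on_comp _ _ (IH _ h1 n1 r1)).
    move=> [p t] [[/= sp tu] [_ e]]; split => //=; exact: (step_end hc nc rj sp xD e).
  apply: cont_on_pair; last by apply: continuous_cont_on => u; exact: cvg_snd.
  apply: (@cont_on_comp _ _ _ _ (simp c `*` uniti R) (fun u => (u.1, 1)) (fun u => step i u.1 u.2)).
  + by move=> [p t] [[/= sp tu] _].
  + by apply: cont_on_pair; apply: continuous_cont_on => u; [exact: cvg_fst|exact: cvg_cst].
  by apply: step_cont => //; rewrite rj.
move=> [p t] [/= sp tu]; have [h|h] := leP (2 ^+ i.+1 * t) 1.
  by exists (v c); [rewrite /= fset1U1|split => //; rewrite eqxx].
have [x xD e] := minc_attained p D0.
have /[!inE]/andP[xv xc] := xD.
exists x; first by rewrite /= !inE xc orbT.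
by split => //; rewrite (negPf xv); split => //=; exact: ltW.
Qed.

Lemma noncrit0 : ~~ crit fset0.
Proof.
have h : chainf (fset0 : {fset T}) by move=> x y; rewrite inE.
by apply/negP => /(crit_max h) /(_ (fsubset_refl _)) []; rewrite cardfs0.
Qed.

(** The empty chain is noncritical and hence matched with a single vertex; this vertex is the point
    to which everything collapses. *)
Lemma base_exists : exists p0 : K, simp [fset v fset0]%fset p0.
Proof.
have h : chainf (fset0 : {fset T}) by move=> x y; rewrite inE.
have [||||p0 e] := @mk_point R _ T [fset v fset0]%fset (fun x => (x == v fset0)%:R).
- by have := tog_chain h noncrit0; rewrite fsetU0.
- by move=> x; exact: ler0n.
- by move=> x; rewrite inE => /negPf ->.
- by rewrite big_seq_fset1 eqxx.
by exists p0 => x; rewrite e inE => /negPf ->.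
Qed.

Lemma simp1_uniq (x : T) p q : simp [fset x]%fset p -> simp [fset x]%fset q -> p = q.
Proof.
move=> sp sq; apply: val_inj; apply: funext => y; have [->|yx] := eqVneq y x.
  by have := point_sum sp; have := point_sum sq; rewrite !big_seq_fset1 => -> ->.
by rewrite sp ?sq // inE.
Qed.

(** From time 1/2 on all pushes are complete, including that of rank 0. Each real push lowers the
    rank, and the only simplex that is not moved is the vertex matched with the empty chain. *)
Lemma flow_late i p p0 t : noncrit p -> (r (supp p) < i)%N -> simp [fset v fset0]%fset p0 ->
  2^-1 <= t -> flow i p t = p0.
Proof.
move=> + + sp0 t2; elim: i p => //= i IH p np.
have hs := @chainf_supp _ _ _ p; have ss := @simp_supp _ _ _ p.
have -> : tau i t = 1.
  apply: tau1; have h : 1 <= 2 * t by rewrite -ler_pdivrMl // mulr1.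
  rewrite exprSr -mulrA; apply: le_trans h _; rewrite ler_peMl //.
    by rewrite mulr_ge0 // (le_trans _ t2).
  by rewrite exprn_ege1 // ler1n.
rewrite ltnS leq_eqVlt => /predU1P[rj|lt]; last first.
  by rewrite (step_lt _ hs np lt ss); exact: IH.
set c := supp p in rj hs ss; have [D0|D0] := eqVneq (c `\ v c)%fset fset0.
  rewrite (step_fix _ _ hs np ss D0) (flow_fix _ _ hs np ss D0).
  have [||_ e _] := @togP c fset0 hs np; [by rewrite D0|by apply/fsubsetP => y; rewrite inE|].
  apply: simp1_uniq sp0; apply: simp_sub ss; rewrite e.
  apply/fsubsetP => x xc; rewrite inE; apply: contraT => xv.
  by have := in_fset0 x; rewrite -D0 in_fsetD1 xv xc.
have [x xD e] := minc_attained p D0.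
have [h1 n1 r1] := rank_drop hs np xD; rewrite rj in r1.
have s1 := step_end hs np rj ss xD (esym e).
have n2 := noncrit_simp h1 n1 s1; apply: IH => //.
apply: leq_ltn_trans r1; by have [] := rank_mono h1 n2 n1 ((simpP _ _).1 s1).
Qed.

Lemma collapse : exists (H : K * R -> K) (p0 : K),
  [/\ forall c, chainf c -> ~~ crit c -> cont_on (simp c `*` uniti R) H,
      forall p, noncrit p -> H (p, 0) = p,
      forall p t, noncrit p -> noncrit (H (p, t)),
      forall p t, noncrit p -> 2^-1 <= t -> H (p, t) = p0 &
      noncrit p0].
Proof.
have [p0 s0] := base_exists; exists (fun u => flow (r (supp u.1)).+1 u.1 u.2), p0; split.
- move=> c hc nc; apply: cont_on_eq (flow_cont hc nc (ltnSn _)) => -[p t] [/= sp _].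
  have sc := (simpP c p).1 sp; have np := noncrit_sub sc hc nc.
  by rewrite -[RHS](@flow_stable (r c).+1) // ltnS; have [] := rank_mono hc np nc sc.
- by move=> p np; apply: flow_early; rewrite mulr0 ler01.
- by move=> p t np; exact: flow_noncrit.
- by move=> p t np t2; exact: flow_late.
have h : chainf (fset0 : {fset T}) by move=> x y; rewrite inE.
have [n1 _ _] := upper_noncrit h noncrit0; have := tog_chain h noncrit0.
by rewrite fsetU0 in n1 * => h1; exact: noncrit_simp s0.
Qed.

End Collapse.

Lemma cont_on_cover2 (X Y : topologicalType) (A B C : set X) (f : X -> Y) :
  closed A -> closed B -> cont_on A f -> cont_on B f -> C `<=` A `|` B -> cont_on C f.
Proof.
move=> cA cB fA fB CAB.
apply: (@cont_on_cover _ _ bool [fset true; false]%fset (fun e : bool => if e then A else B)).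
- by case.
- by case.
by move=> x /CAB [?|?]; [exists true|exists false]; rewrite //= !inE.
Qed.

(** * Critical simplices *)

Section Cells.
Context {R : realType} {disp : Order.disp_t} {T : porderType disp}.
Local Notation K := (realization R T).
Implicit Types (p : K) (c : {fset T}) (t : R).
Variable p0 : K.

Definition toP c (f : T -> R) : K :=
  if pselect (exists q : K, val q = fun x => if x \in c then f x else 0) is left h
  then projT1 (cid h) else p0.

Definition bary_valid c (f : T -> R) := (forall x, x \in c -> 0 <= f x) /\ \sum_(x <- c) f x = 1.

Lemma toPE c f : chainf c -> bary_valid c f ->
  val (toP c f) = fun x => if x \in c then f x else 0.
Proof.
move=> hc [f0 f1]; rewrite /toP; case: pselect => [h|[]]; first exact: projT2 (cid h).
apply: (mk_point hc) => [x|x /negPf->//|]; first by case: ifP => // /f0.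
by rewrite -f1 big_seq [RHS]big_seq; apply: eq_bigr => x ->.
Qed.

Lemma simp_toP c f : chainf c -> bary_valid c f -> simp c (toP c f).
Proof. by move=> hc vf x /negPf xc; rewrite toPE // xc. Qed.

Lemma toP_id c p (f : T -> R) : chainf c -> simp c p -> (forall x, x \in c -> f x = val p x) ->
  toP c f = p.
Proof.
move=> hc sp fp; apply: val_inj; rewrite toPE //; last first.
  split; first by move=> x xc; rewrite fp // point_ge0.
  by rewrite -(point_sum sp) big_seq [RHS]big_seq; apply: eq_bigr.
by apply: funext => x; case: ifPn => [/fp //|/sp ->].
Qed.

Lemma toP_cont (Z : topologicalType) (A : set Z) c (f : Z -> T -> R) : chainf c ->
  (forall z, A z -> bary_valid c (f z)) -> (forall x, x \in c -> cont_on A (fun z => f z x)) ->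
  cont_on A (fun z => toP c (f z)).
Proof.
move=> hc vf cf z Az; apply: (@cvg_point _ _ _ _ _ _ _ _ _ hc).
- by apply: simp_toP => //; exact: vf.
- by rewrite near_withinE; apply: nearW => z' /vf; exact: simp_toP.
move=> x xc; rewrite toPE //; last exact: vf.
rewrite /= xc; apply: cvg_trans (cf x xc z Az); apply: near_eq_cvg.
by rewrite near_withinE; apply: nearW => z' /vf vz; rewrite toPE // xc.
Qed.

Variables (crit : {fset T} -> bool) (d : nat).
Hypothesis crit_max : forall c c', chainf c' -> crit c -> (c `<=` c')%fset -> c' = c /\ #|` c| = d.+1.
Variable H : K * R -> K.
Hypothesis H_cont : forall c, chainf c -> ~~ crit c -> cont_on (simp c `*` uniti R) H.
Hypothesis H_0 : forall p, noncrit crit p -> H (p, 0) = p.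
Hypothesis H_noncrit : forall p t, noncrit crit p -> noncrit crit (H (p, t)).
Hypothesis H_late : forall p t, noncrit crit p -> 2^-1 <= t -> H (p, t) = p0.
Hypothesis p0_noncrit : noncrit crit p0.

Definition bar : R := d.+1%:R^-1.
(* [gauge] is [0] on the boundary of a critical simplex and [1] at its barycentre.  For
   [t <= 2 gauge] the point is pushed radially outwards; the boundary point [rad] it reaches
   then follows [H]. *)
Definition gauge c p : R := d.+1%:R * minc c p.
Definition rad c p (x : T) : R := (val p x - minc c p) / (1 - gauge c p).
Definition stretch p t (x : T) : R := bar + (val p x - bar) / (1 - t / 2).

Definition Gc c (u : K * R) : K :=
  if u.2 <= 2 * gauge c u.1 then toP c (stretch u.1 u.2) else H (toP c (rad c u.1), u.2 - 2 * gauge c u.1).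
Definition G (u : K * R) : K := if crit (supp u.1) then Gc (supp u.1) u else H u.

Lemma gauge_fst_continuous c : continuous (fun u : K * R => gauge c u.1).
Proof. by move=> u; apply: cvgM; [exact: cvg_cst|exact: (@minc_fst_continuous R disp T c u)]. Qed.

Lemma gauge_ge0 c p : 0 <= gauge c p.
Proof. by rewrite mulr_ge0 // minc_ge0. Qed.

Lemma dS0 : d.+1%:R != 0 :> R. Proof. by rewrite pnatr_eq0. Qed.

Lemma minc_gauge c p : minc c p = bar * gauge c p.
Proof. by rewrite /gauge mulrA mulVf ?mul1r // dS0. Qed.

Section CritCell.
Variable c : {fset T}.
Hypotheses (hc : chainf c) (cc : crit c).

Lemma card_crit : #|` c| = d.+1.
Proof. by case: (crit_max hc cc (fsubset_refl c)). Qed.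

Lemma crit_nonempty : c != fset0.
Proof. by rewrite -cardfs_gt0 card_crit. Qed.

Lemma sum_const (a : R) : \sum_(x <- c) a = d.+1%:R * a.
Proof. by rewrite big_const_seq count_predT iter_addr_0 mulr_natl -card_crit. Qed.

Lemma gauge_le1 p : simp c p -> gauge c p <= 1.
Proof.
move=> sp; rewrite -(point_sum sp) /gauge -sum_const big_seq [leRHS]big_seq.
by apply: ler_sum => x; exact: minc_le.
Qed.

Lemma face_noncrit x : x \in c -> chainf (c `\ x)%fset /\ ~~ crit (c `\ x)%fset.
Proof.
move=> xc; have s : (c `\ x `<=` c)%fset by exact: fsubD1set.
split; first exact: chainf_sub hc.
by apply/negP => /(crit_max hc) /(_ s) [/fsetP /(_ x)]; rewrite !inE eqxx xc.
Qed.

Lemma supp_crit p : simp c p -> crit (supp p) -> supp p = c.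
Proof. by move=> /simpP s /(crit_max hc) /(_ s) []. Qed.

Lemma supp_noncrit p : simp c p -> ~~ crit (supp p) -> gauge c p = 0.
Proof.
move=> sp ns; have [h|] := boolP (c `<=` supp p)%fset.
  by case/negP: ns; rewrite (_ : supp p = c) //; apply/eqP; rewrite eqEfsubset h andbT; apply/simpP.
case/fsubsetPn => x xc; rewrite in_supp negbK => /eqP x0.
by rewrite /gauge (_ : minc c p = 0) ?mulr0 //; apply/le_anti; rewrite minc_ge0 -x0 minc_le.
Qed.

Lemma gauge0_noncrit p : simp c p -> gauge c p = 0 -> noncrit crit p.
Proof.
move=> sp /eqP; rewrite mulf_eq0 (negPf dS0) /= => /eqP m0.
have [x xc e] := minc_attained p crit_nonempty; apply/negP => /(supp_crit sp) e'.
by have := in_supp p x; rewrite e' xc -e m0 eqxx.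
Qed.

Lemma valid_rad p : simp c p -> gauge c p < 1 -> bary_valid c (rad c p).
Proof.
move=> sp m1; split=> [x xc|]; first by rewrite divr_ge0 ?subr_ge0 ?minc_le // ltW.
by rewrite -mulr_suml big_split /= (point_sum sp) sum_const mulrN -/(gauge c p) divff // subr_eq0 gt_eqF.
Qed.

Lemma valid_stretch p t : simp c p -> uniti R t -> t <= 2 * gauge c p -> bary_valid c (stretch p t).
Proof.
rewrite /uniti /= in_itv /= => sp /andP[t0 t1] tm.
have k0 : 0 < 1 - t / 2 by lra.
split=> [x xc|]; last first.
  rewrite big_split /= -mulr_suml big_split /= (point_sum sp) !sum_const /bar mulrN divff ?dS0 //.
  by rewrite subrr mul0r addr0.
have mx := minc_le p xc; rewrite minc_gauge in mx.
have b0 : 0 < bar by rewrite invr_gt0 ltr0n.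
rewrite /stretch -[X in 0 <= X + _](mulfK (lt0r_neq0 k0)) -mulrDl divr_ge0 //; last exact: ltW.
have : bar * (t / 2) <= bar * gauge c p by rewrite ler_pM2l //; lra.
by rewrite mulrBr mulr1; lra.
Qed.

Lemma rad_face p x : simp c p -> gauge c p < 1 -> val p x = minc c p -> x \in c ->
  simp (c `\ x)%fset (toP c (rad c p)).
Proof.
move=> sp m1 e xc y; rewrite (toPE hc (valid_rad sp m1)) !inE negb_and negbK.
by case/orP=> [/eqP->|/negPf->//]; rewrite xc /rad e subrr mul0r.
Qed.

Lemma rad_noncrit p : simp c p -> gauge c p < 1 -> noncrit crit (toP c (rad c p)).
Proof.
move=> sp m1; have [x xc e] := minc_attained p crit_nonempty.
have [h n] := face_noncrit xc.
exact: (noncrit_simp crit_max h n (rad_face sp m1 (esym e) xc)).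
Qed.

(** On the boundary of the cell the gauge is zero and [rad] is the identity, so [Gc] agrees there
    with [H] and one formula covers the closed simplex. *)
Lemma GE p t : simp c p -> uniti R t -> G (p, t) = Gc c (p, t).
Proof.
move=> sp tu; rewrite /G /=; case: ifPn => [/(supp_crit sp) -> //|ns].
have m0 := supp_noncrit sp ns; rewrite /Gc /= m0 mulr0 subr0.
have id1 : toP c (rad c p) = p.
  by apply: toP_id => // x xc; rewrite /rad minc_gauge m0 mulr0 !subr0 divr1.
rewrite id1; case: ifP => // t0; have -> : t = 0.
  by move: tu; rewrite /uniti /= in_itv /= => /andP[t0' _]; apply/le_anti; rewrite t0.
rewrite H_0 //; apply/esym/toP_id => // x xc.
by rewrite /stretch mul0r subr0 divr1 addrC subrK.
Qed.

(** At [t = 2 * gauge c p] the radial stretch has just reached the boundary, at the point [rad]; the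
    two branches of [Gc] therefore agree. *)
Lemma Gc_eq p : simp c p -> gauge c p < 1 ->
  toP c (stretch p (2 * gauge c p)) = H (toP c (rad c p), 0).
Proof.
move=> sp m1; rewrite H_0; last exact: rad_noncrit.
congr toP; apply: funext => x; rewrite /stretch /rad minc_gauge.
have k : 1 - gauge c p != 0 by rewrite subr_eq0 gt_eqF.
by field.
Qed.

Lemma Gc_cont : cont_on (simp c `*` uniti R) (Gc c).
Proof.
have cP := @closed_prism R disp T c.
have c2 : continuous (fun u : K * R => 2 * gauge c u.1).
  by move=> u; apply: cvgM; [exact: cvg_cst|exact: (@gauge_fst_continuous c u)].
have csnd : continuous (fun u : K * R => u.2) by move=> u; exact: cvg_snd.
pose A1 := (simp c `*` uniti R) `&` [set u : K * R | u.2 <= 2 * gauge c u.1].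
pose A2 := (simp c `*` uniti R) `&` [set u : K * R | 2 * gauge c u.1 <= u.2].
have half1 (t : R) : uniti R t -> 1 - t / 2 != 0.
  by rewrite /uniti /= in_itv /= => /andP[t0 t1]; apply/eqP; lra.
have cA1 : closed A1 by apply: closedI => //; exact: closed_le_fun.
have cA2 : closed A2 by apply: closedI => //; exact: closed_le_fun.
apply: (@cont_on_cover2 _ _ A1 A2) => //.
- apply: (@cont_on_eq _ _ _ (fun u => toP c (stretch u.1 u.2))).
    by move=> [p t] [[/= sp tu] h]; rewrite /Gc /= h.
  apply: toP_cont => // [[p t] [[/= sp tu] h]|x xc]; first exact: valid_stretch.
  move=> [p t] [[/= sp tu] _]; apply: cvg_within_filter.
  apply: cvgD; first exact: cvg_cst.
  apply: cvgM.
    by apply: cvgB; [exact: (@bary_fst_continuous R disp T x (p, t))|exact: cvg_cst].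
  apply: cvgV; first exact: half1.
  apply: cvgB; first exact: cvg_cst.
  by apply: cvgM; [exact: (csnd (p, t))|exact: cvg_cst].
- have hm p t : uniti R t -> 2 * gauge c p <= t -> gauge c p < 1.
    by rewrite /uniti /= in_itv /= => /andP[t0 t1] h; lra.
  apply: (@cont_on_eq _ _ _ (fun u => H (toP c (rad c u.1), u.2 - 2 * gauge c u.1))).
    move=> [p t] [[/= sp tu] h]; rewrite /Gc /=; case: ifP => // h'.
    have e : t = 2 * gauge c p by apply/le_anti; rewrite h h'.
    by rewrite e Gc_eq ?subrr // (hm p t).
  (* [H] is known to be continuous only on noncritical simplices, so the boundary is treated face by
     face, according to where the minimum is attained. *)
  apply: (@cont_on_cover _ _ T c (fun x => A2 `&` [set u : K * R | val u.1 x = minc c u.1])).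
  + move=> x xc; apply: closedI => //.
    by apply: closed_eq_fun; [exact: bary_fst_continuous|exact: minc_fst_continuous].
  + move=> x xc; have [h n] := face_noncrit xc.
    apply: (cont_on_comp _ _ (H_cont h n)).
      move=> [p t] [[[/= sp tu] le] e] /=; split; first by apply: rad_face => //; exact: hm le.
      move: tu; rewrite /uniti /= !in_itv /= => /andP[t0 t1]; have := gauge_ge0 c p; lra.
    apply: cont_on_pair; last first.
      by apply: continuous_cont_on => u; apply: cvgB; [exact: (csnd u)|exact: (c2 u)].
    apply: toP_cont => // [[p t] [[[/= sp tu] le] e]|y yc].
      by apply: valid_rad => //; exact: hm le.
    move=> [p t] [[[/= sp tu] le] e]; apply: cvg_within_filter; apply: cvgM.
      by apply: cvgB; [exact: (@bary_fst_continuous R disp T y (p, t))|exact: (@minc_fst_continuous R disp T c (p, t))].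
    apply: cvgV; first by rewrite subr_eq0 gt_eqF // (hm p t).
    by apply: cvgB; [exact: cvg_cst|exact: (@gauge_fst_continuous c (p, t))].
  move=> [p t] [[/= sp tu] le]; have [x xc e] := minc_attained p crit_nonempty.
  by exists x => //; split => //; split.
move=> [p t] [/= sp tu]; have [h|/ltW h] := leP t (2 * gauge c p); [left|right]; split => //.
Qed.

End CritCell.

Lemma G_cont c : chainf c -> cont_on (simp c `*` uniti R) G.
Proof.
move=> hc; have [cc|nc] := boolP (crit c).
  by apply: cont_on_eq (Gc_cont hc cc) => -[p t] [/= sp tu]; rewrite (GE hc cc).
apply: cont_on_eq (H_cont hc nc) => -[p t] [/= sp tu]; rewrite /G /=.
by have /negPf -> : ~~ crit (supp p) by apply: (noncrit_simp crit_max hc nc).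
Qed.

Lemma G_homotopy : {within [set: K] `*` uniti R, continuous G}.
Proof. by apply: realization_homotopy => c; exact: G_cont. Qed.

Lemma G_0 p : G (p, 0) = p.
Proof.
rewrite /G /=; case: ifPn => [cc|]; last exact: H_0.
rewrite /Gc /= mulr_ge0 ?gauge_ge0 //; apply: toP_id.
- exact: chainf_supp.
- exact: simp_supp.
by move=> x _; rewrite /stretch mul0r subr0 divr1 addrC subrK.
Qed.

(** The time left after reaching the boundary is [1 - 2 * gauge c p], at least 1/2, and by then [H]
    has reached [p0]. *)
Lemma G_1 c p : chainf c -> crit c -> simp c p -> 4 * gauge c p <= 1 -> G (p, 1) = p0.
Proof.
move=> hc cc sp h; have g0 := gauge_ge0 c p.
rewrite (GE hc cc) //; last by rewrite /uniti /= in_itv /= ler01 lexx.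
rewrite /Gc /=; have -> : (1 <= 2 * gauge c p) = false by apply/negbTE; rewrite -ltNge; lra.
by apply: H_late; [apply: rad_noncrit => //; lra|lra].
Qed.

End Cells.

Section SubtypeTopology.

Lemma cvg_set_type (X : topologicalType) (A : set X) (Z : Type) (F : set_system Z) (g : Z -> A) (l : A) :
  Filter F -> (fun z => val (g z)) @ F --> val l -> g @ F --> l.
Proof.
move=> FF h U; rewrite nbhsE => -[U1 [[W oW WU] Ul] UU].
have : nbhs (val l) W by apply: open_nbhs_nbhs; split => //; move: Ul; rewrite -WU.
move=> /h hW; change (F (fun z => W (val (g z)))) in hW; change (F (fun z => U (g z))).
apply: filterS hW => z Wz; apply: UU; rewrite -WU; exact: Wz.
Qed.

Lemma val_continuous (X : topologicalType) (A : set X) : continuous (fun x : A => val x).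
Proof. exact: initial_continuous. Qed.

Lemma cvg_rV (R : realType) m (Z : Type) (F : set_system Z) (g : Z -> 'rV[R]_m) (l : 'rV[R]_m) :
  Filter F -> (forall i, g z 0 i @[z --> F] --> l 0 i) -> g @ F --> l.
Proof.
move=> FF h U [P hP PU].
have : F (\bigcap_(i in [set` [fset i in 'I_m]%fset]) [set z | P 0 i (g z 0 i)]).
  by apply: filter_bigI => i _; apply: (h i); exact: hP.
move=> hF; change (F (fun z => U (g z))); apply: filterS hF => z hz; apply: PU => i j; rewrite ord1; apply: hz => /=.
by rewrite !inE.
Qed.

End SubtypeTopology.

(** * The equivalence with the bouquet *)

Section Stereographic.
Context {R : realType} (d : nat).
Implicit Types (a : 'I_d.+1 -> R) (m t : R) (z : 'rV[R]_d.+1).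

(** Index 0 is omitted because the vectors of interest have coordinate sum zero; the other
    coordinates identify their hyperplane with a [d]-dimensional space. *)
Definition sqn a : R := \sum_(i < d) a (lift ord0 i) ^+ 2.

(* Stereographic parametrisation: the ray through [a] and [m] determines a point, [m = 0] giving
   the base point. *)
Definition Phi a m : 'rV[R]_d.+1 := \row_i
  (if i == ord0 then (sqn a - m ^+ 2) / (sqn a + m ^+ 2) else 2 * m * a i / (sqn a + m ^+ 2)).

Lemma Phi0 a m : Phi a m 0 ord0 = (sqn a - m ^+ 2) / (sqn a + m ^+ 2).
Proof. by rewrite mxE eqxx. Qed.

Lemma PhiS a m i : Phi a m 0 (lift ord0 i) = 2 * m * a (lift ord0 i) / (sqn a + m ^+ 2).
Proof. by rewrite mxE. Qed.

Lemma sqn_ge0 a : 0 <= sqn a.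
Proof. by apply: sumr_ge0 => i _; exact: sqr_ge0. Qed.

Lemma Phi_sphere a m : sqn a + m ^+ 2 != 0 -> sphere R d (Phi a m).
Proof.
move=> k0; rewrite /sphere /= big_ord_recl Phi0.
rewrite (eq_bigr (fun i => (2 * m / (sqn a + m ^+ 2)) ^+ 2 * a (lift ord0 i) ^+ 2)).
  by rewrite -mulr_sumr -/(sqn a); field.
by move=> i _; rewrite PhiS -exprMn; congr (_ ^+ 2); rewrite mulrAC.
Qed.

Lemma Phi_base a : sqn a != 0 -> Phi a 0 = sphere_base R d.
Proof.
move=> a0; apply/rowP => i; rewrite !mxE eqxx /= expr0n /= subr0 addr0.
by case: eqVneq => _; rewrite ?divff // mulr0 mul0r mul0r.
Qed.

Lemma sqnM a k : sqn (fun i => k * a i) = k ^+ 2 * sqn a.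
Proof. by rewrite /sqn mulr_sumr; apply: eq_bigr => i _; rewrite exprMn. Qed.

Lemma Phi_scale a m k : k != 0 -> Phi (fun i => k * a i) (k * m) = Phi a m.
Proof.
move=> k0; apply/rowP => i; rewrite !mxE sqnM exprMn -mulrDr.
have k2 : k ^+ 2 != 0 by rewrite expf_neq0.
case: eqVneq => _; first by rewrite -mulrBr -mulf_div divff // mul1r.
have -> : 2 * (k * m) * (k * a i) = k ^+ 2 * (2 * m * a i) by ring.
by rewrite -mulf_div divff // mul1r.
Qed.

Definition tang z (i : 'I_d.+1) : R := if i == ord0 then - \sum_(j < d) z 0 (lift ord0 j) else z 0 i.
Definition hgt z : R := 1 - z 0 ord0.

Lemma tangS z j : tang z (lift ord0 j) = z 0 (lift ord0 j). Proof. by []. Qed.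

Lemma tang_sum z : \sum_i tang z i = 0.
Proof. by rewrite big_ord_recl /tang eqxx addNr. Qed.

Lemma sqn_tang z : sphere R d z -> sqn (tang z) = hgt z * (1 + z 0 ord0).
Proof.
rewrite /sphere /= big_ord_recl -/(sqn (z 0)) => e; rewrite /sqn /hgt.
under eq_bigr do rewrite tangS.
by rewrite -/(sqn (z 0)); lra.
Qed.

Lemma hgt_ge0 z : sphere R d z -> 0 <= hgt z <= 2.
Proof.
rewrite /sphere /= big_ord_recl -/(sqn (z 0)) => e; have := sqn_ge0 (z 0) => s.
have h : z 0 ord0 ^+ 2 <= 1 by lra.
have : `|z 0 ord0| <= 1 by rewrite -(@ler_pXn2r R 2) ?nnegrE // real_normK ?num_real // expr1n.
by rewrite ler_norml /hgt => /andP[h1 h2]; lra.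
Qed.

Lemma hgt0 z : sphere R d z -> hgt z = 0 -> z = sphere_base R d.
Proof.
move=> sz h0; have e0 : z 0 ord0 = 1 by move: h0; rewrite /hgt; lra.
have := sqn_tang sz; rewrite h0 mul0r => /eqP.
rewrite psumr_eq0 => [/allP h|i _]; last exact: sqr_ge0.
apply/rowP => i; rewrite !mxE eqxx /=; case: (unliftP ord0 i) => [j ->|->]; last by rewrite e0 eqxx.
have := h j (mem_index_enum _); rewrite tangS sqrf_eq0 => /eqP ->.
by rewrite eq_sym eq_liftF.
Qed.

Lemma hgt_base : hgt (sphere_base R d) = 0.
Proof. by rewrite /hgt /sphere_base mxE !eqxx subrr. Qed.

Lemma Phi_tang z : sphere R d z -> hgt z != 0 -> Phi (tang z) (hgt z) = z.
Proof.
move=> sz h0; apply/rowP => i; rewrite !mxE sqn_tang //.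
have -> : hgt z * (1 + z 0 ord0) + hgt z ^+ 2 = 2 * hgt z by rewrite /hgt; ring.
have -> : hgt z * (1 + z 0 ord0) - hgt z ^+ 2 = 2 * hgt z * z 0 ord0 by rewrite /hgt; ring.
have k0 : 2 * hgt z != 0 by rewrite mulf_neq0 ?pnatr_eq0.
rewrite /tang; case: eqVneq => [->|_]; first by rewrite [2 * _ * _]mulrC mulfK.
by rewrite [2 * _ * _]mulrC mulfK.
Qed.

Definition mina a : R := \big[Num.min/0]_i a i.
(** The scale for which [tang z / level z] is the displacement from the barycentre of a point of
    gauge [hgt z / level z]; it solves the relation between gauge and least displacement stated in
    [gauge_tvec]. *)
Definition level z : R := hgt z - d.+1%:R * mina (tang z).

Lemma mina_le0 a : mina a <= 0.
Proof. by rewrite /mina; elim/big_rec: _ => // i x _ h; rewrite ge_min h orbT. Qed.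

Lemma mina_le a i : mina a <= a i.
Proof.
rewrite /mina -(big_filter_cond (index_enum _) xpredT) filter_predT.
elim: (index_enum _) (mem_index_enum i) => //= j s IH.
by rewrite inE big_cons ge_min => /predU1P[<-|/IH ->]; rewrite ?lexx ?orbT.
Qed.

Lemma mina_attained a : \sum_i a i = 0 -> exists i, mina a = a i.
Proof.
move=> s0; have [//|ne] := pselect (exists i, mina a = a i).
have m0 : mina a = 0 \/ exists i, mina a = a i.
  rewrite /mina; elim/big_rec: _ => [|i x _ [->|[j ->]]]; first by left.
    by have [h|h] := leP (a i) 0; [right; exists i|left].
  by have [h|h] := leP (a i) (a j); right; [exists i|exists j].
case: m0 => // m0; exists ord0; rewrite m0; apply/esym/le_anti.
have := mina_le a ord0; rewrite m0 => ->; rewrite andbT -s0 big_ord_recl lerDl.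
by apply: sumr_ge0 => i _; have := mina_le a (lift ord0 i); rewrite m0.
Qed.

Lemma minaM a k : 0 <= k -> mina (fun i => k * a i) = k * mina a.
Proof.
move=> k0; rewrite /mina (big_morph (fun x => k * x) (id1 := 0) (op1 := Num.min)) ?mulr0 //.
by move=> x y; rewrite minr_pMr.
Qed.

(** The coordinates sum to zero, so a positive one is balanced by [d] others, none of which is below
    the minimum. *)
Lemma tang_bound z (j : 'I_d) : sphere R d z ->
  `|tang z (lift ord0 j)| <= d%:R * (- mina (tang z)).
Proof.
move=> sz; set i := lift ord0 j; have m0 := mina_le0 (tang z); have mi := mina_le (tang z).
have d1 : (1 : R) <= d%:R by rewrite ler1n; case: (d) j {i mi m0 sz z} => // -[].
rewrite ler_norml; apply/andP; split.
  apply: le_trans (mi i); rewrite mulrN opprK ler_neMl //.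
have := tang_sum z; rewrite (bigD1 i) //= => /eqP; rewrite addr_eq0 => /eqP ->.
rewrite -sumrN; apply: (@le_trans _ _ (\sum_(k < d.+1 | k != i) - mina (tang z))).
  by apply: ler_sum => k _; rewrite lerN2.
by rewrite sumr_const mulr_natl; rewrite cardC1 card_ord.
Qed.

Lemma level_ge z : sphere R d z -> hgt z <= level z.
Proof. by move=> sz; rewrite /level lerDl oppr_ge0 mulr_ge0_le0 ?ler0n ?mina_le0. Qed.

Lemma level_gt0 z : sphere R d z -> hgt z != 0 -> 0 < level z.
Proof.
move=> sz h0; apply: lt_le_trans (level_ge sz); rewrite lt_neqAle eq_sym h0.
by have /andP[] := hgt_ge0 sz.
Qed.

(* Near the base point [hgt z] is quadratic, and [level z] linear, in [tang z]. *)
Lemma level_near_base z : sphere R d z -> 0 <= z 0 ord0 ->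
  4 * d%:R * (\sum_(i < d) `|z 0 (lift ord0 i)|) <= 1 -> 4 * hgt z <= level z.
Proof.
move=> sz z0 h; have := sqn_tang sz; have /andP[b0 _] := hgt_ge0 sz => e.
have m0 := mina_le0 (tang z).
have : sqn (tang z) <= (\sum_(i < d) `|z 0 (lift ord0 i)|) * (d%:R * (- mina (tang z))).
  rewrite mulr_suml; apply: ler_sum => i _; rewrite -real_normK ?num_real // expr2 tangS.
  by rewrite ler_wpM2l // -tangS tang_bound.
set S := \sum_(i < d) _ in h *; set k := - mina _ => le.
have k0 : 0 <= k by rewrite oppr_ge0.
have h1 : hgt z <= S * (d%:R * k) by apply: le_trans le; rewrite e ler_peMr // lerDl.
have h2 : 4 * (S * (d%:R * k)) <= k.
  have -> : 4 * (S * (d%:R * k)) = 4 * d%:R * S * k by ring.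
  by rewrite -[leRHS]mul1r ler_wpM2r.
have h3 : k <= d.+1%:R * k by rewrite ler_peMl // ler1n.
have -> : level z = hgt z + d.+1%:R * k by rewrite /level /k mulrN.
lra.
Qed.

Section Limits.
Context (Z : Type) (F : set_system Z) {FF : Filter F}.

Lemma cvg_sumr (J : Type) (s : seq J) (g : J -> Z -> R) (l : J -> R) :
  (forall j, g j z @[z --> F] --> l j) -> \sum_(j <- s) g j z @[z --> F] --> \sum_(j <- s) l j.
Proof. by move=> h; apply: (@cvg_big R J +%R) => //; exact: add_continuous. Qed.

Lemma cvg_minr (J : Type) (s : seq J) (x0 : R) (g : J -> Z -> R) (l : J -> R) :
  (forall j, g j z @[z --> F] --> l j) ->
  \big[Num.min/x0]_(j <- s) g j z @[z --> F] --> \big[Num.min/x0]_(j <- s) l j.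
Proof. by move=> h; apply: (@cvg_big R J (fun x y : R => Num.min x y)) => //; exact: minr_continuous. Qed.

Lemma cvg_sqn (a : Z -> 'I_d.+1 -> R) l : (forall i, a z i @[z --> F] --> l i) ->
  sqn (a z) @[z --> F] --> sqn l.
Proof. by move=> h; apply: cvg_sumr => i; rewrite expr2; apply: cvgM; exact: h. Qed.

Lemma cvg_Phi (a : Z -> 'I_d.+1 -> R) l (m : Z -> R) m0 :
  (forall i, a z i @[z --> F] --> l i) -> m z @[z --> F] --> m0 -> sqn l + m0 ^+ 2 != 0 ->
  Phi (a z) (m z) @[z --> F] --> Phi l m0.
Proof.
move=> ha hm k0; have hs := cvg_sqn ha.
have hm2 : m z ^+ 2 @[z --> F] --> m0 ^+ 2 by rewrite expr2; apply: cvgM.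
have hV : (sqn (a z) + m z ^+ 2)^-1 @[z --> F] --> (sqn l + m0 ^+ 2)^-1.
  by apply: cvgV => //; exact: cvgD.
apply: cvg_rV => i; case: (unliftP ord0 i) => [j ->|->].
  rewrite PhiS; under eq_fun do rewrite PhiS.
  by apply: cvgM => //; apply: cvgM => //; apply: cvgM => //; exact: cvg_cst.
rewrite Phi0; under eq_fun do rewrite Phi0.
by apply: cvgM => //; apply: cvgB.
Qed.

Lemma cvg_mina (a : Z -> 'I_d.+1 -> R) l : (forall i, a z i @[z --> F] --> l i) ->
  mina (a z) @[z --> F] --> mina l.
Proof. exact: cvg_minr. Qed.

Variables (w : Z -> 'rV[R]_d.+1) (w0 : 'rV[R]_d.+1).
Hypothesis ww : w z @[z --> F] --> w0.

Lemma cvg_coord i : w z 0 i @[z --> F] --> w0 0 i.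
Proof. by apply: (cvg_comp _ (fun v : 'rV[R]_d.+1 => v 0 i) ww); exact: coord_continuous. Qed.

Lemma cvg_tang i : tang (w z) i @[z --> F] --> tang w0 i.
Proof.
rewrite /tang; case: eqVneq => _; last exact: cvg_coord.
by apply: cvgN; apply: cvg_sumr => j; exact: cvg_coord.
Qed.

Lemma cvg_hgt : hgt (w z) @[z --> F] --> hgt w0.
Proof. by apply: cvgB; [exact: cvg_cst|exact: cvg_coord]. Qed.

Lemma cvg_level : level (w z) @[z --> F] --> level w0.
Proof.
apply: cvgB; first exact: cvg_hgt.
by apply: cvgM; [exact: cvg_cst|apply: cvg_mina; exact: cvg_tang].
Qed.

End Limits.

(** In simplex coordinates this lowers the gauge by [t / 2] along the same direction, just as
    [stretch] does up to scale, and sends small gauges to the base point. That point needs its own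
    clause because [Phi] has denominator zero there. *)
Definition shrink z t : 'rV[R]_d.+1 :=
  if hgt z == 0 then sphere_base R d else Phi (tang z) (Num.max 0 (hgt z - t / 2 * level z)).

(** The tangent vector vanishes only at the antipode of the base point, where [hgt z] and [level z]
    are both 2 and the second argument of [Phi] is [2 - t]. *)
Lemma shrink_ne0 z t : sphere R d z -> hgt z != 0 -> t <= 1 ->
  sqn (tang z) + Num.max 0 (hgt z - t / 2 * level z) ^+ 2 != 0.
Proof.
move=> sz h0 t1; have e := sqn_tang sz; have s0 := sqn_ge0 (tang z).
rewrite paddr_eq0 ?sqr_ge0 //; apply/negP => /andP[/eqP s1 /eqP /eqP]; rewrite sqrf_eq0 => m0.
have z1 : 1 + z 0 ord0 = 0.
  by apply/eqP; move/eqP: e; rewrite s1 eq_sym mulf_eq0 (negPf h0).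
have h2 : hgt z = 2 by rewrite /hgt; lra.
have t0 i : tang z i = 0.
  case: (unliftP ord0 i) => [j ->|->].
    apply/eqP; rewrite -sqrf_eq0; move/eqP: s1; rewrite psumr_eq0 => [|k _]; last exact: sqr_ge0.
    by move=> /allP /(_ j (mem_index_enum _)).
  rewrite /tang eqxx big1 ?oppr0 // => j _.
  apply/eqP; rewrite -sqrf_eq0; move/eqP: s1; rewrite psumr_eq0 => [|k _]; last exact: sqr_ge0.
  by move=> /allP /(_ j (mem_index_enum _)).
have [k ek] := mina_attained (tang_sum z); rewrite t0 in ek.
move: m0; rewrite /level ek h2 mulr0 subr0; have -> : 2 - t / 2 * 2 = 2 - t by field.
by rewrite max_r; [move=> /eqP; lra|lra].
Qed.

Lemma shrink_sphere z t : sphere R d z -> t <= 1 -> sphere R d (shrink z t).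
Proof.
move=> sz t1; rewrite /shrink; case: eqVneq => h0; first exact: sphere_base_in.
by apply/Phi_sphere/shrink_ne0.
Qed.

Lemma shrink_0 z : sphere R d z -> shrink z 0 = z.
Proof.
move=> sz; rewrite /shrink; case: eqVneq => [/(hgt0 sz)->//|h0].
by rewrite mul0r mul0r subr0 max_r ?Phi_tang //; have /andP[] := hgt_ge0 sz.
Qed.

(** A bound uniform in [t]: it gives continuity at the base point, where the formula degenerates. *)
Lemma shrink_base_dist z t : sphere R d z -> 0 <= z 0 ord0 -> 0 <= t <= 1 ->
  1 - 2 * hgt z <= shrink z t 0 ord0.
Proof.
move=> sz z0 /andP[t0 t1]; have /andP[b0 b2] := hgt_ge0 sz; rewrite /shrink.
case: eqVneq => [e|h0]; first by rewrite /sphere_base mxE eqxx e mulr0 subr0.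
set m := Num.max 0 _; have k0 := shrink_ne0 sz h0 t1; rewrite -/m in k0.
have m0 : 0 <= m by rewrite le_max lexx.
have L0 := level_gt0 sz h0.
have mh : m <= hgt z by rewrite ge_max b0 gerBl mulr_ge0 ?divr_ge0 // ltW.
rewrite Phi0; have e := sqn_tang sz; have s0 := sqn_ge0 (tang z).
have hp : 0 < hgt z by rewrite lt_neqAle eq_sym h0.
have kp : 0 < sqn (tang z) + m ^+ 2 by rewrite lt_neqAle eq_sym k0 addr_ge0 // sqr_ge0.
rewrite ler_pdivlMr // e.
have m2 : m ^+ 2 <= hgt z ^+ 2 by rewrite ler_pXn2r ?nnegrE.
have z00 : 0 <= hgt z * z 0 ord0 by rewrite mulr_ge0.
have : 0 <= hgt z * (hgt z * z 0 ord0) by rewrite mulr_ge0.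
have : 0 <= hgt z * m ^+ 2 by rewrite mulr_ge0 // sqr_ge0.
rewrite expr2 in m2 *; nra.
Qed.

Lemma sphere_coord_le z i : sphere R d z -> z 0 (lift ord0 i) ^+ 2 <= 2 * hgt z.
Proof.
move=> sz; have e := sqn_tang sz; have /andP[b0 b2] := hgt_ge0 sz.
apply: (@le_trans _ _ (sqn (tang z))).
  rewrite /sqn (bigD1 i) //= tangS lerDl; apply: sumr_ge0 => j _; exact: sqr_ge0.
by rewrite e [leRHS]mulrC ler_wpM2l //; rewrite /hgt in b0; lra.
Qed.

Lemma cvg_shrink (Z : Type) (F : set_system Z) (w : Z -> 'rV[R]_d.+1)
    (w0 : 'rV[R]_d.+1) (s : Z -> R) (s0 : R) :
  Filter F -> (\forall z \near F, sphere R d (w z) /\ 0 <= s z <= 1) -> sphere R d w0 ->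
  0 <= s0 <= 1 -> w z @[z --> F] --> w0 -> s z @[z --> F] --> s0 ->
  shrink (w z) (s z) @[z --> F] --> shrink w0 s0.
Proof.
move=> FF hF sw0 /andP[s00 s01] ww ss; rewrite {2}/shrink; case: eqVneq => [h0|h0]; last first.
  have : Phi (tang (w z)) (Num.max 0 (hgt (w z) - s z / 2 * level (w z))) @[z --> F] -->
     Phi (tang w0) (Num.max 0 (hgt w0 - s0 / 2 * level w0)).
    apply: cvg_Phi; [exact: cvg_tang| |exact: shrink_ne0].
    apply: (cvg_comp2 (cvg_cst _) _ (@maxr_continuous R (0, _))).
    apply: cvgB; first exact: cvg_hgt.
    apply: cvgM; last exact: cvg_level.
    by apply: cvgM => //; exact: cvg_cst.
  apply: cvg_trans; apply: near_eq_cvg.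
  have nb : nbhs (hgt w0) [set x | x != 0] by apply: open_nbhs_nbhs; split => //; exact: open_neq.
  have : \forall z \near F, hgt (w z) != 0 by exact: (cvg_hgt ww nb).
  by apply: filterS => z /negPf hz; rewrite /shrink hz.
have ew0 := hgt0 sw0 h0.
(* Near the base point all coordinates of a point of the sphere are controlled by [hgt], so making
   [hgt] of the image small is enough. *)
have near0 (e : R) : 0 < e -> \forall z \near F, hgt (w z) < e.
  move=> e0; have nb : nbhs (hgt w0) [set x | x < e].
    by apply: open_nbhs_nbhs; split; [exact: open_lt|rewrite /= h0].
  exact: (cvg_hgt ww nb).
have near1 (e : R) : 0 < e -> \forall z \near F, hgt (shrink (w z) (s z)) < e.
  move=> e0; have e2 : 0 < Num.min 1 (e / 2) by rewrite lt_min ltr01 divr_gt0.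
  apply: filterS2 hF (near0 _ e2) => z [sz /andP[t0 t1]]; rewrite lt_min => /andP[z1 z2].
  have z0 : 0 <= w z 0 ord0 by rewrite /hgt in z1; lra.
  by have := shrink_base_dist sz z0 (introT andP (conj t0 t1)); rewrite {1}/hgt in z2 *; rewrite /hgt; lra.
apply: cvg_rV => i; apply/cvgrPdist_lt => e e0; rewrite /sphere_base !mxE eqxx /=.
case: (unliftP ord0 i) => [j ->|->].
  have e2 : 0 < e ^+ 2 / 2 by rewrite divr_gt0 // exprn_gt0.
  apply: filterS2 hF (near1 _ e2) => z [sz /andP[t0 t1]] hz.
  rewrite [lift ord0 j == _]eq_sym eq_liftF sub0r normrN.
  rewrite ltNge; apply/negP => le; have := sphere_coord_le j (shrink_sphere sz t1).
  have : e ^+ 2 <= `|shrink (w z) (s z) 0 (lift ord0 j)| ^+ 2.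
    by rewrite ler_pXn2r ?nnegrE ?normr_ge0 //; exact: ltW.
  by rewrite real_normK ?num_real //; lra.
apply: filterS2 hF (near1 _ e0) => z [sz /andP[t0 t1]] hz.
rewrite eqxx -/(hgt _) ger0_norm //; by have /andP[] := hgt_ge0 (shrink_sphere sz t1).
Qed.

End Stereographic.

(** * Coordinates between a critical simplex and the sphere *)

Section CellCoordinates.
Context {R : realType} {disp : Order.disp_t} {T : porderType disp} (d : nat).
Local Notation K := (realization R T).
Implicit Types (p : K) (t : R) (z : 'rV[R]_d.+1).
Variables (x0 : T) (p0 : K) (c : {fset T}).
Hypotheses (hc : chainf c) (cd : #|` c| = d.+1).

Local Notation bar := (@bar R d).
Local Notation gauge := (gauge d).

Definition enu (i : 'I_d.+1) : T := nth x0 (enum_fset c) i.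
Definition rnk (x : T) : 'I_d.+1 := inord (index x (enum_fset c)).

Lemma enu_in i : enu i \in c.
Proof. by apply: mem_nth; have := ltn_ord i; rewrite -[X in (_ < X)%N]cd. Qed.

Lemma rnkK x : x \in c -> enu (rnk x) = x.
Proof.
move=> xc; rewrite /enu /rnk inordK ?nth_index //.
by rewrite -[X in (_ < X)%N]cd index_mem.
Qed.

Lemma enuK i : rnk (enu i) = i.
Proof.
apply: val_inj; rewrite /= inordK /enu index_uniq ?fset_uniq ?ltn_ord //;
by have := ltn_ord i; rewrite -[X in (_ < X)%N]cd.
Qed.

Lemma sum_enu (f : T -> R) : \sum_(x <- c) f x = \sum_i f (enu i).
Proof.
rewrite (big_nth x0) -[size _]/(#|` c|) cd big_mkord.
by [].
Qed.

Definition tvec p (i : 'I_d.+1) : R := val p (enu i) - bar.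

Lemma barS : d.+1%:R * bar = 1. Proof. by apply: divff; rewrite pnatr_eq0. Qed.

Lemma sum_tvec p : simp c p -> \sum_i tvec p i = 0.
Proof.
move=> sp; rewrite big_split /= -(sum_enu (val p)) (point_sum sp) sumr_const card_ord.
by rewrite -[_ *+ _]mulr_natl mulrN barS subrr.
Qed.

Lemma gauge_tvec p : simp c p -> gauge c p = 1 + d.+1%:R * mina (tvec p).
Proof.
move=> sp; have -> : gauge c p = d.+1%:R * minc c p by [].
rewrite -[X in X + _]barS -mulrDr; congr (_ * _).
have [k ek] := mina_attained (sum_tvec sp).
have c0 : c != fset0 by rewrite -cardfs_gt0 cd.
have [x xc ex] := minc_attained p c0.
apply/le_anti/andP; split.
  by rewrite ek /tvec addrC subrK minc_le // enu_in.
by have := mina_le (tvec p) (rnk x); rewrite ex /tvec rnkK // lerBrDl.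
Qed.

Lemma tvec_ne0 p : simp c p -> sqn (tvec p) + gauge c p ^+ 2 != 0.
Proof.
move=> sp; rewrite paddr_eq0 ?sqr_ge0 ?sqn_ge0 //; apply/negP => /andP[].
rewrite psumr_eq0 => [/allP h|i _]; last exact: sqr_ge0.
rewrite sqrf_eq0 => /eqP; rewrite gauge_tvec // => g0.
have tS j : tvec p (lift ord0 j) = 0.
  by apply/eqP; rewrite -sqrf_eq0; exact: (h j (mem_index_enum _)).
have t0 : tvec p ord0 = 0 by have := sum_tvec sp; rewrite big_ord_recl big1 ?addr0.
have [k ek] := mina_attained (sum_tvec sp).
move: g0; rewrite ek; suff -> : tvec p k = 0 by lra.
by case: (unliftP ord0 k) => [j ->|->].
Qed.

(** The inverse of the map given by [Phi], [tvec] and [gauge], away from the base point. *)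
Definition psi z (x : T) : R := bar + tang z (rnk x) / level z.

Lemma valid_psi z : sphere R d z -> hgt z != 0 -> bary_valid c (psi z).
Proof.
move=> sz h0; have L0 := level_gt0 sz h0; split=> [x xc|].
  have b0 : 0 < bar by rewrite invr_gt0 ltr0n.
  rewrite /psi -[X in 0 <= X + _](mulfK (lt0r_neq0 L0)) -mulrDl divr_ge0 //; last exact: ltW.
  have := mina_le (tang z) (rnk x); have /andP[h1 _] := hgt_ge0 sz.
  have -> : bar * level z = bar * hgt z - (d.+1%:R * bar) * mina (tang z) by rewrite /level; ring.
  rewrite barS mul1r => h.
  have : 0 <= bar * hgt z by rewrite mulr_ge0 // ltW.
  lra.
rewrite sum_enu big_split /= sumr_const card_ord -[_ *+ _]mulr_natl barS -mulr_suml.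
by under eq_bigr do rewrite enuK; rewrite tang_sum mul0r addr0.
Qed.

Lemma tvec_psi z : sphere R d z -> hgt z != 0 ->
  tvec (toP p0 c (psi z)) = fun i => (level z)^-1 * tang z i.
Proof.
move=> sz h0; apply: funext => i; rewrite /tvec (toPE _ hc (valid_psi sz h0)) enu_in.
by rewrite /psi enuK addrC addKr mulrC.
Qed.

Lemma simp_psi z : sphere R d z -> hgt z != 0 -> simp c (toP p0 c (psi z)).
Proof. by move=> sz h0; apply: simp_toP => //; exact: valid_psi. Qed.

Lemma gauge_psi z : sphere R d z -> hgt z != 0 -> gauge c (toP p0 c (psi z)) = hgt z / level z.
Proof.
move=> sz h0; have L0 := level_gt0 sz h0; rewrite gauge_tvec ?tvec_psi; try exact: simp_psi; try by [].
rewrite minaM ?invr_ge0 1?ltW // -[X in X + _](divff (lt0r_neq0 L0)) {1}/level.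
by rewrite mulrCA -[_^-1 * _]mulrC -mulrDl subrK.
Qed.

Lemma hgt_Phi p : simp c p -> hgt (Phi (tvec p) (gauge c p)) = 2 * gauge c p ^+ 2 / (sqn (tvec p) + gauge c p ^+ 2).
Proof. by move=> sp; rewrite /hgt Phi0; have := tvec_ne0 sp => k; field. Qed.

Lemma psi_Phi p : simp c p -> gauge c p != 0 -> toP p0 c (psi (Phi (tvec p) (gauge c p))) = p.
Proof.
move=> sp g0; have k := tvec_ne0 sp; set N := sqn _ + _ in k; set m := gauge c p in g0 k *.
have g1 : 0 <= m by exact: gauge_ge0.
have N0 : 0 < N by rewrite lt_neqAle eq_sym k addr_ge0 ?sqn_ge0 ?sqr_ge0.
set z := Phi _ _; have ez : tang z = fun i => (2 * m / N) * tvec p i.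
  apply: funext => i; case: (unliftP ord0 i) => [j ->|->].
    by rewrite tangS PhiS -/N mulrAC.
  rewrite /tang eqxx; under eq_bigr do rewrite PhiS -/N mulrAC.
  rewrite -mulr_sumr; have := sum_tvec sp; rewrite big_ord_recl => /eqP; rewrite addr_eq0 => /eqP ->.
  by rewrite mulrN.
have q0 : 0 < 2 * m / N by rewrite divr_gt0 // mulr_gt0 // lt_neqAle eq_sym g0.
have eL : level z = 2 * m / N.
  rewrite /level hgt_Phi // -/m -/N ez minaM; last exact: ltW.
  have e := gauge_tvec sp; rewrite -/m in e.
  have e1 : d.+1%:R * mina (tvec p) = m - 1 by rewrite [in RHS]e; ring.
  have -> : d.+1%:R * (2 * m / N * mina (tvec p)) = (2 * m / N) * (m - 1) by rewrite -e1; ring.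
  by rewrite expr2; ring.
apply: toP_id => // x xc; rewrite /psi eL ez mulrC mulKf ?gt_eqF // /tvec rnkK //.
by rewrite addrC subrK.
Qed.

Lemma cvg_psi (Z : Type) (F : set_system Z) (w : Z -> 'rV[R]_d.+1) (w0 : 'rV[R]_d.+1) :
  Filter F -> (\forall z \near F, sphere R d (w z)) -> sphere R d w0 -> hgt w0 != 0 ->
  w z @[z --> F] --> w0 -> toP p0 c (psi (w z)) @[z --> F] --> toP p0 c (psi w0).
Proof.
move=> FF hF sw0 h0 ww; have L0 := level_gt0 sw0 h0.
have nb : nbhs (hgt w0) [set x | x != 0] by apply: open_nbhs_nbhs; split => //; exact: open_neq.
have hn : \forall z \near F, hgt (w z) != 0 by exact: (cvg_hgt ww nb).
apply: (@cvg_point _ _ _ _ _ _ _ _ _ hc); first exact: simp_psi.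
  by apply: filterS2 hF hn => z sz hz; exact: simp_psi.
move=> x xc; have -> : val (toP p0 c (psi w0)) x = psi w0 x by rewrite (toPE _ hc (valid_psi sw0 h0)) xc.
have : psi (w z) x @[z --> F] --> psi w0 x.
  apply: cvgD; first exact: cvg_cst.
  apply: cvgM; first exact: cvg_tang.
  by apply: cvgV; [exact: lt0r_neq0|exact: cvg_level].
apply: cvg_trans; apply: near_eq_cvg; apply: filterS2 hF hn => z sz hz.
by rewrite (toPE _ hc (valid_psi sz hz)) xc.
Qed.

Lemma cont_Phi : cont_on (simp c) (fun p => Phi (tvec p) (gauge c p)).
Proof.
move=> p sp; apply: cvg_within_filter; apply: cvg_Phi; last exact: tvec_ne0.
  move=> i; apply: cvgB; last exact: cvg_cst.
  exact: (@bary_continuous R disp T (enu i) p).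
by apply: cvgM; [exact: cvg_cst|exact: (@minc_continuous R disp T c p)].
Qed.

End CellCoordinates.

(** * The two maps and their homotopies *)

Section Bouquet.
Context {R : realType} {disp : Order.disp_t} {T : porderType disp} (d : nat).
Local Notation K := (realization R T).
Implicit Types (p : K) (c : {fset T}) (t : R).
Variables (x0 : T) (p0 : K) (crit : {fset T} -> bool).
Hypothesis crit_max : forall c c', chainf c' -> crit c -> (c `<=` c')%fset -> c' = c /\ #|` c| = d.+1.
Variable H : K * R -> K.
Hypothesis H_cont : forall c, chainf c -> ~~ crit c -> cont_on (simp c `*` uniti R) H.
Hypothesis H_0 : forall p, noncrit crit p -> H (p, 0) = p.
Hypothesis H_noncrit : forall p t, noncrit crit p -> noncrit crit (H (p, t)).
Hypothesis H_late : forall p t, noncrit crit p -> 2^-1 <= t -> H (p, t) = p0.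
Hypothesis p0_noncrit : noncrit crit p0.

Definition cellT : choiceType := {c : {fset T} | crit c && `[< chainf c >]}.
Local Notation W := (bouquet R d cellT).
Implicit Types i : cellT.
Local Notation GG := (G p0 crit d H).
Local Notation gauge := (gauge d).

Lemma cell_crit i : crit (val i). Proof. by have /andP[] := valP i. Qed.
Lemma cell_chain i : chainf (val i). Proof. by have /andP[_ /asboolP] := valP i. Qed.
Lemma cell_card i : #|` val i| = d.+1.
Proof. exact: (card_crit crit_max (@cell_chain i) (cell_crit i)). Qed.

Definition toS i (z : 'rV[R]_d.+1) : bouquet_summand R d (Some i) :=
  insubd (bouquet_base R d (Some i)) z.
Definition lift_o (o : option cellT) : bouquet_summand R d o -> W := @wedge_lift _ _ (bouquet_base R d (I := cellT)) o.
Definition wbase : W := lift_o (bouquet_base R d (None : option cellT)).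
Definition cell i z : W := lift_o (toS i z).

Lemma val_toS i z : sphere R d z -> val (toS i z) = z.
Proof. by move=> sz; rewrite /toS val_insubd mem_set. Qed.

Lemma toS_val i (s : bouquet_summand R d (Some i)) : toS i (val s) = s.
Proof. by apply: val_inj; rewrite val_toS //; exact: set_mem (valP s). Qed.

Lemma cell_base i : cell i (sphere_base R d) = wbase.
Proof.
rewrite /wbase /cell -[sphere_base R d]/(val (bouquet_base R d (Some i))) toS_val.
exact: (@wedge_liftE (option cellT) _ (bouquet_base R d (I := cellT)) None
  (bouquet_base R d (None : option cellT)) (Some i) (bouquet_base R d (Some i))).
Qed.

Lemma cvg_cell i (Z : Type) (F : set_system Z) (w : Z -> 'rV[R]_d.+1) (w0 : 'rV[R]_d.+1) :
  Filter F -> (\forall z \near F, sphere R d (w z)) -> sphere R d w0 ->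
  w z @[z --> F] --> w0 -> cell i (w z) @[z --> F] --> cell i w0.
Proof.
move=> FF hF sw0 ww; apply: (@cvg_comp _ _ _ (fun z => toS i (w z)) (@lift_o (Some i)) F (nbhs (toS i w0))).
  apply: cvg_set_type; rewrite val_toS //.
  apply: cvg_trans ww; apply: near_eq_cvg; apply: filterS hF => z sz; by rewrite val_toS.
exact: wedge_lift_continuous.
Qed.

Definition fK p : W :=
  if insub (supp p) is Some i then cell i (Phi (tvec x0 (val i) p) (gauge (val i) p)) else wbase.

Lemma fK_noncrit p : noncrit crit p -> fK p = wbase.
Proof. by move=> /negPf np; rewrite /fK insubF // np. Qed.

(** On the boundary the gauge is zero and [Phi] takes the base value, so the cell formula extends to
    the closed simplex; continuity follows simplex by simplex. *)
Lemma fK_cell i p : simp (val i) p ->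
  fK p = cell i (Phi (tvec x0 (val i) p) (gauge (val i) p)).
Proof.
move=> sp; have [cs|ns] := boolP (crit (supp p)).
  have e := supp_crit crit_max (@cell_chain i) sp cs.
  by rewrite /fK e valK.
have g0 := supp_noncrit d (cell_crit i) sp ns.
have := tvec_ne0 x0 (cell_card i) sp; rewrite g0 expr0n addr0 => k.
by rewrite fK_noncrit // Phi_base // cell_base.
Qed.

Lemma fK_cont_cell i : cont_on (simp (val i)) fK.
Proof.
apply: (@cont_on_eq _ _ _ (fun p => cell i (Phi (tvec x0 (val i) p) (gauge (val i) p)))).
  by move=> p sp; rewrite (fK_cell sp).
move=> p sp; apply: cvg_cell.
- rewrite near_withinE; apply: nearW => q sq; apply: Phi_sphere.
  exact: (tvec_ne0 x0 (cell_card i) sq).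
- apply: Phi_sphere; exact: (tvec_ne0 x0 (cell_card i) sp).
exact: (@cont_Phi _ _ _ _ x0 (val i) (cell_card i) p sp).
Qed.

Lemma fK_continuous : continuous fK.
Proof.
apply: realization_continuous => c hc; have [cc|nc] := boolP (crit c); last first.
  apply: (@cont_on_eq _ _ _ (fun=> wbase)).
    by move=> p sp; rewrite fK_noncrit //; exact: (noncrit_simp crit_max hc nc).
  by move=> p sp; exact: cvg_cst.
have pc : crit c && `[< chainf c >] by rewrite cc; apply/asboolP.
exact: (@fK_cont_cell (exist _ c pc)).
Qed.

(** The base point has its own clause because [level], the denominator in [psi], vanishes there. *)
Definition gcell i (z : 'rV[R]_d.+1) : K :=
  if hgt z == 0 then p0 else GG (toP p0 (val i) (psi (val i) z), 1).

Lemma gcell_near_base i z : sphere R d z -> 4 * hgt z <= level z -> gcell i z = p0.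
Proof.
move=> sz h; rewrite /gcell; case: eqVneq => // h0; have L0 := level_gt0 sz h0.
apply: (@G_1 _ _ _ _ _ _ crit_max _ H_0 H_late (val i)).
- exact: cell_chain.
- exact: cell_crit.
- exact: (simp_psi x0 p0 (@cell_chain i) (cell_card i)).
rewrite (gauge_psi x0 p0 (@cell_chain i) (cell_card i)) //.
by rewrite mulrA ler_pdivrMr // mul1r.
Qed.

(** Near the base point the gauge is at most 1/4, so [G_1] makes the map constant; elsewhere [psi]
    and [G] are continuous. *)
Lemma gcell_cont i : cont_on (sphere R d) (gcell i).
Proof.
have hc := @cell_chain i; have cd := cell_card i.
move=> z0 sz0; have ww : z @[z --> within (sphere R d) (nbhs z0)] --> z0 by exact: cvg_within.
have sF : \forall z \near within (sphere R d) (nbhs z0), sphere R d z.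
  by rewrite near_withinE; apply: nearW.
have [h0|h0] := eqVneq (hgt z0) 0.
  have -> : gcell i z0 = p0 by rewrite /gcell h0 eqxx.
  have e0 := hgt0 sz0 h0.
  have n1 : \forall z \near within (sphere R d) (nbhs z0), 0 < (z : 'rV[R]_d.+1) 0 ord0.
    have nb : nbhs (z0 0 ord0) [set x : R | 0 < x].
      by apply: open_nbhs_nbhs; split; [exact: open_gt|rewrite /= e0 mxE !eqxx].
    exact: (cvg_coord ww nb).
  pose S (z : 'rV[R]_d.+1) : R := 4 * d%:R * (\sum_(j < d) `|z 0 (lift ord0 j)|).
  have n2 : \forall z \near within (sphere R d) (nbhs z0), S z < 1.
    have cS : S z @[z --> within (sphere R d) (nbhs z0)] --> S z0.
      apply: cvgM; first exact: cvg_cst.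
      by apply: cvg_sumr => j; apply: cvg_norm; exact: cvg_coord.
    have S0 : S z0 = 0.
      by rewrite /S big1 ?mulr0 // => j _; rewrite e0 /sphere_base mxE eqxx [lift _ _ == _]eq_sym eq_liftF normr0.
    have nb : nbhs (S z0) [set x : R | x < 1].
      by apply: open_nbhs_nbhs; split; [exact: open_lt|rewrite /= S0 ltr01].
    exact: (cS _ nb).
  have e : {near within (sphere R d) (nbhs z0), (fun=> p0) =1 gcell i}.
    apply: filterS3 sF n1 n2 => z sz h1 h2.
    by rewrite gcell_near_base //; apply: level_near_base => //; exact: ltW.
  by apply: cvg_trans (near_eq_cvg e) _; exact: cvg_cst.
have nb : nbhs (hgt z0) [set x | x != 0] by apply: open_nbhs_nbhs; split => //; exact: open_neq.
have hn : \forall z \near within (sphere R d) (nbhs z0), hgt z != 0 by exact: (cvg_hgt ww nb).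
have -> : gcell i z0 = GG (toP p0 (val i) (psi (val i) z0), 1) by rewrite /gcell (negPf h0).
have u1 : uniti R 1 by rewrite /uniti /= in_itv /= ler01 lexx.
have sp := simp_psi x0 p0 hc cd sz0 h0.
have : GG (toP p0 (val i) (psi (val i) z), 1) @[z --> within (sphere R d) (nbhs z0)]
    --> GG (toP p0 (val i) (psi (val i) z0), 1).
  have Gc := @G_cont _ _ _ _ _ _ crit_max _ H_cont H_0 _ hc (_, 1) (conj sp u1).
  move=> U /Gc; rewrite /= !nbhs_simpl /= => GU.
  have hpair : (toP p0 (val i) (psi (val i) z), (1 : R)) @[z --> within (sphere R d) (nbhs z0)]
      --> (toP p0 (val i) (psi (val i) z0), (1 : R)).
    by apply: cvg_pair_nbhs; [exact: (@cvg_psi _ _ _ _ x0 p0 _ hc cd _ _ _ _ _ sF sz0 h0 ww)|exact: cvg_cst].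
  have := hpair _ GU; rewrite /= !nbhs_simpl /= => h.
  apply: filterS3 sF hn h => z sz hz; apply; split => //=.
  exact: simp_psi.
apply: cvg_trans; apply: near_eq_cvg; apply: filterS hn => z /negPf hz.
by rewrite /gcell hz.
Qed.

Definition gpart (o : option cellT) : bouquet_summand R d o -> K :=
  if o is Some i then fun s => gcell i (val s) else fun=> p0.

Lemma gpart_base o o' : gpart (bouquet_base R d o) = gpart (bouquet_base R d o').
Proof.
suff h o1 : gpart (bouquet_base R d o1) = p0 by rewrite !h.
by case: o1 => //= i; rewrite /gcell hgt_base eqxx.
Qed.

Definition gW : W -> K := wedge_fun gpart.

Lemma gW_lift o s : gW (@lift_o o s) = gpart s.
Proof. by apply: wedge_lift_funE; exact: gpart_base. Qed.

Lemma gW_cell i z : sphere R d z -> gW (cell i z) = gcell i z.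
Proof. by move=> sz; rewrite gW_lift /= val_toS. Qed.

Lemma gW_base : gW wbase = p0.
Proof. by rewrite gW_lift. Qed.

Lemma gW_continuous : continuous gW.
Proof.
apply: wedge_fun_continuous; last exact: gpart_base.
case=> [i|]; last exact: (@cst_continuous _ K p0).
move=> s; have sv : sphere R d (val s) by exact: set_mem (valP s).
move=> U /(gcell_cont sv); rewrite /= => h.
have := @val_continuous _ (sphere R d) s _ h; rewrite /= !nbhs_simpl /=.
apply: filterS => s' /=; apply; exact: set_mem (valP s').
Qed.

(** [psi] undoes [fK] on the interior of a critical simplex, so the composite is the final stage of
    [G], which starts at the identity. *)
Lemma gf p : gW (fK p) = GG (p, 1).
Proof.
have [np|] := boolP (noncrit crit p).
  rewrite fK_noncrit // gW_base /G /= (negPf np) H_late //.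
  by rewrite invf_le1 ?ler1n.
rewrite negbK => cs; have hs := @chainf_supp _ _ _ p.
have pc : crit (supp p) && `[< chainf (supp p) >] by rewrite cs; apply/asboolP.
pose i : cellT := exist _ (supp p) pc.
have sp : simp (val i) p by exact: simp_supp.
have k := tvec_ne0 x0 (cell_card i) sp.
rewrite (fK_cell sp) gW_cell; last exact: Phi_sphere.
have g0 : gauge (val i) p != 0.
  by apply: contraTneq cs => /(gauge0_noncrit crit_max (@cell_chain i) (cell_crit i) sp).
rewrite /gcell hgt_Phi //; last exact: cell_card.
have hp : 2 * gauge (val i) p ^+ 2 / (@sqn R d (tvec x0 (val i) p) + gauge (val i) p ^+ 2) != 0.
  by apply: mulf_neq0; [apply: mulf_neq0; [rewrite pnatr_eq0|exact: expf_neq0]|exact: invr_neq0].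
by rewrite (negPf hp) (@psi_Phi _ _ _ _ x0 p0 _ (@cell_chain i) (cell_card i) p sp g0).
Qed.

Definition dpart t (o : option cellT) : bouquet_summand R d o -> W :=
  if o is Some i then fun s => cell i (shrink (val s) t) else fun=> wbase.

Lemma dpart_base t o o' : dpart t (bouquet_base R d o) = dpart t (bouquet_base R d o').
Proof.
suff h o1 : dpart t (bouquet_base R d o1) = wbase by rewrite !h.
by case: o1 => //= i; rewrite /shrink hgt_base eqxx cell_base.
Qed.

Definition DW (u : W * R) : W := wedge_fun (@dpart u.2) u.1.

Lemma DW_lift o s t : DW (@lift_o o s, t) = dpart t s.
Proof. by apply: wedge_lift_funE; exact: dpart_base. Qed.

Lemma wedge_cover (w : W) : exists o (s : bouquet_summand R d o), lift_o s = w.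
Proof.
have : [set: W] w by [].
by rewrite -(wedgeTE (bouquet_base R d (I := cellT))) => -[oo _ [s _ e]]; exists oo, s.
Qed.

Lemma DW_0 w : DW (w, 0) = w.
Proof.
have [oo [s <-]] := wedge_cover w; rewrite DW_lift; case: oo s => [i|] s /=.
  by rewrite shrink_0 ?/cell ?toS_val //; exact: set_mem (valP s).
rewrite /wbase; congr lift_o; apply: val_inj; by have := set_mem (valP s).
Qed.

(** If the gauge is at least 1/2, the simplex point is stretched and the result is on the same ray
    as [shrink], up to the factor [2 / level z] that [Phi_scale] removes. For smaller gauge the
    point has entered the noncritical part, and both sides are the base point. *)
Lemma DW_1 w : DW (w, 1) = fK (gW w).
Proof.
have [oo [s <-]] := wedge_cover w; rewrite DW_lift gW_lift; case: oo s => [i|] s /=; last first.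
  by rewrite fK_noncrit.
have sz : sphere R d (val s) by exact: set_mem (valP s).
set z := val s in sz *; have hc := @cell_chain i; have cd := cell_card i.
rewrite /gcell /shrink; case: eqVneq => h0; first by rewrite cell_base fK_noncrit.
have L0 := level_gt0 sz h0; have sp := simp_psi x0 p0 hc cd sz h0.
have u1 : uniti R 1 by rewrite /uniti /= in_itv /= ler01 lexx.
rewrite (GE p0 crit_max H_0 hc (cell_crit i) sp u1) /Gc /= gauge_psi //.
have g1 := gauge_le1 crit_max hc (cell_crit i) sp.
have k := shrink_ne0 sz h0 (lexx 1).
rewrite -/z.
case: ifPn => [h|]; last first.
  rewrite -ltNge => h; rewrite fK_noncrit; last first.
    by apply/H_noncrit/(rad_noncrit p0 crit_max hc (cell_crit i) sp); rewrite gauge_psi //; lra.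
  have m0 : Num.max 0 (hgt z - 1 / 2 * level z) = 0.
    rewrite max_l //; move: h; rewrite mulrA ltr_pdivrMr //; lra.
  by rewrite m0 expr0n addr0 in k *; rewrite Phi_base // cell_base.
have vs := valid_stretch crit_max hc (cell_crit i) sp u1.
set P := toP p0 (val i) (psi (val i) z) in sp g1 vs *.
have gP : gauge (val i) P = hgt z / level z by exact: gauge_psi.
rewrite -gP in h; have {}vs := vs h.
have sq : simp (val i) (toP p0 (val i) (stretch d P 1)) by exact: simp_toP.
have k2 : 2 / level z != 0 by rewrite mulf_neq0 ?pnatr_eq0 // invr_neq0 // gt_eqF.
have tq : tvec x0 (val i) (toP p0 (val i) (stretch d P 1)) = fun j => 2 / level z * tang z j.
  apply: funext => j; rewrite /tvec (toPE _ hc vs) enu_in // /stretch addrC addKr.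
  rewrite -[val P _ - _]/(tvec x0 (val i) P j) tvec_psi //.
  have L1 : level z != 0 by rewrite gt_eqF.
  by field.
rewrite (fK_cell sq) tq (gauge_tvec x0 cd sq) tq minaM; last by rewrite divr_ge0 // ltW.
have -> : 1 + d.+1%:R * (2 / level z * mina (tang z)) = 2 / level z * (hgt z - 1 / 2 * level z).
  have L1 : level z != 0 by rewrite gt_eqF.
  have em : d.+1%:R * mina (tang z) = hgt z - level z by rewrite /level; ring.
  have -> : d.+1%:R * (2 / level z * mina (tang z)) = 2 / level z * (hgt z - level z) by rewrite -em; ring.
  by field.
rewrite Phi_scale // max_r //.
move: h; rewrite gP mulrA ler_pdivlMr // mul1r; lra.
Qed.

(** The wedge carries a final topology, so [tube] reduces the claim to each summand, where it is
    [cvg_shrink]. *)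
Lemma DW_cont : {within [set: W] `*` uniti R, continuous DW}.
Proof.
apply: (@tube R W W (option cellT) (fun o => bouquet_summand R d o : topologicalType) (fun=> setT) lift_o).
- move=> U hU; apply/wedge_openP => o; rewrite openE => s Us.
  by have := hU o s I Us; rewrite /within /=; apply: filterS => s' /(_ I).
- by move=> w; have [oo [s e]] := wedge_cover w; exists oo, s.
case=> [i|]; last first.
  apply: (@cont_on_eq _ _ _ (fun=> wbase)) => [[s t] _|u _]; last exact: cvg_cst.
  by rewrite DW_lift.
apply: (@cont_on_eq (bouquet_summand R d (Some i) * R)%type W _
  (fun u => cell i (shrink (val u.1) u.2))) => [[s t] _|]; first by rewrite DW_lift.
move=> [s t] [_ /= tu].
have su (s' : bouquet_summand R d (Some i)) : sphere R d (val s') by exact: set_mem (valP s').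
have tu' (t' : R) : uniti R t' -> 0 <= t' <= 1 by rewrite /uniti /= in_itv.
apply: cvg_cell.
- by rewrite near_withinE; apply: nearW => -[s' t'] [_ /tu' /= /andP[_ t1]]; exact: (shrink_sphere (su s') t1).
- by case/andP: (tu' _ tu) => _ t1; exact: (shrink_sphere (su s) t1).
apply: cvg_shrink => //; last 2 first.
- apply: cvg_within_filter.
  by apply: (@continuous_comp _ _ _ fst (fun s : bouquet_summand R d (Some i) => val s) (s, t)); [exact: cvg_fst|exact: val_continuous].
- by apply: cvg_within_filter; exact: (@cvg_snd _ _ (nbhs s) (nbhs t)).
- by rewrite near_withinE; apply: nearW => -[s' t'] [_ /tu' h]; split => //; exact: (su s').
- exact: (su s).
Qed.

Lemma unit_rev : cont_on (uniti R) (fun t : R => 1 - t) /\ forall t, uniti R t -> uniti R (1 - t).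
Proof.
split; last by move=> t; rewrite /uniti /= !in_itv /= => /andP[h1 h2]; lra.
by apply: continuous_cont_on => t; apply: cvgB; [exact: cvg_cst|exact: cvg_id].
Qed.

Lemma homotopic_rev (X Y : topologicalType) (f g : X -> Y) (F : X * R -> Y) :
  {within [set: X] `*` uniti R, continuous F} -> (forall x, F (x, 0) = f x) ->
  (forall x, F (x, 1) = g x) -> homotopic R g f.
Proof.
move=> /subspace_continuousP cF F0 F1; exists (fun u => F (u.1, 1 - u.2)); split.
- apply: cont_on_within.
  apply: (@cont_on_comp _ _ _ _ ([set: X] `*` uniti R) (fun u : X * R => (u.1, 1 - u.2)) F) => //.
    by move=> [x t] [_ /= tu]; split => //=; exact: unit_rev.2.
  apply: cont_on_pair; apply: continuous_cont_on => u; first exact: cvg_fst.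
  by apply: cvgB; [exact: cvg_cst|exact: cvg_snd].
- by move=> x; rewrite /= subr0.
- by move=> x; rewrite /= subrr.
Qed.

Lemma bouquet_equivalence : homotopy_equivalent R K W.
Proof.
exists fK, gW; split; [exact: fK_continuous|exact: gW_continuous| |].
  apply: (homotopic_rev (F := GG)).
  - exact: (G_homotopy crit_max H_cont H_0).
  - by move=> p; exact: G_0.
  by move=> p; rewrite /= gf.
apply: (homotopic_rev (F := DW)); [exact: DW_cont|exact: DW_0|].
by move=> w; rewrite /= DW_1.
Qed.

End Bouquet.

(* [c] is matched with the chain obtained by adding or removing [v c]; [r] ranks the pairs. *)
Theorem morse_bouquet (R : realType) (disp : Order.disp_t) (T : porderType disp) (d : nat)
    (crit : {fset T} -> bool) (v : {fset T} -> T) (r : {fset T} -> nat) :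
  (forall c, chainf c -> ~~ crit c -> chainf (v c |` c)%fset) ->
  (forall c c', chainf c -> ~~ crit c -> (c `\ v c `<=` c')%fset -> (c' `<=` v c |` c)%fset ->
     [/\ ~~ crit c', v c' = v c & r c' = r c]) ->
  (forall c c', chainf c' -> ~~ crit c -> ~~ crit c' -> (c `<=` c')%fset ->
     (r c <= r c')%N /\ (r c = r c' -> v c = v c' /\ (v c |` c = v c' |` c')%fset)) ->
  (forall c c', chainf c' -> crit c -> (c `<=` c')%fset -> c' = c /\ #|` c| = d.+1) ->
  exists I : choiceType, homotopy_equivalent R (realization R T) (bouquet R d I).
Proof.
move=> h1 h2 h3 h4; have [H [p0 [cH H0 Hn H1 n0]]] := @collapse R disp T crit v r d h1 h2 h3 h4.
by exists (cellT crit); exact: (@bouquet_equivalence R disp T d (v fset0) p0 crit h4 H).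
Qed.

Close Scope ring_scope.
Unset Implicit Arguments.

Theorem theorem1p1 (R : realType) (n : nat) (hn : 2 <= n) :
  exists I : choiceType,
    homotopy_equivalent R (realization R (FC n)) (bouquet R (n - 2) I).
Proof.
have [crit [v [r [h1 h2 h3 h4]]]] := chain_matching hn.
(* Critical chains have [n.-1] members, and this is [(n - 2).+1] because [2 <= n]. *)
apply: (@morse_bouquet R _ (FC n) (n - 2) crit v r h1 h2 h3) => c c' hc' cc s; have [-> ->] := h4 c c' hc' cc s.
by split => //; move: hn; clear; case: n => [|[|m]] //= _; rewrite subn2.
Qed.
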